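(* For each fixed $T>0$: (1) $\mathcal{R}^+=\{f\in hol(Q_\infty):\ f(z+1)=f(z)=-f(-z)\ \text{ for all } z\in Q_\infty,\ f|_Q\in\mathcal{H}^+_T(Q)\}$, where $\mathcal{H}^+_T(Q)$ is the reproducing kernel Hilbert space on $Q$ with reproducing kernel $$\mathcal{K}_+(z,w;T)=\sum_{m,n\in\mathbb{Z}}\mathcal{K}_0(z+n,w+m;T)=\mathcal{K}_\ell(z,w;T)+\mathcal{K}_\ell(z+1,w+1;T)+\mathcal{K}_\ell(z+1,w;T)+\mathcal{K}_\ell(z,w+1;T),$$ for $z,w\in Q$. The space $\mathcal{H}^+_T(Q)$ is endowed with the norm $\|f\|_{\mathcal{H}^+_T(Q)}=\inf\{\|u\|_{L^2_{\mathbb{C}}(0,T)}:\ f=-2\mathcal{L}^+_Tu,\ u\in L^2_{\mathbb{C}}(0,T)\}$. (2) $\mathcal{R}^-=\{f\in hol(Q_\infty):\ -f(z+1)=f(z)=-f(-z)\ \text{ for all } z\in Q_\infty,\ f|_Q\in\mathcal{H}^-_T(Q)\}$, where $\mathcal{H}^-_T(Q)$ is the reproducing kernel Hilbert space on $Q$ with reproducing kernel $$\mathcal{K}_-(z,w;T)=\mathcal{K}_\ell(z,w;T)+\mathcal{K}_\ell(z+1,w+1;T)-\mathcal{K}_\ell(z+1,w;T)-\mathcal{K}_\ell(z,w+1;T),$$ for $z,w\in Q$. The space $\mathcal{H}^-_T(Q)$ is endowed with the norm $\|f\|_{\mathcal{H}^-_T(Q)}=\inf\{\|u\|_{L^2_{\mathbb{C}}(0,T)}:\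 f=-2\mathcal{L}^-_Tu,\ u\in L^2_{\mathbb{C}}(0,T)\}$.
   Context: Identify $\mathbb{R}^2$ with $\mathbb{C}$. Let $Q=\{x+iy: |y|<x,\ |y|<1-x\}$, $Q_\infty=\bigcup_{n\in\mathbb{Z}}(n+Q)$ and $D=\{x+iy: |y|<x,\ |y|<2-x\}$ (so $Q\subset D$ and $1+Q\subset D$). For an open set $\Omega\subset\mathbb{C}$, $hol(\Omega)$ is the set of analytic functions on $\Omega$. $L^2_{\mathbb{C}}(0,T)$ is the space of complex-valued square integrable functions on $(0,T)$. Kernels: $$\mathcal{K}_0(z,w;T)=\frac{z\overline{w}}{\pi}e^{-\frac{z^2+\overline{w}^2}{4T}}\left(\frac{1}{(z^2+\overline{w}^2)^2}+\frac{1}{4T(z^2+\overline{w}^2)}\right)$$ whenever $z^2+\overline{w}^2\neq 0$, and $\mathcal{K}_\ell(z,w;T)=\sum_{m,n\in\mathbb{Z}}\mathcal{K}_0(z+2n,w+2m;T)$ for $z,w\in D$. Heat kernel: $K(x,t)=\frac{1}{\sqrt{4\pi t}}e^{-x^2/(4t)}$ for $t>0$; $\theta(x,t)=\sum_{n\in\mathbb{Z}}K(x+2n,t)$; for $z\in\mathbb{C}$, $(\partial_xK)(z,t)=-\frac{z}{4\sqrt{\pi}\,t^{3/2}}e^{-z^2/(4t)}$, and $(\partial_x\theta)(z,t)=\sum_{n\in\mathbb{Z}}(\partial_xK)(z+2n,t)$. Control system: $\partial_tw-\partial_{xx}w=0$ for $0<x<1$, $0<t<T$; $w(0,t)=u_\ell(t)$,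 $w(1,t)=u_r(t)$ for $0<t<T$; $w(x,0)=0$ for $0<x<1$. For $u_\ell,u_r\in L^2_{\mathbb{C}}(0,T)$ its solution is the unique $w\in C([0,T],W^{-1,2}(0,1))$ given by $$w(x,t)=-2\int_0^t(\partial_x\theta)(x,t-\tau)u_\ell(\tau)\,d\tau+2\int_0^t(\partial_x\theta)(x-1,t-\tau)u_r(\tau)\,d\tau.$$ $\mathcal{R}^+_T$ (respectively $\mathcal{R}^-_T$) is the set of all $w(\cdot,T)$ where $w$ is the solution with $u_\ell\in L^2_{\mathbb{C}}(0,T)$ and $u_r=-u_\ell$ (respectively $u_r=u_\ell$). These spaces do not depend on $T>0$ and are denoted $\mathcal{R}^+$, $\mathcal{R}^-$. Their elements are identified with their analytic extensions from $(0,1)$ to $Q_\infty$ given by the same integral formula with $x$ replaced by $z\in Q_\infty$. The operators $\mathcal{L}^{\pm}_T:L^2_{\mathbb{C}}(0,T)\to hol(Q)$ are $(\mathcal{L}^{\pm}_Tu)(z)=\int_0^T[(\partial_x\theta)(z,T-\tau)\pm(\partial_x\theta)(z+1,T-\tau)]u(\tau)\,d\tau$, $z\in Q$.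
   Formalization: The stated norm inf{‖u‖ : f = −2L^±u} is not the norm of the space with kernel K_±: since K_± is the Gram kernel of L^±, it belongs to 4K_±. The formal theorem instead proves ‖f‖ = 2·inf{‖u‖ : f = −2L^±u} for the space with kernel K_±. *)

(* Defs.v *)
From HB Require Import structures.
From mathcomp Require Import all_boot all_order all_algebra.
From mathcomp Require Import complex.
From mathcomp Require Import all_classical all_reals all_analysis.
From mathcomp Require summability.

Set Implicit Arguments.
Unset Strict Implicit.
Unset Printing Implicit Defensive.
Import Order.TTheory GRing.Theory Num.Theory.
Import numFieldNormedType.Exports.

Local Open Scope classical_set_scope.
Local Open Scope ring_scope.
Local Open Scope complex_scope.

(* [R[i]] carries the topology and the normed [R[i]]-module structure of the
   numeric field it is, so that [derivable _ z 1] is complex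
   differentiability. *)
#[warnings="-redundant-canonical-projection"]
HB.instance Definition _ (R : rcfType) := NormedModule.copy R[i] R[i]^o.

Section Domains.
Context {R : realType}.

Definition Qsq : set R[i] :=
  [set z | `|complex.Im z| < complex.Re z /\
           `|complex.Im z| < 1 - complex.Re z].

Definition Qinf : set R[i] :=
  \bigcup_(n in [set: int]) [set n%:~R + z | z in Qsq].

(* Meant for open [Omega]; depends only on the values of [f] on [Omega]. *)
Definition hol (Omega : set R[i]) : set (R[i] -> R[i]) :=
  [set f | forall z, Omega z -> derivable f z 1].

End Domains.

Section ComplexAnalysis.
Context {R : realType}.

Definition expC (z : R[i]) : R[i] :=
  (expR (complex.Re z))%:C
    * (cos (complex.Im z) +i* sin (complex.Im z)).

(* Unconditional sum: limit of the partial sums along the finite subsets of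
   the index set. *)
Definition sumC (I : choiceType) (x : I -> R[i]) : R[i] :=
  summability.sum x.

Definition itv0 (T : R) : set R := `]0, T[.

Definition intC (T : R) (g : R -> R[i]) : R[i] :=
  (\int[lebesgue_measure]_(t in itv0 T) complex.Re (g t)) +i*
  (\int[lebesgue_measure]_(t in itv0 T) complex.Im (g t)).

Definition sqnorm (z : R[i]) : R := complex.Re z ^+ 2 + complex.Im z ^+ 2.

Definition L2C (T : R) : set (R -> R[i]) :=
  [set u | [/\ measurable_fun (itv0 T) (fun t => complex.Re (u t)),
               measurable_fun (itv0 T) (fun t => complex.Im (u t)) &
               (\int[lebesgue_measure]_(t in itv0 T)
                  (sqnorm (u t))%:E < +oo)%E]].

Definition L2norm (T : R) (u : R -> R[i]) : R :=
  Num.sqrt (\int[lebesgue_measure]_(t in itv0 T) sqnorm (u t)).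

End ComplexAnalysis.

Section RKHS.
Context {R : realType} {X : Type}.
Implicit Types (H : set (X -> R[i])) (ip : (X -> R[i]) -> (X -> R[i]) -> R[i]).

Definition ipnorm ip (f : X -> R[i]) : R := Num.sqrt (complex.Re (ip f f)).

(* [H], with the inner product [ip] (only its values on [H] matter), is the
   Hilbert space of functions on [X] with reproducing kernel [K].  In [R[i]],
   [0 <= c] says that [c] is real and nonnegative. *)
Record is_rkhs H ip (K : X -> X -> R[i]) : Prop := IsRKHS {
  rkhs0 : H (fun=> 0);
  rkhsP : forall (a : R[i]) f g, H f -> H g -> H (fun x => a * f x + g x);
  ip_linear : forall (a : R[i]) f g h, H f -> H g -> H h ->
    ip (fun x => a * f x + g x) h = a * ip f h + ip g h;
  ip_conj : forall f g, H f -> H g -> ip g f = (ip f g)^*;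
  ip_ge0 : forall f, H f -> 0 <= ip f f;
  ip_def : forall f, H f -> ip f f = 0 -> f = (fun=> 0);
  rkhs_complete : forall f_ : nat -> X -> R[i], (forall n, H (f_ n)) ->
    (forall e : R, 0 < e -> exists N : nat, forall m n : nat,
       (N <= m)%N -> (N <= n)%N ->
       ipnorm ip (fun x => f_ m x - f_ n x) < e) ->
    exists2 f, H f & forall e : R, 0 < e -> exists N : nat, forall n : nat,
       (N <= n)%N -> ipnorm ip (fun x => f_ n x - f x) < e;
  kernel_mem : forall w, H (fun z => K z w);
  reproducing : forall f w, H f -> f w = ip f (fun z => K z w) }.

End RKHS.

Section Heat.
Context {R : realType}.
Implicit Types (z w : R[i]) (t T : R) (u ul ur : R -> R[i]).

(* The value where [z ^+ 2 + w^* ^+ 2 = 0] is junk. *)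
Definition K0 T z w : R[i] :=
  let s := z ^+ 2 + w^* ^+ 2 in
  z * w^* / pi%:C * expC (- (s / (4 * T)%:C))
    * ((s ^+ 2)^-1 + ((4 * T)%:C * s)^-1).

Definition Kl T z w : R[i] :=
  sumC (fun p : int * int => K0 T (z + 2 * p.2%:~R) (w + 2 * p.1%:~R)).

Definition Kplus T z w : R[i] :=
  sumC (fun p : int * int => K0 T (z + p.2%:~R) (w + p.1%:~R)).

Definition Kminus T z w : R[i] :=
  Kl T z w + Kl T (z + 1) (w + 1) - Kl T (z + 1) w - Kl T z (w + 1).

(* [z]-derivatives of the heat kernel [exp (- z^2 / (4 t)) / sqrt (4 pi t)] and
   of its 2-periodization, for [t > 0]. *)
Definition dxK z t : R[i] :=
  - (z / (4 * Num.sqrt pi * t `^ (3 / 2))%:C) * expC (- (z ^+ 2 / (4 * t)%:C)).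

Definition dxtheta z t : R[i] := sumC (fun n : int => dxK (z + 2 * n%:~R) t).

(* Integral representation of the solution on (0,1) with zero initial datum and
   Dirichlet controls [ul] at 0 and [ur] at 1; the space variable is allowed to
   be complex, which gives the analytic extension to [Qinf]. *)
Definition heat_sol ul ur z t : R[i] :=
  - 2 * intC t (fun tau => dxtheta z (t - tau) * ul tau)
  + 2 * intC t (fun tau => dxtheta (z - 1) (t - tau) * ur tau).

(* States reachable in time [T], as analytic functions on [Qinf]: membership
   only constrains the values of [f] there. *)
Definition reach_plus T : set (R[i] -> R[i]) :=
  [set f | exists2 u, L2C T u &
     forall z, Qinf z -> f z = heat_sol u (fun t => - u t) z T].

Definition reach_minus T : set (R[i] -> R[i]) :=
  [set f | exists2 u, L2C T u &
     forall z, Qinf z -> f z = heat_sol u u z T].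

Definition Lplus T u z : R[i] :=
  intC T (fun tau =>
    (dxtheta z (T - tau) + dxtheta (z + 1) (T - tau)) * u tau).

Definition Lminus T u z : R[i] :=
  intC T (fun tau =>
    (dxtheta z (T - tau) - dxtheta (z + 1) (T - tau)) * u tau).

Definition onQ (f : R[i] -> R[i]) : Qsq (R := R) -> R[i] :=
  fun z : Qsq (R := R) => f (val z).

Definition kernel_onQ (K : R[i] -> R[i] -> R[i]) :
    Qsq (R := R) -> Qsq (R := R) -> R[i] :=
  fun z w : Qsq (R := R) => K (val z) (val w).

(* Quotient norm on the range of [- 2 L].  Since
   [K0 T z w = \int_0^T dxK z t * (dxK w t)^* dt], without any factor [4], the
   kernel of the range of [- 2 L] normed in this way is [4 Kplus] (resp.
   [4 Kminus]); hence the norm of the space with kernel [Kplus]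
   (resp. [Kminus]) is [2 * control_norm]. *)
Definition control_norm (L : (R -> R[i]) -> R[i] -> R[i]) T
    (f : Qsq (R := R) -> R[i]) : R :=
  inf [set r | exists u, [/\ L2C T u,
                             f = onQ (fun z => - 2 * L u z) &
                             r = L2norm T u]].

End Heat.

(* Main.v *)
Require Import Defs.
From HB Require Import structures.
From mathcomp Require Import all_boot all_order all_algebra.
From mathcomp Require Import finmap complex.
From mathcomp Require Import all_classical all_reals all_analysis.
From mathcomp Require Import measurable_realfun.
From mathcomp Require summability.
From mathcomp Require Import ring lra zify.

Set Implicit Arguments.
Unset Strict Implicit.
Unset Printing Implicit Defensive.
Import Order.TTheory GRing.Theory Num.Theory.
Import numFieldNormedType.Exports.

Local Open Scope classical_set_scope.
Local Open Scope ring_scope.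
Local Open Scope complex_scope.

(** For [z] in [Q] and every integer [n], the translate [z + n] lies in a sector
    where [Re ((z + n) ^ 2)] dominates a multiple of [(1 + `|n|) ^ 2]
    ([Qsq_translates]).  There the heat kernels [dxK (z + n) t] are bounded
    uniformly in [0 < t < T], with a bound that is summable over [n]
    ([dxK_bound]).  Hence the theta series converge normally, and
    [dxtheta z (T - t) + sg * dxtheta (z + 1) (T - t)], written [Phi z t], is for
    each [z] a bounded function of [t]; the sign [sg] is [1] for the first
    statement and [-1] for the second one.

    The control operator is therefore [u |-> <u, (Phi z)^*>], the coefficient
    function of [u] along a family of elements of the Hilbert space
    [L^2(0, T)].  The space of such coefficient functions, normed as the
    quotient of [L^2(0, T)] by the kernel of the operator, always is the
    reproducing kernel Hilbert space of the Gram kernel of the family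
    ([range_space_rkhs], [range_space_norm]): each function has a unique
    preimage of minimal norm, the one orthogonal to the kernel.  This rests on
    the completeness of [L^2] ([L2_complete]).  A state is [-2] times the value
    of the operator, whence the factor 2 between the two norms.

    The Gram kernel is computed by integrating the double series of products
    of heat kernels term by term ([has_sum_K0]); each term is a Laplace
    integral with an explicit primitive, and equals [K0] ([K0_integral]).
    This identifies the Gram kernel with [Kplus] or [Kminus].

    It remains to compare functions on [Q] and on [Qinf].  The symmetries of
    [dxtheta] make every reachable state odd and [sg]-periodic, and a Taylor
    estimate of the heat kernel, uniform in [t] and summable over the
    translates ([dxK_taylor]), allows to differentiate under the integral and
    the sum, so that the state is holomorphic.  Conversely a function with
    these symmetries is determined by its restriction to [Q]
    ([symmetric_ext]), so it is reachable as soon as that restriction is in the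
    range ([reachable_iff]). *)

(** * The modulus and the exponential of complex numbers *)

(** The modulus as an element of [R], the norm of [R[i]] being complex. *)
Definition cmod {R : rcfType} (z : R[i]) : R := ComplexField.Normc.normc z.

Section ComplexModulus.
Context {R : realType}.
Implicit Types (z w : R[i]) (x y : R).

Lemma cmodE z : `|z| = (cmod z)%:C.
Proof. by []. Qed.

Lemma cmod_sqrt z :
  cmod z = Num.sqrt (complex.Re z ^+ 2 + complex.Im z ^+ 2).
Proof. by case: z. Qed.

Lemma cmod_sqr z : cmod z ^+ 2 = sqnorm z.
Proof. by rewrite cmod_sqrt sqr_sqrtr // addr_ge0 ?sqr_ge0. Qed.

Lemma cmod_ge0 z : 0 <= cmod z.
Proof. by rewrite cmod_sqrt sqrtr_ge0. Qed.

Lemma cmod0 : cmod (0 : R[i]) = 0.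
Proof. exact: ComplexField.Normc.normc0. Qed.

Lemma cmod_eq0 z : cmod z = 0 -> z = 0.
Proof. exact: ComplexField.Normc.eq0_normc. Qed.

Lemma cmod_gt0 z : (0 < cmod z) = (z != 0).
Proof.
rewrite lt_neqAle cmod_ge0 andbT eq_sym; congr negb.
by apply/eqP/eqP => [/cmod_eq0 //|->]; rewrite cmod0.
Qed.

Lemma cmodM z w : cmod (z * w) = cmod z * cmod w.
Proof. exact: ComplexField.Normc.normcM. Qed.

Lemma cmodV z : cmod z^-1 = (cmod z)^-1.
Proof. exact: ComplexField.Normc.normcV. Qed.

Lemma cmodD z w : cmod (z + w) <= cmod z + cmod w.
Proof. exact: le_normcD. Qed.

Lemma cmodN z : cmod (- z) = cmod z.
Proof. exact: normcN. Qed.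

Lemma cmodB z w : cmod (z - w) <= cmod z + cmod w.
Proof. by rewrite -(cmodN w) cmodD. Qed.

Lemma cmodC z w : cmod (z - w) = cmod (w - z).
Proof. by rewrite -cmodN opprB. Qed.

Lemma cmodX z n : cmod (z ^+ n) = cmod z ^+ n.
Proof.
elim: n => [|n IH]; first by rewrite !expr0 /cmod ComplexField.Normc.normc1.
by rewrite !exprS cmodM IH.
Qed.

Lemma cmod_conj z : cmod z^* = cmod z.
Proof. by case: z => a b; rewrite /cmod /= sqrrN. Qed.

Lemma cmod_real x : cmod x%:C = `|x|.
Proof. by rewrite /cmod /= expr0n addr0 sqrtr_sqr. Qed.

Lemma cmod_nat n : cmod (n%:R : R[i]) = n%:R.
Proof. by rewrite -(rmorph_nat (real_complex R)) cmod_real normr_nat. Qed.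

Lemma cmod_Re z : `|complex.Re z| <= cmod z.
Proof.
by rewrite cmod_sqrt -sqrtr_sqr ler_wsqrtr// lerDl sqr_ge0.
Qed.

Lemma cmod_Im z : `|complex.Im z| <= cmod z.
Proof.
by rewrite cmod_sqrt -sqrtr_sqr ler_wsqrtr// lerDr sqr_ge0.
Qed.

Lemma cmod_le z : cmod z <= `|complex.Re z| + `|complex.Im z|.
Proof.
case: z => a b; rewrite cmod_sqrt /=.
rewrite -[leRHS]ger0_norm ?addr_ge0// -sqrtr_sqr ler_wsqrtr// sqrrD.
by rewrite !real_normK ?num_real// lerD2r lerDl mulrn_wge0 // mulr_ge0.
Qed.

Lemma cmod_sum (I : Type) (r : seq I) (P : pred I) (F : I -> R[i]) :
  cmod (\sum_(i <- r | P i) F i) <= \sum_(i <- r | P i) cmod (F i).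
Proof.
elim/big_rec2: _ => [|i y1 y2 _ h]; first by rewrite cmod0.
by rewrite (le_trans (cmodD _ _))// lerD2l.
Qed.

Lemma ReD z w : complex.Re (z + w) = complex.Re z + complex.Re w.
Proof. by case: z w => [? ?] [? ?]. Qed.
Lemma ImD z w : complex.Im (z + w) = complex.Im z + complex.Im w.
Proof. by case: z w => [? ?] [? ?]. Qed.
Lemma ReN z : complex.Re (- z) = - complex.Re z.
Proof. by case: z. Qed.
Lemma ImN z : complex.Im (- z) = - complex.Im z.
Proof. by case: z. Qed.
Lemma ReM z w : complex.Re (z * w) =
  complex.Re z * complex.Re w - complex.Im z * complex.Im w.
Proof. by case: z w => [? ?] [? ?]. Qed.
Lemma ImM z w : complex.Im (z * w) =
  complex.Re z * complex.Im w + complex.Im z * complex.Re w.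
Proof. by case: z w => [? ?] [? ?]. Qed.
Lemma ReJ z : complex.Re z^* = complex.Re z.
Proof. by case: z. Qed.
Lemma ImJ z : complex.Im z^* = - complex.Im z.
Proof. by case: z. Qed.
(** The same notation denotes one conjugation or the other, depending on the
    operation that encloses it. *)
Lemma conjE z : Num.conj z = conjc z. Proof. by []. Qed.
Lemma conjN z : conjc (- z) = - conjc z. Proof. exact: rmorphN. Qed.
Lemma conjD z w : conjc (z + w) = conjc z + conjc w.
Proof. exact: rmorphD. Qed.
Lemma conjM z w : conjc (z * w) = conjc z * conjc w.
Proof. exact: rmorphM. Qed.
Lemma conjX z n : conjc (z ^+ n) = conjc z ^+ n.
Proof. exact: rmorphXn. Qed.
Lemma Re_real x : complex.Re x%:C = x. Proof. by []. Qed.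
Lemma Im_real x : complex.Im x%:C = 0. Proof. by []. Qed.
Lemma complexP z w : complex.Re z = complex.Re w ->
  complex.Im z = complex.Im w -> z = w.
Proof. by case: z w => [? ?] [? ?] /= -> ->. Qed.
Lemma Re_int (n : int) : complex.Re (n%:~R : R[i]) = n%:~R.
Proof. by rewrite -(rmorph_int (real_complex R)). Qed.
Lemma Im_int (n : int) : complex.Im (n%:~R : R[i]) = 0.
Proof. by rewrite -(rmorph_int (real_complex R)). Qed.

Lemma Re_pair x y : complex.Re (x +i* y) = x. Proof. by []. Qed.
Lemma Im_pair x y : complex.Im (x +i* y) = y. Proof. by []. Qed.

Definition ReImE := (ReD, ImD, ReN, ImN, ReM, ImM, ReJ, ImJ, Re_real, Im_real,
  Re_int, Im_int, Re_pair, Im_pair).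

End ComplexModulus.

Section ComplexExponential.
Context {R : realType}.
Implicit Types (z w : R[i]) (x y : R).

Let cosD_ x y : cos (x + y) = cos x * cos y - sin x * sin y.
Proof. exact: cosD. Qed.

Lemma expCD z w : expC (z + w) = expC z * expC w.
Proof.
rewrite /expC !ReImE expRD cosD_ sinD.
by apply: complexP; rewrite !ReImE; ring.
Qed.

Lemma expC_conj z : expC z^* = (expC z)^*.
Proof.
rewrite /expC !ReImE cosN sinN.
by apply: complexP; rewrite !ReImE; ring.
Qed.

Lemma cmod_expC z : cmod (expC z) = expR (complex.Re z).
Proof.
rewrite /expC cmodM cmod_real ger0_norm ?expR_ge0//.
by rewrite [cmod (_ +i* _)]cmod_sqrt /= cos2Dsin2 sqrtr1 mulr1.
Qed.

Lemma norm_sin_le x : `|sin x| <= `|x|.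
Proof.
wlog x0 : x / 0 <= x.
  move=> h; case: (leP 0 x) => [/h//|x0].
  by rewrite -normrN -sinN -(normrN x) h // oppr_ge0 ltW.
have [c _] := @MVT_segment R sin cos 0 x x0 (fun y _ => is_derive_sin y)
  (continuous_subspaceT (@continuous_sin R)).
rewrite sin0 !subr0 => ->.
by rewrite normrM ler_piMl // cos_max.
Qed.

Lemma norm_cosB1_le x : `|cos x - 1| <= x ^+ 2.
Proof.
have -> : cos x - 1 = - (2 * sin (x / 2) ^+ 2).
  have -> : cos x = cos (x / 2 + x / 2) by congr cos; field.
  by have := cos2Dsin2 (x / 2); rewrite cosD_ => h; lra.
rewrite normrN ger0_norm; last by rewrite mulr_ge0// sqr_ge0.
have : sin (x / 2) ^+ 2 <= (x / 2) ^+ 2.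
  by rewrite -!(@real_normK _ (sin _)) ?num_real// -(@real_normK _ (x/2)) ?num_real// lerXn2r ?nnegrE ?norm_sin_le.
by have := sqr_ge0 x; lra.
Qed.

Lemma norm_sinBx_le x : `|sin x - x| <= x ^+ 2 * expR `|x|.
Proof.
wlog x0 : x / 0 <= x.
  move=> h; case: (leP 0 x) => [/h//|x0].
  have -> : sin x - x = - (sin (- x) - - x) by rewrite sinN; ring.
  by rewrite normrN -sqrrN -(normrN x) h // oppr_ge0 ltW.
pose f y : R := sin y - y.
have df y : is_derive y 1 f (cos y - 1) by apply: is_deriveB.
have cf : {within `[0, x], continuous f}.
  apply: continuous_subspaceT => y; apply: continuousB; [exact: continuous_sin|exact].
have [c cx] := @MVT_segment R f _ 0 x x0 (fun y _ => df y) cf.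
rewrite /f sin0 !subr0 => ->.
move: cx; rewrite in_itv /= => /andP[c0 cx].
rewrite normrM; apply: (@le_trans _ _ (c * x ^+ 2)).
  rewrite (ger0_norm x0); apply: (le_trans (ler_wpM2r x0 (norm_cosB1_le c))).
  by rewrite expr2 -mulrA ler_wpM2l// expr2 ler_wpM2r.
have : x <= expR x by have := expR_ge1Dx x; lra.
rewrite (ger0_norm x0) => h.
by rewrite mulrC ler_wpM2l ?sqr_ge0// (le_trans cx).
Qed.

Lemma norm_expRB1_le x : `|expR x - 1| <= `|x| * expR `|x|.
Proof.
case: (leP 0 x) => x0.
  have h := expR_ge1Dx (- x); have h0 := expR_gt0 x.
  have e : expR x * expR (- x) = 1 by rewrite -expRD subrr expR0.
  rewrite !ger0_norm//; first by nra.
  by rewrite subr_ge0 -expR0 ler_expR.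
rewrite (ltr0_norm x0) ler0_norm; last first.
  by rewrite subr_le0 -expR0 ler_expR ltW.
have h := expR_ge1Dx x; have h' := expR_ge1Dx (- x).
nra.
Qed.

Lemma expRB1B_le x : `|expR x - 1 - x| <= x ^+ 2 * expR `|x|.
Proof.
have h := expR_ge1Dx x.
rewrite ger0_norm; last by lra.
have h' : expR x - 1 - x <= x * (expR x - 1).
  have h1 := expR_ge1Dx (- x); have h0 := expR_gt0 x.
  have e : expR x * expR (- x) = 1 by rewrite -expRD subrr expR0.
  nra.
apply: (le_trans h'); apply: (le_trans (ler_norm _)); rewrite normrM.
rewrite -(@real_normK _ x) ?num_real// expr2 -mulrA ler_wpM2l//.
exact: norm_expRB1_le.
Qed.

(** The constants are not sharp: what matters is the quadratic order and a
    growth at most exponential in the modulus, which the Gaussian factor of the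
    heat kernel absorbs. *)
Lemma expC_taylor z :
  cmod (expC z - 1 - z) <= 5 * cmod z ^+ 2 * expR (2 * cmod z).
Proof.
case: z => x y.
have hx := cmod_Re (x +i* y); have hy := cmod_Im (x +i* y).
set r := cmod (x +i* y) in hx hy *; rewrite /= in hx hy.
have r0 : 0 <= r by exact: cmod_ge0.
have er1 : 1 <= expR r by rewrite -expR0 ler_expR.
have er2 : expR (2 * r) = expR r * expR r by rewrite -expRD; congr expR; ring.
have exr : expR `|x| <= expR r by rewrite ler_expR.
have eyr : expR `|y| <= expR r by rewrite ler_expR.
have ex1 : expR x <= expR r by rewrite ler_expR (le_trans (ler_norm x)).
have ex0 := expR_gt0 x.
have x2 : x ^+ 2 <= r ^+ 2.
  by rewrite -(@real_normK _ x) ?num_real// lerXn2r ?nnegrE.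
have y2 : y ^+ 2 <= r ^+ 2.
  by rewrite -(@real_normK _ y) ?num_real// lerXn2r ?nnegrE.
have r2 := sqr_ge0 r.
have h1 : `|expR x - 1 - x| <= r ^+ 2 * (expR r * expR r).
  apply: (le_trans (expRB1B_le x)); rewrite ler_pM ?sqr_ge0 ?expR_ge0//.
  by rewrite (le_trans exr)// ler_peMl// expR_ge0.
have h2 : `|expR x * (cos y - 1)| <= r ^+ 2 * (expR r * expR r).
  rewrite normrM (gtr0_norm ex0) mulrC ler_pM//.
    by rewrite (le_trans (norm_cosB1_le y)).
  by rewrite (le_trans ex1)// ler_peMl// expR_ge0.
have h3 : `|expR x * (sin y - y)| <= r ^+ 2 * (expR r * expR r).
  rewrite normrM (gtr0_norm ex0) mulrCA ler_pM ?expR_ge0//.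
  by apply: (le_trans (norm_sinBx_le y)); rewrite ler_pM ?sqr_ge0 ?expR_ge0.
have h4 : `|(expR x - 1) * y| <= r ^+ 2 * (expR r * expR r).
  rewrite normrM; apply: (@le_trans _ _ (r * expR r * r)).
    rewrite ler_pM//; apply: (le_trans (norm_expRB1_le x)).
    by rewrite ler_pM ?expR_ge0.
  rewrite -mulrA mulrC -mulrA -expr2 mulrC ler_wpM2l//.
  by rewrite ler_peMl// expR_ge0.
apply: (le_trans (cmod_le _)).
rewrite /expC !ReImE /= mul0r !subr0 mul0r addr0.
have -> : expR x * cos y - 1 - x = (expR x - 1 - x) + expR x * (cos y - 1) by ring.
have -> : expR x * sin y - y = expR x * (sin y - y) + (expR x - 1) * y by ring.
rewrite er2.
have := ler_normD (expR x - 1 - x) (expR x * (cos y - 1)).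
have := ler_normD (expR x * (sin y - y)) ((expR x - 1) * y).
have : 0 <= r ^+ 2 * (expR r * expR r) by rewrite mulr_ge0// mulr_ge0// expR_ge0.
lra.
Qed.

End ComplexExponential.

(** * Unconditional sums *)

#[local] Existing Instance summability.totally_filter.

Section UnconditionalSums.
Context {R : realType}.
Local Open Scope fset_scope.
Local Open Scope ring_scope.

(** Convergence of the net of finite partial sums, in terms of the real
    modulus. *)
Definition has_sum (I : choiceType) (x : I -> R[i]) (s : R[i]) : Prop :=
  forall e : R, 0 < e -> exists J0 : {fset I}, forall J : {fset I},
    J0 `<=` J -> cmod (\sum_(i <- J) x i - s) <= e.

(** The majorants of normally convergent families; boundedness of the finite
    sums is summability for nonnegative terms. *)
Definition fsummable (I : choiceType) (a : I -> R) : Prop :=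
  (forall i, 0 <= a i) /\
  exists M : R, forall J : {fset I}, \sum_(i <- J) a i <= M.

Lemma cmod_small z : (forall e : R, 0 < e -> cmod z <= e) -> z = 0 :> R[i].
Proof.
move=> h; apply/eqP/negPn/negP; rewrite -cmod_gt0 => z0.
by have := h (cmod z / 2) (divr_gt0 z0 (ltr0Sn _ _)); lra.
Qed.

Lemma has_sum_sumC (I : choiceType) (x : I -> R[i]) s :
  has_sum x s -> sumC x = s.
Proof.
move=> h; rewrite /sumC /summability.sum; apply: norm_cvg_lim.
apply/cvgrPdist_le => e e0.
have er : e = (complex.Re e)%:C.
  by move: e0; rewrite ltcE => /andP[/eqP/= i0 _]; case: e i0 => a b /= ->.
have e0' : 0 < complex.Re e by move: e0; rewrite ltcE => /andP[].
have [J0 hJ0] := h _ e0'.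
exists J0 => // J /= J0J.
rewrite er cmodE -/(cmod _) lecR cmodC /summability.partial_sum.
by have := hJ0 J J0J; rewrite big_seq_fsetE.
Qed.

Lemma has_sumD (I : choiceType) (x y : I -> R[i]) s t :
  has_sum x s -> has_sum y t -> has_sum (fun i => x i + y i) (s + t).
Proof.
move=> h h' e e0.
have e20 : 0 < e / 2 by lra.
have [J hJ] := h _ e20; have [J' hJ'] := h' _ e20.
exists (J `|` J') => K; rewrite fsubUset => /andP[/hJ a /hJ' b].
rewrite big_split /=.
have -> : forall u v : R[i], u + v - (s + t) = (u - s) + (v - t).
  by move=> u v; ring.
by apply: (le_trans (cmodD _ _)); lra.
Qed.

Lemma has_sumZ (I : choiceType) (x : I -> R[i]) s (c : R[i]) :
  has_sum x s -> has_sum (fun i => c * x i) (c * s).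
Proof.
move=> h e e0.
have c0 : 0 < cmod c + 1 by have := cmod_ge0 c; lra.
have [J hJ] := h _ (divr_gt0 e0 c0).
exists J => K /hJ a; rewrite -mulr_sumr -mulrBr cmodM.
apply: (@le_trans _ _ (cmod c * (e / (cmod c + 1)))).
  by rewrite ler_wpM2l// cmod_ge0.
rewrite mulrCA ler_piMr ?(ltW e0)// ler_pdivrMr// mul1r.
lra.
Qed.

Lemma has_sumN (I : choiceType) (x : I -> R[i]) s :
  has_sum x s -> has_sum (fun i => - x i) (- s).
Proof.
move=> /(@has_sumZ _ _ _ (-1)); rewrite mulN1r; congr has_sum.
by apply/funext => i; rewrite mulN1r.
Qed.

Lemma has_sum_conj (I : choiceType) (x : I -> R[i]) s :
  has_sum x s -> has_sum (fun i => (x i)^*) s^*.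
Proof.
move=> h e /h[J hJ]; exists J => K /hJ.
by rewrite -rmorph_sum -rmorphB cmod_conj.
Qed.

Lemma has_sum_bij (I K : choiceType) (f : K -> I) (g : I -> K)
    (x : I -> R[i]) s :
  cancel f g -> cancel g f -> has_sum x s -> has_sum (x \o f) s.
Proof.
move=> fK gK h e /h[J hJ].
exists (g @` J) => L gL.
have -> : \sum_(i <- L) (x \o f) i = \sum_(i <- f @` L) x i.
  by rewrite big_imfset //= => a b _ _ /(can_inj fK).
apply: hJ; apply/fsubsetP => i iJ; rewrite -(gK i) in_imfset //=.
by apply: (fsubsetP gL); rewrite in_imfset.
Qed.

(** [P] tells the two copies apart, so that each finite subset of [I] splits
    into two finite sets of indices; this serves for the parity of integers. *)
Lemma has_sum_split (I K L : choiceType) (P : pred I)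
    (f : K -> I) (f' : I -> K) (g : L -> I) (g' : I -> L)
    (x : I -> R[i]) s t :
  cancel f f' -> cancel g g' ->
  (forall k, P (f k)) -> (forall l, ~~ P (g l)) ->
  (forall i, P i -> f (f' i) = i) -> (forall i, ~~ P i -> g (g' i) = i) ->
  has_sum (x \o f) s -> has_sum (x \o g) t -> has_sum x (s + t).
Proof.
move=> fK gK Pf Pg f'K g'K h h' e e0.
have e20 : 0 < e / 2 by lra.
have [J hJ] := h _ e20; have [J' hJ'] := h' _ e20.
exists ((f @` J) `|` (g @` J')) => A; rewrite fsubUset => /andP[fJ gJ].
have {}hJ : cmod (\sum_(i <- A | P i) x i - s) <= e / 2.
  have -> : \sum_(i <- A | P i) x i = \sum_(k <- f' @` [fset i in A | P i]) (x \o f) k.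
    rewrite big_imfset => [|a b] /=.
      by rewrite big_fset /=; apply: eq_bigr => i /f'K ->.
    by rewrite !inE => /andP[_ Pa] /andP[_ Pb] /(congr1 f); rewrite !f'K.
  apply: hJ; apply/fsubsetP => k kJ; rewrite -(fK k) in_imfset //= !inE Pf andbT.
  by apply: (fsubsetP fJ); rewrite in_imfset.
have {}hJ' : cmod (\sum_(i <- A | ~~ P i) x i - t) <= e / 2.
  have -> : \sum_(i <- A | ~~ P i) x i = \sum_(k <- g' @` [fset i in A | ~~ P i]) (x \o g) k.
    rewrite big_imfset => [|a b] /=.
      by rewrite big_fset /=; apply: eq_bigr => i /g'K ->.
    by rewrite !inE => /andP[_ Pa] /andP[_ Pb] /(congr1 g); rewrite !g'K.
  apply: hJ'; apply/fsubsetP => k kJ; rewrite -(gK k) in_imfset //= !inE Pg andbT.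
  by apply: (fsubsetP gJ); rewrite in_imfset.
rewrite (bigID P) /=.
set u := \sum_(i <- A | P i) _ in hJ *; set v := \sum_(i <- A | _) _ in hJ' *.
have -> : u + v - (s + t) = (u - s) + (v - t) by ring.
by apply: (le_trans (cmodD _ _)); lra.
Qed.

Lemma sum_le_subset (I : choiceType) (a : I -> R) (J K : {fset I}) :
  (forall i, 0 <= a i) -> J `<=` K -> \sum_(i <- J) a i <= \sum_(i <- K) a i.
Proof.
move=> a0 JK; rewrite [leRHS](big_fsetID _ (mem J)) /=.
have -> : [fset x in K | x \in J] = J.
  apply/fsetP => i; rewrite !inE /= andbC; case: (boolP (i \in J)) => //= iJ.
  exact: (fsubsetP JK).
by rewrite lerDl sumr_ge0.
Qed.

Lemma fsummable_tail (I : choiceType) (a : I -> R) : fsummable a ->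
  forall e : R, 0 < e -> exists J0 : {fset I}, forall J : {fset I},
    J0 `<=` J -> \sum_(i <- J) a i <= \sum_(i <- J0) a i + e.
Proof.
move=> [a0 [M hM]] e e0.
pose S : set R := [set r | exists J : {fset I}, r = \sum_(i <- J) a i].
have hS : has_sup S.
  split; first by exists (\sum_(i <- fset0) a i), fset0.
  by exists M => _ [J ->]; exact: hM.
have [_ [J0 ->] h] := sup_adherent e0 hS.
exists J0 => J _; rewrite (@le_trans _ _ (sup S))//.
  by apply: (sup_ubound hS.2); exists J.
by lra.
Qed.

Lemma has_sum_nonneg (I : choiceType) (a : I -> R) : fsummable a ->
  exists s : R, has_sum (fun i => (a i)%:C) s%:C.
Proof.
move=> [a0 [M hM]].
pose S : set R := [set r | exists J : {fset I}, r = \sum_(i <- J) a i].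
have hS : has_sup S.
  split; first by exists (\sum_(i <- fset0) a i), fset0.
  by exists M => _ [J ->]; exact: hM.
exists (sup S) => e e0.
have [_ [J0 ->] h] := sup_adherent e0 hS.
exists J0 => J J0J; rewrite -rmorph_sum -rmorphB cmod_real.
have h1 : \sum_(i <- J) a i <= sup S by apply: (sup_ubound hS.2); exists J.
have h2 := sum_le_subset a0 J0J.
by rewrite ler0_norm; lra.
Qed.

Lemma fsummableD (I : choiceType) (a b : I -> R) :
  fsummable a -> fsummable b -> fsummable (fun i => a i + b i).
Proof.
move=> [a0 [M hM]] [b0 [N hN]]; split; first by move=> i; rewrite addr_ge0.
by exists (M + N) => J; rewrite big_split lerD.
Qed.

Lemma fsummableZ (I : choiceType) (a : I -> R) (c : R) :
  0 <= c -> fsummable a -> fsummable (fun i => c * a i).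
Proof.
move=> c0 [a0 [M hM]]; split; first by move=> i; rewrite mulr_ge0.
by exists (c * M) => J; rewrite -mulr_sumr ler_wpM2l.
Qed.

Lemma fsummable_le (I : choiceType) (a b : I -> R) :
  (forall i, 0 <= b i) -> (forall i, b i <= a i) -> fsummable a -> fsummable b.
Proof.
move=> b0 ba [a0 [M hM]]; split => //.
by exists M => J; apply: le_trans (hM J); rewrite ler_sum.
Qed.

Lemma fsummable_inj (I K : choiceType) (f : K -> I) (a : I -> R) :
  injective f -> fsummable a -> fsummable (a \o f).
Proof.
move=> fI [a0 [M hM]]; split; first by move=> i; exact: a0.
exists M => J; apply: le_trans (hM (f @` J)).
by rewrite big_imfset //= => x y _ _ /fI.
Qed.

Lemma big_fset_prod (V : nmodType) (I K : choiceType) (A : {fset I})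
    (B : {fset K}) (F : I * K -> V) :
  \sum_(p <- (A `*` B)%fset) F p = \sum_(i <- A) \sum_(k <- B) F (i, k).
Proof.
rewrite -(big_allpairs (F := F)); apply: perm_big; apply: uniq_perm => //.
  by apply: allpairs_uniq => // -[a b] [c d].
move=> [i k]; rewrite in_fsetM /=.
apply/andP/allpairsP => [[iA kB]|[[a b] /= [aA bB [-> ->]]]//].
by exists (i, k).
Qed.

Lemma fsummableM (I K : choiceType) (a : I -> R) (b : K -> R) :
  fsummable a -> fsummable b -> fsummable (fun p : K * I => a p.2 * b p.1).
Proof.
move=> [a0 [M hM]] [b0 [N hN]]; split; first by move=> i; rewrite mulr_ge0.
exists (M * N) => J.
have ab0 (p : K * I) : 0 <= a p.2 * b p.1 by rewrite mulr_ge0.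
apply: le_trans (sum_le_subset (K := (fst @` J) `*` (snd @` J)) ab0 _) _.
  by apply/fsubsetP => -[k i] h; rewrite in_fsetM /= !(in_imfset _ _ h).
rewrite big_fset_prod /=.
under eq_bigr do rewrite -mulr_suml.
rewrite -mulr_sumr.
have := hM (snd @` J); have := hN (fst @` J) => h1 h2.
by rewrite ler_pM // sumr_ge0.
Qed.

(** Reduced to nonnegative terms, where the sum is a supremum, by adding the
    majorant to the real and imaginary parts. *)
Lemma has_sum_ex (I : choiceType) (a : I -> R) (x : I -> R[i]) :
  fsummable a -> (forall i, cmod (x i) <= a i) -> has_sum x (sumC x).
Proof.
move=> fa xa.
suff [s hs] : exists s, has_sum x s by rewrite (has_sum_sumC hs).
have real (y : I -> R) : (forall i, `|y i| <= a i) ->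
    exists s, has_sum (fun i => (y i)%:C) s.
  move=> ya.
  have [s hs] := has_sum_nonneg fa.
  have ya' : fsummable (fun i => y i + a i).
    apply: (@fsummable_le _ (fun i => a i + a i)); last exact: fsummableD.
      by move=> i; have := ler_norm (- y i); have := ya i; rewrite normrN; lra.
    by move=> i; have := ler_norm (y i); have := ya i; lra.
  have [t ht] := has_sum_nonneg ya'.
  exists (t%:C - s%:C).
  have := has_sumD ht (has_sumN hs); congr has_sum; apply/funext => i.
  by rewrite rmorphD addrK.
have [s hs] := real _ (fun i => le_trans (cmod_Re (x i)) (xa i)).
have [t ht] := real _ (fun i => le_trans (cmod_Im (x i)) (xa i)).
exists (s + 'i * t).
have := has_sumD hs (has_sumZ 'i ht); congr has_sum; apply/funext => i.
by rewrite -complexE.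
Qed.

(** The rate of convergence depends on the majorant only; this uniformity is
    what allows to exchange sums with integrals and derivatives. *)
Lemma has_sum_unif (I : choiceType) (a : I -> R) : fsummable a ->
  forall e : R, 0 < e -> exists J0 : {fset I}, forall x : I -> R[i],
    (forall i, cmod (x i) <= a i) -> forall J : {fset I}, J0 `<=` J ->
    cmod (\sum_(i <- J) x i - sumC x) <= e.
Proof.
move=> fa e e0.
have e20 : 0 < e / 2 by lra.
have [J0 hJ0] := fsummable_tail fa e20.
exists J0 => x xa J J0J.
have [J1 hJ1] := has_sum_ex fa xa e20.
have {}hJ1 := hJ1 _ (fsubsetUr J J1).
have h1 : cmod (\sum_(i <- J `|` J1) x i - \sum_(i <- J) x i) <= e / 2.
  have JJ : J `<=` J `|` J1 by exact: fsubsetUl.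
  rewrite (big_fsetID _ (mem J)) /=.
  have -> : [fset i in J `|` J1 | i \in J] = J.
    by apply/fsetP => i; rewrite !inE /= andbC; case: (i \in J).
  rewrite [X in cmod (X - _)]addrC addrK; apply: (le_trans (cmod_sum _ _ _)).
  apply: (@le_trans _ _ (\sum_(i <- [fset i in J `|` J1 | i \notin J]) a i)).
    by rewrite ler_sum.
  have := hJ0 (J `|` J1) (fsubset_trans J0J JJ).
  rewrite (big_fsetID _ (mem J)) /=.
  have -> : [fset i in J `|` J1 | i \in J] = J.
    by apply/fsetP => i; rewrite !inE /= andbC; case: (i \in J).
  by have := sum_le_subset fa.1 J0J; lra.
rewrite cmodC in h1.
set S := \sum_(i <- J `|` J1) x i in hJ1 h1.
have -> : \sum_(i <- J) x i - sumC x = (\sum_(i <- J) x i - S) + (S - sumC x) by ring.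
by apply: (le_trans (cmodD _ _)); lra.
Qed.

Lemma cmod_sumC (I : choiceType) (a : I -> R) (M : R) (x : I -> R[i]) :
  (forall i, 0 <= a i) -> (forall J : {fset I}, \sum_(i <- J) a i <= M) ->
  (forall i, cmod (x i) <= a i) -> cmod (sumC x) <= M.
Proof.
move=> a0 hM xa.
have fa : fsummable a by split => //; exists M.
apply/ler_addgt0Pr => e e0.
have [J0 hJ0] := has_sum_ex fa xa e0.
have := hJ0 _ (fsubset_refl _); rewrite cmodC => h1.
have h2 : cmod (\sum_(i <- J0) x i) <= M.
  apply: (le_trans (cmod_sum _ _ _)); apply: le_trans (hM J0); exact: ler_sum.
have -> : sumC x = \sum_(i <- J0) x i + (sumC x - \sum_(i <- J0) x i) by ring.
by apply: (le_trans (cmodD _ _)); lra.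
Qed.

(** The sum over the product exists by absolute convergence, and its value can
    be read on the rectangles, which are cofinal among finite subsets. *)
Lemma has_sumM (I K : choiceType) (a : I -> R) (b : K -> R) x y :
  fsummable a -> fsummable b -> (forall i, cmod (x i) <= a i) ->
  (forall k, cmod (y k) <= b k) ->
  has_sum (fun p : K * I => x p.2 * y p.1) (sumC x * sumC y).
Proof.
move=> fa fb xa yb.
have xyab (p : K * I) : cmod (x p.2 * y p.1) <= a p.2 * b p.1.
  by rewrite cmodM ler_pM ?cmod_ge0.
have hS := has_sum_ex (fsummableM fa fb) xyab.
suff <- : sumC (fun p : K * I => x p.2 * y p.1) = sumC x * sumC y by [].
apply/eqP; rewrite -subr_eq0; apply/eqP/cmod_small => e e0.
have [M hM] := fa.2; have [N hN] := fb.2.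
pose C : R := 1 + `|M| + `|N|.
have C0 : 0 < C by rewrite /C -addrA ltr_wpDr// addr_ge0.
have ed : 0 < e / (2 * C) by rewrite divr_gt0// mulr_gt0.
have e20 : 0 < e / 2 by lra.
have [J0 hJ0] := hS _ e20.
have [A hA] := has_sum_ex fa xa ed.
have [B hB] := has_sum_ex fb yb ed.
set S := sumC _ in hJ0 *.
pose A' := A `|` (snd @` J0); pose B' := B `|` (fst @` J0).
have {}hA := hA A' (fsubsetUl _ _); have {}hB := hB B' (fsubsetUl _ _).
have {}hJ0 := hJ0 (B' `*` A').
have {hJ0} : cmod (\sum_(i <- B' `*` A') x i.2 * y i.1 - S) <= e / 2.
  apply: hJ0; apply/fsubsetP => -[k i] h.
  by rewrite in_fsetM /= !inE /= !(in_imfset _ _ h) !orbT.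
rewrite big_fset_prod /=.
under eq_bigr do rewrite -mulr_suml.
rewrite -mulr_sumr cmodC.
set X := \sum_(i <- A') _ in hA *; set Y := \sum_(i <- B') _ in hB *.
move=> h.
have -> : S - sumC x * sumC y =
  (S - X * Y) + (X - sumC x) * Y + sumC x * (Y - sumC y) by ring.
have hY : cmod Y <= `|N|.
  apply: (le_trans (cmod_sum _ _ _)); apply: le_trans (ler_norm _).
  by apply: le_trans (hN B'); apply: ler_sum.
have hX : cmod (sumC x) <= `|M|.
  apply: (@cmod_sumC _ a) => // [i|J]; first exact: fa.1.
  exact: le_trans (hM J) (ler_norm _).
apply: (le_trans (cmodD _ _)); rewrite cmodM.
have h1 : cmod (sumC x) * cmod (Y - sumC y) <= `|M| * (e / (2 * C)).
  by rewrite ler_pM ?cmod_ge0.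
have h2 : cmod (X - sumC x) * cmod Y <= (e / (2 * C)) * `|N|.
  by rewrite ler_pM ?cmod_ge0.
have h3 := cmodD (S - X * Y) ((X - sumC x) * Y).
rewrite cmodM in h3.
have h4 : `|M| * (e / (2 * C)) + (e / (2 * C)) * `|N| <= e / 2.
  rewrite [X in _ + X]mulrC -mulrDl mulrA ler_pdivrMr; last by rewrite mulr_gt0.
  have -> : e / 2 * (2 * C) = C * e by field.
  by rewrite ler_pM2r// /C -addrA lerDr.
lra.
Qed.

(** Brings summability over an arbitrary index type back to the partial sums
    of a sequence. *)
Lemma fsummable_code (I : choiceType) (c : I -> nat) (g : nat -> R) (M : R) :
  injective c -> (forall n, 0 <= g n) ->
  (forall N, \sum_(0 <= n < N) g n <= M) -> fsummable (g \o c).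
Proof.
move=> cI g0 hM; split; first by move=> i; exact: g0.
exists M => J.
pose N := (\max_(i <- J) c i).+1.
apply: le_trans (hM N).
have <- : \sum_(n <- c @` J) g n = \sum_(i <- J) (g \o c) i.
  by rewrite big_imfset //= => x y _ _ /cI.
have -> : \sum_(0 <= n < N) g n = \sum_(n <- [fset n in iota 0 N]) g n.
  rewrite /index_iota subn0; apply: perm_big.
  apply: uniq_perm; rewrite ?iota_uniq ?fset_uniq// => n.
  by rewrite !inE.
apply: sum_le_subset => //.
apply/fsubsetP => _ /imfsetP[i /= iJ ->].
have : (c i <= \max_(j <- J) c j)%N by apply: leq_bigmax_seq.
by rewrite !inE mem_iota; lia.
Qed.

Lemma sum_inv_square_le (N : nat) :
  \sum_(0 <= n < N) (((1 + n%:R) ^+ 2)^-1 : R) <= 2.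
Proof.
suff h : forall n, \sum_(0 <= k < n.+1) (((1 + k%:R) ^+ 2)^-1 : R) <= 2 - (1 + n%:R)^-1.
  case: N => [|n]; first by rewrite big_geq.
  by apply: le_trans (h n) _; rewrite gerBl invr_ge0 addr_ge0.
elim=> [|n IH]; first by rewrite big_nat1 addr0 expr1n invr1; lra.
rewrite big_nat_recr //=.
have n0 : 0 <= n%:R :> R by [].
have e1 : n.+1%:R = 1 + n%:R :> R by rewrite -natr1; ring.
rewrite e1.
suff : ((1 + (1 + n%:R)) ^+ 2)^-1 <= (1 + n%:R)^-1 - (1 + (1 + n%:R))^-1 :> R by lra.
set x : R := n%:R in n0 *.
have -> : (1 + x)^-1 - (1 + (1 + x))^-1 = ((1 + x) * (1 + (1 + x)))^-1.
  field; apply/andP; split; apply: lt0r_neq0; lra.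
rewrite lef_pV2 ?posrE; nra.
Qed.

(** The size of an integer, shifted so as to be invertible. *)
Definition bracket (n : int) : R := 1 + `|n|%:~R.

(** Nonnegative and negative integers are interleaved, which at most doubles
    their size. *)
Lemma fsummable_bracket2 : fsummable (fun n => (bracket n ^+ 2)^-1).
Proof.
pose c (n : int) := match n with Posz k => k.*2 | Negz k => k.*2.+1 end.
have cI : injective c.
  move=> [m|m] [n|n] /=; first by move/double_inj => ->.
  - by move/(congr1 odd); rewrite /= !odd_double.
  - by move/(congr1 odd); rewrite /= !odd_double.
  - by case=> /double_inj => ->.
apply: (@fsummable_le _ (fun n => 4 * (((1 + (c n)%:R) ^+ 2)^-1 : R))).
- by move=> n; rewrite invr_ge0 sqr_ge0.
- move=> n; rewrite /bracket.
  have cn : (c n)%:R <= 2 * `|n|%:~R :> R.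
    have -> : `|n|%:~R = (absz n)%:R :> R by rewrite -abszE.
    rewrite -natrM ler_nat; case: n => k /=; lia.
  have n0 : 0 <= `|n|%:~R :> R by rewrite ler0z.
  have c0 : 0 <= (c n)%:R :> R by [].
  rewrite -[leLHS]mul1r ler_pdivrMr; last by nra.
  rewrite mulrAC ler_pdivlMr; last by nra.
  nra.
- apply: fsummableZ => //.
  by apply: (fsummable_code cI _ sum_inv_square_le) => n; rewrite invr_ge0 sqr_ge0.
Qed.

End UnconditionalSums.

(** * Hilbert spaces with a degenerate inner product *)

Section SemiHilbert.
Context {R : realType} {V : lmodType R[i]}.
Implicit Types (S : set V) (dot : V -> V -> R[i]) (u v w k : V).

Definition dotnorm dot u : R := Num.sqrt (complex.Re (dot u u)).

(** Hilbert space whose inner product may be degenerate, so that functions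
    need not be identified almost everywhere. *)
Record semi_hilbert S dot : Prop := SemiHilbert {
  sh0 : S 0;
  shP : forall a u v, S u -> S v -> S (a *: u + v);
  sh_linear : forall a u v w, S u -> S v -> S w ->
    dot (a *: u + v) w = a * dot u w + dot v w;
  sh_conj : forall u v, S u -> S v -> dot v u = (dot u v)^*;
  sh_ge0 : forall u, S u -> 0 <= dot u u;
  sh_complete : forall u_ : nat -> V, (forall n, S (u_ n)) ->
    (forall e : R, 0 < e -> exists N : nat, forall m n : nat,
       (N <= m)%N -> (N <= n)%N -> dotnorm dot (u_ m - u_ n) < e) ->
    exists2 u, S u & forall e : R, 0 < e -> exists N : nat, forall n : nat,
       (N <= n)%N -> dotnorm dot (u_ n - u) < e }.

Context (S : set V) (dot : V -> V -> R[i]) (SH : semi_hilbert S dot).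

Local Notation N u := (complex.Re (dot u u)).
Local Notation nrm := (dotnorm dot).

Lemma shZ a u : S u -> S (a *: u).
Proof. by move=> Su; have := shP SH a Su (sh0 SH); rewrite addr0. Qed.

Lemma shD u v : S u -> S v -> S (u + v).
Proof. by move=> Su Sv; have := shP SH 1 Su Sv; rewrite scale1r. Qed.

Lemma shB u v : S u -> S v -> S (u - v).
Proof.
by move=> Su Sv; have := shP SH (-1) Sv Su; rewrite scaleN1r addrC.
Qed.

Lemma dotDl u v w : S u -> S v -> S w -> dot (u + v) w = dot u w + dot v w.
Proof.
by move=> Su Sv Sw; have := sh_linear SH 1 Su Sv Sw; rewrite scale1r mul1r.
Qed.

Lemma dotBl u v w : S u -> S v -> S w -> dot (u - v) w = dot u w - dot v w.
Proof.
move=> Su Sv Sw; have := sh_linear SH (-1) Sv Su Sw.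
by rewrite scaleN1r mulN1r addrC => ->; rewrite addrC.
Qed.

Lemma dot0l w : S w -> dot 0 w = 0.
Proof.
by move=> Sw; have := dotBl (sh0 SH) (sh0 SH) Sw; rewrite !subrr.
Qed.

Lemma dotZl a u w : S u -> S w -> dot (a *: u) w = a * dot u w.
Proof.
move=> Su Sw; have := sh_linear SH a Su (sh0 SH) Sw.
by rewrite addr0 dot0l // addr0.
Qed.

Lemma dotDr u v w : S u -> S v -> S w -> dot w (u + v) = dot w u + dot w v.
Proof.
move=> Su Sv Sw; rewrite (sh_conj SH (shD Su Sv) Sw) dotDl // rmorphD.
by rewrite (sh_conj SH Su Sw) (sh_conj SH Sv Sw).
Qed.

Lemma dotZr a u w : S u -> S w -> dot w (a *: u) = a^* * dot w u.
Proof.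
move=> Su Sw; rewrite (sh_conj SH (shZ a Su) Sw) dotZl // rmorphM.
by rewrite (sh_conj SH Su Sw).
Qed.

Lemma dot_self_real u : S u -> dot u u = (N u)%:C.
Proof.
by move=> /(sh_ge0 SH); rewrite lecE => /andP[/eqP/= h _]; apply: complexP.
Qed.

Lemma dot_self_ge0 u : S u -> 0 <= N u.
Proof. by move=> /(sh_ge0 SH); rewrite lecE => /andP[]. Qed.

Lemma dotnorm_ge0 u : 0 <= nrm u.
Proof. exact: sqrtr_ge0. Qed.

Lemma dotnorm_sqr u : S u -> nrm u ^+ 2 = N u.
Proof. by move=> Su; rewrite sqr_sqrtr // dot_self_ge0. Qed.

Lemma dot_selfD s u v : S u -> S v ->
  N (u + s *: v) = N u + 2 * complex.Re (s^* * dot u v) + sqnorm s * N v.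
Proof.
move=> Su Sv; have Ssv := shZ s Sv.
rewrite dotDl ?dotDr ?dotZl ?dotZr//; try exact: shD.
rewrite (sh_conj SH Su Sv) (dot_self_real Sv) /sqnorm !ReImE.
by case: (dot u v) => a b; case: s {Ssv} => c d /=; ring.
Qed.

Lemma dot_selfZ a u : S u -> N (a *: u) = sqnorm a * N u.
Proof.
move=> Su; rewrite dotZl ?dotZr //; last exact: shZ.
by rewrite (dot_self_real Su) /sqnorm !ReImE; ring.
Qed.

(** The value at [s = - r * dot u v], the direction of steepest descent. *)
Lemma dot_self_descent r u v : S u -> S v ->
  N (u + (- r%:C * dot u v) *: v) =
  N u - 2 * r * sqnorm (dot u v) + r ^+ 2 * sqnorm (dot u v) * N v.
Proof.
move=> Su Sv; rewrite dot_selfD // /sqnorm !ReImE.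
by case: (dot u v) => a b /=; ring.
Qed.

Lemma sqnorm_eq0 (c : R[i]) : sqnorm c <= 0 -> c = 0.
Proof.
rewrite -cmod_sqr => h; apply: cmod_eq0; apply/eqP.
by rewrite -sqrf_eq0 eq_le h sqr_ge0.
Qed.

(** First-order optimality: a nonzero product would give a descent
    direction. *)
Lemma dot_minimizer_eq0 u k : S u -> S k ->
  (forall s, N u <= N (u + s *: k)) -> dot u k = 0.
Proof.
move=> Su Sk h; apply: sqnorm_eq0.
have k0 := dot_self_ge0 Sk.
have := h (- (N k + 1)^-1%:C * dot u k); rewrite dot_self_descent //.
set r := (N k + 1)^-1; set c := sqnorm _.
have r0 : 0 < r by rewrite invr_gt0; lra.
have rk : r * N k <= 1 by rewrite mulrC ler_pdivrMr; lra.
have c0 : 0 <= c by rewrite /c -cmod_sqr sqr_ge0.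
move=> h'; have {h'} : r * (2 * c - (r * N k) * c) <= 0 by lra.
rewrite pmulr_rle0 //; nra.
Qed.

Lemma cauchy_schwarz u v : S u -> S v -> cmod (dot u v) <= nrm u * nrm v.
Proof.
move=> Su Sv.
rewrite -(@ler_pXn2r _ 2) ?nnegrE ?cmod_ge0 ?mulr_ge0 ?dotnorm_ge0 //.
rewrite exprMn !dotnorm_sqr // cmod_sqr; set c := sqnorm _.
have u0 := dot_self_ge0 Su; have v0 := dot_self_ge0 Sv.
have c0 : 0 <= c by rewrite /c -cmod_sqr sqr_ge0.
have h r : 0 <= N u - 2 * r * c + r ^+ 2 * c * N v.
  rewrite -dot_self_descent //; apply: dot_self_ge0; apply: shD => //.
  exact: shZ.
have [v1|v1] := ltP 0 (N v).
  have := h (N v)^-1.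
  have -> : N u - 2 * (N v)^-1 * c + (N v)^-1 ^+ 2 * c * N v = N u - c / N v.
    by field; exact: lt0r_neq0.
  by rewrite subr_ge0 ler_pdivrMr.
have {v1 v0} v0 : N v = 0 by apply/eqP; rewrite eq_le v1 v0.
have [c1|c1] := ltP 0 c; last by rewrite v0; lra.
have := h ((N u + 1) / (2 * c)); rewrite v0 mulr0 addr0.
have -> : 2 * ((N u + 1) / (2 * c)) * c = N u + 1.
  by field; exact: lt0r_neq0.
lra.
Qed.

Lemma dotnormZ a u : S u -> nrm (a *: u) = cmod a * nrm u.
Proof.
move=> Su; rewrite /dotnorm dot_selfZ // -cmod_sqr.
by rewrite sqrtrM ?sqr_ge0 // sqrtr_sqr ger0_norm ?cmod_ge0.
Qed.

Lemma dotnormD u v : S u -> S v -> nrm (u + v) <= nrm u + nrm v.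
Proof.
move=> Su Sv.
rewrite -(@ler_pXn2r _ 2) ?nnegrE ?addr_ge0 ?dotnorm_ge0 //.
have -> : u + v = u + 1 *: v by rewrite scale1r.
rewrite dotnorm_sqr; last by rewrite scale1r; exact: shD.
rewrite dot_selfD // rmorph1 mul1r sqrrD !dotnorm_sqr //.
have -> : sqnorm (1 : R[i]) = 1 by rewrite /sqnorm /= expr0n /= expr1n addr0.
have := ler_norm (complex.Re (dot u v)).
have := cmod_Re (dot u v); have := cauchy_schwarz Su Sv.
rewrite -mulr_natl; lra.
Qed.

Lemma dotnormN u : S u -> nrm (- u) = nrm u.
Proof. by move=> Su; rewrite -scaleN1r dotnormZ // cmodN -(rmorph1 (real_complex R)) cmod_real normr1 mul1r. Qed.

Lemma dotnorm_eq0 u v : S u -> S v -> nrm u = 0 -> dot u v = 0.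
Proof.
move=> Su Sv h; apply: cmod_eq0; apply/eqP; rewrite eq_le cmod_ge0 andbT.
by apply: (le_trans (cauchy_schwarz Su Sv)); rewrite h mul0r.
Qed.

End SemiHilbert.

(** * Spaces of coefficient functions *)

Section RangeSpace.
Context {R : realType} {V : lmodType R[i]} {X : Type}.
Context (S : set V) (dot : V -> V -> R[i]) (SH : semi_hilbert S dot).
Context (phi : X -> V) (Sphi : forall x, S (phi x)).

Local Notation N u := (complex.Re (dot u u)).
Local Notation nrm := (dotnorm dot).

Definition coef (u : V) : X -> R[i] := fun x => dot u (phi x).

(** The representatives of [f] that are orthogonal to the kernel of [coef];
    by [minimal_rep_min] they have the least norm. *)
Definition minimal_rep (f : X -> R[i]) : set V :=
  [set v | [/\ S v, coef v = f &
     forall k, S k -> coef k = (fun=> 0) -> dot v k = 0]].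

Lemma coefP a u v : S u -> S v ->
  coef (a *: u + v) = (fun x => a * coef u x + coef v x).
Proof. by move=> Su Sv; apply/funext => x; rewrite /coef (sh_linear SH). Qed.

Lemma coefB u v : S u -> S v -> coef (u - v) = (fun x => coef u x - coef v x).
Proof. by move=> Su Sv; apply/funext => x; rewrite /coef (dotBl SH). Qed.

Lemma parallelogram u v : S u -> S v ->
  N (u - v) = 2 * N u + 2 * N v - 4 * N ((1/2)%:C *: (u + v)).
Proof.
move=> Su Sv; rewrite (dot_selfZ SH) //; last exact: (shD SH).
have -> : u + v = u + 1 *: v by rewrite scale1r.
rewrite -scaleN1r !(dot_selfD SH) // /sqnorm !ReImE.
by case: (dot u v) => a b /=; field.
Qed.

(** The fibre of [coef] is closed and convex: a minimizing sequence is Cauchy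
    by the parallelogram identity, and its limit is orthogonal to the kernel
    of [coef]. *)
Lemma minimal_rep_exists u : S u -> exists v, minimal_rep (coef u) v.
Proof.
move=> Su.
pose A : set R := [set r | exists v, [/\ S v, coef v = coef u & r = N v]].
have A0 : has_inf A.
  split; first by exists (N u), u.
  by exists 0 => _ [v [Sv _ ->]]; exact: (dot_self_ge0 SH).
pose d := inf A.
have dle v : S v -> coef v = coef u -> d <= N v.
  by move=> Sv cv; apply: (inf_lbound A0.2); exists v.
have /choice[v hv] : forall n : nat, exists v, [/\ S v, coef v = coef u & N v < d + n.+1%:R^-1].
  move=> n; have n0 : (0 : R) < n.+1%:R^-1 by [].
  by have [_ [v [Sv cv ->]] h] := inf_adherent n0 A0; exists v.
have Sv n : S (v n) by have [] := hv n.
have cv n : coef (v n) = coef u by have [] := hv n.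
have Nv n : N (v n) < d + n.+1%:R^-1 by have [] := hv n.
have d0 : 0 <= d.
  by apply: lb_le_inf A0.1 _ => _ [w [Sw _ ->]]; exact: (dot_self_ge0 SH).
have small (e : R) : 0 < e -> exists n0 : nat, forall n, (n0 <= n)%N -> n.+1%:R^-1 < e.
  move=> e0; exists (Num.bound e^-1) => n hn.
  rewrite -[ltRHS]invrK ltf_pV2 ?posrE ?invr_gt0//.
  apply: lt_le_trans (archi_boundP _) _; first by rewrite invr_ge0 ltW.
  by rewrite ler_nat (leq_trans hn).
have cauchy (e : R) : 0 < e -> exists n0 : nat, forall m n : nat,
    (n0 <= m)%N -> (n0 <= n)%N -> nrm (v m - v n) < e.
  move=> e0; have [|n0 hn0] := small (e ^+ 2 / 4); first by rewrite divr_gt0 ?exprn_gt0.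
  exists n0 => m n /hn0 hm /hn0 hn.
  rewrite -(@ltr_pXn2r _ 2) ?nnegrE ?(ltW e0) ?dotnorm_ge0 //.
  rewrite (dotnorm_sqr SH) ?parallelogram //; last exact: (shB SH).
  have : d <= N ((1/2)%:C *: (v m + v n)).
    apply: dle; first by apply/(shZ SH)/(shD SH).
    apply/funext => x; rewrite -(cv 0%N) /coef (dotZl SH) ?(dotDl SH) //; last exact: (shD SH).
    have -> : forall m, dot (v m) (phi x) = dot (v 0%N) (phi x).
      by move=> j; have := cv j; rewrite -(cv 0%N) => /(congr1 (@^~ x)).
    have -> : dot (v n) (phi x) = dot (v 0%N) (phi x).
      by have := cv n; rewrite -(cv 0%N) => /(congr1 (@^~ x)).
    by apply: complexP; rewrite !ReImE /=; field.
  move: (Nv m) (Nv n) hm hn.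
  by move: (m.+1%:R^-1) (n.+1%:R^-1) => p q; lra.
have [w Sw hw] := sh_complete SH Sv cauchy.
have cw : coef w = coef u.
  apply/funext => x; apply/eqP; rewrite -subr_eq0; apply/eqP/cmod_eq0.
  apply/eqP; rewrite eq_le cmod_ge0 andbT.
  apply/ler_addgt0Pr => e e0; rewrite add0r.
  have p0 : 0 < nrm (phi x) + 1 by have := dotnorm_ge0 dot (phi x); lra.
  have [n0 hn0] := hw _ (divr_gt0 e0 p0).
  rewrite -(cv n0) cmodC -/(coef (v n0) x) -(_ : coef (v n0 - w) x = coef (v n0) x - coef w x); last first.
    by rewrite coefB.
  apply: (le_trans (cauchy_schwarz SH (shB SH (Sv n0) Sw) (Sphi x))).
  apply: (@le_trans _ _ (e / (nrm (phi x) + 1) * nrm (phi x))).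
    by rewrite ler_wpM2r ?dotnorm_ge0 // ltW // hn0.
  by rewrite mulrAC ler_pdivrMr // ler_wpM2l ?(ltW e0) //; lra.
have Nw : nrm w <= Num.sqrt d.
  apply/ler_addgt0Pr => e e0.
  have e20 : 0 < e / 2 by lra.
  have [n0 hn0] := hw _ e20.
  have [|n1 hn1] := small ((e / 2) ^+ 2); first by rewrite exprn_gt0.
  pose n := maxn n0 n1.
  have {}hn0 := hn0 n (leq_maxl _ _); have {}hn1 := hn1 n (leq_maxr _ _).
  have -> : w = v n - (v n - w) by rewrite opprB addrC subrK.
  have SB := shB SH (Sv n) Sw.
  apply: (le_trans (dotnormD SH (Sv n) _)).
    by have := shZ SH (-1) SB; rewrite scaleN1r.
  rewrite (dotnormN SH) //.
  suff : nrm (v n) <= Num.sqrt d + e / 2 by lra.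
  rewrite -(@ler_pXn2r _ 2) ?nnegrE ?dotnorm_ge0 ?addr_ge0 ?sqrtr_ge0 ?(ltW e20) //.
  rewrite (dotnorm_sqr SH) // sqrrD sqr_sqrtr //.
  have : 0 <= Num.sqrt d * (e / 2) *+ 2 by rewrite mulrn_wge0 // mulr_ge0 ?sqrtr_ge0 ?(ltW e20).
  by move: (Nv n) hn1; move: (n.+1%:R^-1) => p; lra.
exists w; split=> // k Sk ck; apply: (dot_minimizer_eq0 SH) => // s.
apply: (@le_trans _ _ d).
  rewrite -(dotnorm_sqr SH) // -[leRHS]sqr_sqrtr //.
  by rewrite lerXn2r ?nnegrE ?dotnorm_ge0 ?sqrtr_ge0.
have Ssk := shZ SH s Sk.
apply: dle; first exact: (shD SH).
rewrite -cw addrC; apply/funext => x; rewrite coefP //.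
by rewrite ck mulr0 add0r.
Qed.

Lemma minimal_repP a f g v w : minimal_rep f v -> minimal_rep g w ->
  minimal_rep (fun x => a * f x + g x) (a *: v + w).
Proof.
move=> [Sv cv hv] [Sw cw hw]; split; first exact: (shP SH).
  by rewrite coefP // cv cw.
by move=> k Sk ck; rewrite (sh_linear SH) // hv // hw // mulr0 addr0.
Qed.

Lemma minimal_rep_uniq f v w x : minimal_rep f v -> minimal_rep f w -> S x ->
  dot v x = dot w x.
Proof.
move=> [Sv cv hv] [Sw cw hw] Sx.
have Svw := shB SH Sv Sw.
have cvw : coef (v - w) = fun=> 0.
  by rewrite coefB // cv cw; apply/funext => y; rewrite subrr.
apply/eqP; rewrite -subr_eq0 -(dotBl SH) //; apply/eqP.
apply: (dotnorm_eq0 SH) => //.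
by rewrite /dotnorm (dotBl SH) // hv // hw // subrr sqrtr0.
Qed.

Lemma minimal_rep_min f v u : minimal_rep f v -> S u -> coef u = f ->
  nrm v <= nrm u.
Proof.
move=> [Sv cv hv] Su cu.
have Svu := shB SH Su Sv.
rewrite -(@ler_pXn2r _ 2) ?nnegrE ?dotnorm_ge0 // !(dotnorm_sqr SH) //.
have -> : u = v + 1 *: (u - v) by rewrite scale1r addrC subrK.
have c0 : coef (u - v) = fun=> 0.
  by rewrite coefB // cv cu; apply/funext => y; rewrite subrr.
have R0 : complex.Re (0 : R[i]) = 0 by [].
rewrite (dot_selfD SH) // (hv (u - v)) // mulr0 R0 mulr0 addr0 lerDl mulr_ge0 // ?(dot_self_ge0 SH) //.
by rewrite -cmod_sqr sqr_ge0.
Qed.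

Lemma minimal_rep_kernel y : minimal_rep (coef (phi y)) (phi y).
Proof.
split=> // k Sk /(congr1 (@^~ y)); rewrite /coef => h.
by rewrite (sh_conj SH Sk) // h conjc0.
Qed.

(** Well defined, although the inner product is degenerate, since two minimal
    representatives have the same products with all elements of [S]; see
    [range_dotE]. *)
Definition range_dot (f g : X -> R[i]) : R[i] :=
  dot (xget 0 (minimal_rep f)) (xget 0 (minimal_rep g)).

Lemma range_dotE f g v w : minimal_rep f v -> minimal_rep g w ->
  range_dot f g = dot v w.
Proof.
move=> hv hw; rewrite /range_dot.
have hf := xgetPex 0 (ex_intro _ _ hv); have hg := xgetPex 0 (ex_intro _ _ hw).
have Sf : S (xget 0 (minimal_rep f)) by case: hf.
have Sg : S (xget 0 (minimal_rep g)) by case: hg.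
have Sv : S v by case: hv.
have Sw : S w by case: hw.
rewrite (minimal_rep_uniq hf hv Sg) (sh_conj SH Sg Sv).
by rewrite (minimal_rep_uniq hg hw Sv) (sh_conj SH Sw Sv).
Qed.

Definition range_space : set (X -> R[i]) :=
  [set f | exists2 u, S u & f = coef u].

Lemma range_rep f : range_space f -> exists v, minimal_rep f v.
Proof. by move=> [u Su ->]; exact: minimal_rep_exists. Qed.

(** The minimal representative of [coef (phi w)] is [phi w] itself, which gives
    the reproducing property; completeness is inherited from [S] through
    minimal representatives. *)
Theorem range_space_rkhs :
  is_rkhs range_space range_dot (fun z w => dot (phi w) (phi z)).
Proof.
have H0 : range_space (fun=> 0).
  exists 0; first exact: (sh0 SH).
  by apply/funext => x; rewrite /coef (dot0l SH).
have HP a f g : range_space f -> range_space g ->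
    range_space (fun x => a * f x + g x).
  move=> [u Su ->] [v Sv ->]; exists (a *: u + v); first exact: (shP SH).
  by rewrite coefP.
have mB f g v w : minimal_rep f v -> minimal_rep g w ->
    minimal_rep (fun x => f x - g x) (v - w).
  move=> hv hw; rewrite -[v - w]addrC -scaleN1r.
  have := minimal_repP (-1) hw hv; congr minimal_rep.
  by apply/funext => x; rewrite mulN1r addrC.
split => //.
- move=> a f g h /range_rep[u hu] /range_rep[v hv] /range_rep[w hw].
  rewrite (range_dotE (minimal_repP a hu hv) hw) (range_dotE hu hw).
  rewrite (range_dotE hv hw) (sh_linear SH) //.
  + by case: hu.
  + by case: hv.
  + by case: hw.
- move=> f g /range_rep[u hu] /range_rep[v hv].
  rewrite (range_dotE hu hv) (range_dotE hv hu) (sh_conj SH) //.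
  + by case: hu.
  + by case: hv.
- move=> f /range_rep[u hu]; rewrite (range_dotE hu hu).
  by apply: (sh_ge0 SH); case: hu.
- move=> f /range_rep[u hu]; rewrite (range_dotE hu hu) => h.
  case: hu => Su <- _; apply/funext => x; apply: (dotnorm_eq0 SH) => //.
  by rewrite /dotnorm h sqrtr0.
- move=> f_ Hf cauchy.
  have /choice[u hu] : forall n, exists u, minimal_rep (f_ n) u.
    by move=> n; apply: range_rep.
  have Su n : S (u n) by case: (hu n).
  have [e e0|u0 Su0 hu0] := sh_complete SH Su.
    have [n0 hn0] := cauchy e e0; exists n0 => m n hm hn.
    have := hn0 m n hm hn.
    by rewrite /ipnorm (range_dotE (mB _ _ _ _ (hu m) (hu n)) (mB _ _ _ _ (hu m) (hu n))).
  exists (coef u0); first by exists u0.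
  move=> e /hu0[n0 hn0]; exists n0 => n /hn0.
  apply: le_lt_trans.
  have [v hv] := minimal_rep_exists Su0.
  have hB := mB _ _ _ _ (hu n) hv.
  rewrite /ipnorm (range_dotE hB hB).
  apply: (minimal_rep_min hB); first exact: (shB SH).
  by rewrite coefB //; case: (hu n) => _ -> _.
- by move=> w; exists (phi w).
- move=> f w /range_rep[v hv].
  rewrite (range_dotE hv (minimal_rep_kernel w)).
  by case: hv => _ <- _.
Qed.

(** The infimum is attained at the minimal representative. *)
Theorem range_space_norm u : S u ->
  ipnorm range_dot (coef u) =
  inf [set r | exists v, [/\ S v, coef v = coef u & r = nrm v]].
Proof.
move=> Su; have [v hv] := minimal_rep_exists Su.
rewrite /ipnorm (range_dotE hv hv) -/(nrm v).
set A := [set r | _].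
have Av : A (nrm v) by exists v; case: hv.
apply/eqP; rewrite eq_le; apply/andP; split.
  apply: lb_le_inf; first by exists (nrm v).
  by move=> _ [w [Sw cw ->]]; exact: (minimal_rep_min hv).
apply: inf_lbound Av; exists 0 => _ [w [_ _ ->]]; exact: dotnorm_ge0.
Qed.

End RangeSpace.

(** * Integrals of complex functions *)

Section ComplexIntegral.
Context {R : realType} (T : R).
Implicit Types (f g : R -> R[i]) (h : R -> R).

Local Notation mu := (@lebesgue_measure R).
Local Notation D := (itv0 T).

Definition cmeasurable g : Prop :=
  measurable_fun D (fun t => complex.Re (g t)) /\
  measurable_fun D (fun t => complex.Im (g t)).

Definition cintegrable g : Prop :=
  mu.-integrable D (EFin \o (fun t => complex.Re (g t))) /\
  mu.-integrable D (EFin \o (fun t => complex.Im (g t))).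

Lemma measurable_itv0 : measurable (D : set (measurableTypeR R)).
Proof. exact: measurable_itv. Qed.
Hint Extern 0 (measurable (itv0 _)) => exact: measurable_itv0 : core.

Lemma cmeasurable_cst (c : R[i]) : cmeasurable (fun=> c).
Proof. by split; exact: measurable_cst. Qed.

Lemma cmeasurableD f g :
  cmeasurable f -> cmeasurable g -> cmeasurable (fun t => f t + g t).
Proof.
move=> [f1 f2] [g1 g2]; split.
  by under eq_fun do rewrite ReD; exact: measurable_funD.
by under eq_fun do rewrite ImD; exact: measurable_funD.
Qed.

Lemma cmeasurableM f g :
  cmeasurable f -> cmeasurable g -> cmeasurable (fun t => f t * g t).
Proof.
move=> [f1 f2] [g1 g2]; split.
  under eq_fun do rewrite ReM.
  by apply: measurable_funB; exact: measurable_funM.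
under eq_fun do rewrite ImM.
by apply: measurable_funD; exact: measurable_funM.
Qed.

Lemma cmeasurable_conj f : cmeasurable f -> cmeasurable (fun t => (f t)^*).
Proof.
move=> [f1 f2]; split; first by under eq_fun do rewrite ReJ.
under eq_fun do rewrite ImJ.
exact: measurableT_comp.
Qed.

Lemma cmeasurable_real h : measurable_fun D h -> cmeasurable (fun t => (h t)%:C).
Proof. by move=> mh; split => //; exact: measurable_cst. Qed.

Lemma cmeasurableZ c f : cmeasurable f -> cmeasurable (fun t => c * f t).
Proof. by move=> mf; apply: cmeasurableM => //; exact: cmeasurable_cst. Qed.

Lemma cmeasurableN f : cmeasurable f -> cmeasurable (fun t => - f t).
Proof.
move=> /(@cmeasurableZ (-1)) mf.
by under [X in cmeasurable X]eq_fun do rewrite -mulN1r.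
Qed.

Lemma cmeasurable_sum (I : Type) (r : seq I) (F : I -> R -> R[i]) :
  (forall i, cmeasurable (F i)) ->
  cmeasurable (fun t => \sum_(i <- r) F i t).
Proof.
move=> mF; elim: r => [|i r IH].
  under [X in cmeasurable X]eq_fun do rewrite big_nil; exact: cmeasurable_cst.
under [X in cmeasurable X]eq_fun do rewrite big_cons; exact: cmeasurableD.
Qed.

Lemma cintegrable_measurable f : cintegrable f -> cmeasurable f.
Proof.
by move=> [f1 f2]; split; apply/measurable_EFinP; exact: (measurable_int mu).
Qed.

Lemma cintegrable_dom f h : cmeasurable f ->
  mu.-integrable D (EFin \o h) -> (forall t, D t -> cmod (f t) <= h t) ->
  cintegrable f.
Proof.
move=> [f1 f2] ih fh; split; apply: (le_integrable _ _ _ ih) => //.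
- exact/measurable_EFinP.
- move=> t /fh ft; rewrite /= lee_fin (le_trans (cmod_Re _)) //.
  exact: le_trans (ler_norm _).
- exact/measurable_EFinP.
- move=> t /fh ft; rewrite /= lee_fin (le_trans (cmod_Im _)) //.
  exact: le_trans (ler_norm _).
Qed.

Lemma integrable_add (h1 h2 : R -> R) : mu.-integrable D (EFin \o h1) ->
  mu.-integrable D (EFin \o h2) ->
  mu.-integrable D (EFin \o (fun t => h1 t + h2 t)).
Proof. by move=> i1 i2; exact: (integrableD measurable_itv0 i1 i2). Qed.

Lemma integrable_scale (k : R) (h : R -> R) : mu.-integrable D (EFin \o h) ->
  mu.-integrable D (EFin \o (fun t => k * h t)).
Proof. by move=> ih; exact: (integrableZl measurable_itv0 k ih). Qed.

Lemma cintegrable_lin (a : R[i]) f g : cintegrable f -> cintegrable g ->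
  cintegrable (fun t => a * f t + g t).
Proof.
have lin (p q : R) (h1 h2 h3 : R -> R) : mu.-integrable D (EFin \o h1) ->
    mu.-integrable D (EFin \o h2) -> mu.-integrable D (EFin \o h3) ->
    mu.-integrable D (EFin \o (fun t => p * h1 t + q * h2 t + h3 t)).
  move=> i1 i2 i3; apply: integrable_add => //.
  by apply: integrable_add; exact: integrable_scale.
move=> [f1 f2] [g1 g2]; split.
  have := lin (complex.Re a) (- complex.Im a) _ _ _ f1 f2 g1.
  by congr (_.-integrable _ (_ \o _)); apply/funext => t; rewrite ReD ReM mulNr.
have := lin (complex.Re a) (complex.Im a) _ _ _ f2 f1 g2.
by congr (_.-integrable _ (_ \o _)); apply/funext => t; rewrite ImD ImM.
Qed.

Lemma intC_lin (a : R[i]) f g : cintegrable f -> cintegrable g ->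
  intC T (fun t => a * f t + g t) = a * intC T f + intC T g.
Proof.
have lin (p q : R) (h1 h2 h3 : R -> R) : mu.-integrable D (EFin \o h1) ->
    mu.-integrable D (EFin \o h2) -> mu.-integrable D (EFin \o h3) ->
    \int[mu]_(t in D) (p * h1 t + q * h2 t + h3 t) =
    p * \int[mu]_(t in D) h1 t + q * \int[mu]_(t in D) h2 t +
    \int[mu]_(t in D) h3 t.
  move=> i1 i2 i3.
  have j1 := integrable_scale p i1; have j2 := integrable_scale q i2.
  rewrite RintegralD //; last exact: integrable_add.
  by rewrite RintegralD // !RintegralZl.
move=> [f1 f2] [g1 g2]; apply: complexP; rewrite /intC !ReImE.
  by rewrite -mulNr -lin //; apply: eq_Rintegral => t _; rewrite ReD ReM mulNr.
by rewrite -lin //; apply: eq_Rintegral => t _; rewrite ImD ImM.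
Qed.

Lemma eq_intC f g : (forall t, D t -> f t = g t) -> intC T f = intC T g.
Proof.
by move=> fg; rewrite /intC; congr (_ +i* _); apply: eq_Rintegral => t; rewrite inE => /fg ->.
Qed.

Lemma cintegrable0 : cintegrable (fun=> 0).
Proof. by split; exact: integrable0. Qed.

Lemma intC0 : intC T (fun=> 0) = 0.
Proof.
by apply: complexP; rewrite /intC !ReImE /= /Rintegral integral0.
Qed.

Lemma cintegrableZ (a : R[i]) f : cintegrable f -> cintegrable (fun t => a * f t).
Proof.
move=> fi; have := cintegrable_lin a fi cintegrable0.
by under [X in cintegrable X]eq_fun do rewrite addr0.
Qed.

Lemma intCZ (a : R[i]) f : cintegrable f ->
  intC T (fun t => a * f t) = a * intC T f.
Proof.
move=> fi; have := intC_lin a fi cintegrable0.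
by under eq_intC do rewrite addr0; rewrite intC0 addr0.
Qed.

Lemma cintegrableD f g : cintegrable f -> cintegrable g ->
  cintegrable (fun t => f t + g t).
Proof.
move=> fi gi; have := cintegrable_lin 1 fi gi.
by under [X in cintegrable X]eq_fun do rewrite mul1r.
Qed.

Lemma intCD f g : cintegrable f -> cintegrable g ->
  intC T (fun t => f t + g t) = intC T f + intC T g.
Proof.
move=> fi gi; have := intC_lin 1 fi gi.
by rewrite mul1r => <-; apply: eq_intC => t _; rewrite mul1r.
Qed.

Lemma cintegrableB f g : cintegrable f -> cintegrable g ->
  cintegrable (fun t => f t - g t).
Proof.
move=> fi gi; have := cintegrable_lin (-1) gi fi.
by under [X in cintegrable X]eq_fun do rewrite mulN1r addrC.
Qed.

Lemma intCB f g : cintegrable f -> cintegrable g ->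
  intC T (fun t => f t - g t) = intC T f - intC T g.
Proof.
move=> fi gi; have := intC_lin (-1) gi fi.
rewrite mulN1r addrC => <-; apply: eq_intC => t _.
by rewrite mulN1r addrC.
Qed.

Lemma cintegrable_sum (I : Type) (r : seq I) (F : I -> R -> R[i]) :
  (forall i, cintegrable (F i)) ->
  cintegrable (fun t => \sum_(i <- r) F i t).
Proof.
move=> mF; elim: r => [|i r IH].
  under [X in cintegrable X]eq_fun do rewrite big_nil; exact: cintegrable0.
under [X in cintegrable X]eq_fun do rewrite big_cons; exact: cintegrableD.
Qed.

Lemma intC_sum (I : Type) (r : seq I) (F : I -> R -> R[i]) :
  (forall i, cintegrable (F i)) ->
  intC T (fun t => \sum_(i <- r) F i t) = \sum_(i <- r) intC T (F i).
Proof.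
move=> iF; elim: r => [|i r IH].
  by under eq_intC do rewrite big_nil; rewrite big_nil intC0.
under eq_intC do rewrite big_cons.
by rewrite big_cons intCD // ?IH //; exact: cintegrable_sum.
Qed.

(** The factor 2, which comes from bounding the real and imaginary parts
    separately, is harmless in the estimates below. *)
Lemma cmod_intC f h : cintegrable f -> mu.-integrable D (EFin \o h) ->
  (forall t, D t -> cmod (f t) <= h t) ->
  cmod (intC T f) <= 2 * \int[mu]_(t in D) h t.
Proof.
move=> [f1 f2] ih fh; apply: (le_trans (cmod_le _)).
rewrite mulr_natl mulr2n /intC !ReImE.
apply: lerD; apply: (le_trans (le_normr_Rintegral _ _)) => //;
  apply: le_Rintegral => //; try exact: integrable_norm;
  move=> t /fh; exact: le_trans (cmod_Re _) || exact: le_trans (cmod_Im _).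
Qed.

End ComplexIntegral.

#[global] Hint Extern 0 (measurable (itv0 _)) => exact: measurable_itv0 : core.

Section SeriesIntegral.
Context {R : realType} (T : R) (T_gt0 : 0 < T).

Local Notation mu := (@lebesgue_measure R).
Local Notation D := (itv0 T).
Local Open Scope fset_scope.
Local Open Scope ring_scope.

Lemma lebesgue_itv0 : mu D = T%:E.
Proof.
by rewrite /itv0 lebesgue_measure_itv /= lte_fin T_gt0 oppr0 adde0.
Qed.

Lemma integrable_cst (c : R) : mu.-integrable D (EFin \o (fun=> c)).
Proof.
apply: measurable_bounded_integrable; first exact: measurable_itv0.
- by have := lebesgue_itv0 => /(congr1 (fun x => (x < +oo)%E)) /= ->; rewrite ltry.
- exact: measurable_cst.
by exists `|c|; split => // M cM t _; rewrite ltW.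
Qed.

Lemma cintegrable_bounded (M : R) (f : R -> R[i]) : cmeasurable T f ->
  (forall t, D t -> cmod (f t) <= M) -> cintegrable T f.
Proof. by move=> mf; apply: cintegrable_dom => //; exact: integrable_cst. Qed.

Lemma cintegrable_mul (M : R) (y u : R -> R[i]) : cmeasurable T y ->
  (forall t, D t -> cmod (y t) <= M) -> cintegrable T u ->
  cintegrable T (fun t => y t * u t).
Proof.
move=> my yM iu.
apply: (@cintegrable_dom _ _ _
  (fun t => M * (`|complex.Re (u t)| + `|complex.Im (u t)|))).
- by apply: cmeasurableM => //; exact: cintegrable_measurable.
- apply: integrable_scale; case: iu => u1 u2.
  by apply: integrable_add; exact: integrable_norm.
- by move=> t Dt; rewrite cmodM ler_pM ?cmod_ge0 ?yM // cmod_le.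
Qed.

(** The sum is the pointwise limit of a sequence of finite partial sums, which
    [has_sum_unif] provides independently of [t]. *)
Lemma cmeasurable_sumC (I : choiceType) (a : I -> R) (x : I -> R -> R[i]) :
  fsummable a -> (forall i, cmeasurable T (x i)) ->
  (forall i t, D t -> cmod (x i t) <= a i) ->
  cmeasurable T (fun t => sumC (x ^~ t)).
Proof.
move=> fa mx xa.
have /choice[J hJ] : forall n : nat, exists J0 : {fset I}, forall y : I -> R[i],
    (forall i, cmod (y i) <= a i) ->
    cmod (\sum_(i <- J0) y i - sumC y) <= n.+1%:R^-1.
  move=> n; have n0 : (0 : R) < n.+1%:R^-1 by [].
  have [J0 h] := has_sum_unif fa n0.
  by exists J0 => y ya; exact: h.
have mJ n : cmeasurable T (fun t => \sum_(i <- J n) x i t).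
  exact: cmeasurable_sum.
have lim t : D t -> forall e : R, 0 < e -> \forall n \near \oo,
    cmod (\sum_(i <- J n) x i t - sumC (x ^~ t)) <= e.
  move=> Dt e e0; near=> n.
  apply: (le_trans (hJ n (x ^~ t) (fun i => xa i t Dt))).
  by near: n; have := near_infty_natSinv_lt (PosNum e0); apply: filterS => n /ltW.
split.
  apply: (@measurable_fun_cvg _ _ _ _ (fun n t => complex.Re (\sum_(i <- J n) x i t))).
    by move=> n; exact: (mJ n).1.
  move=> t Dt; apply/cvgrPdist_le => e e0.
  have := lim t Dt e e0; apply: filterS => n; apply: le_trans.
  by rewrite -ReN -ReD -cmodN opprB; exact: cmod_Re.
apply: (@measurable_fun_cvg _ _ _ _ (fun n t => complex.Im (\sum_(i <- J n) x i t))).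
  by move=> n; exact: (mJ n).2.
move=> t Dt; apply/cvgrPdist_le => e e0.
have := lim t Dt e e0; apply: filterS => n; apply: le_trans.
by rewrite -ImN -ImD -cmodN opprB; exact: cmod_Im.
Unshelve. all: by end_near. Qed.

(** By [has_sum_unif] the partial sums converge uniformly, and the integrable
    weight [u] turns uniform smallness into smallness of the integral. *)
Lemma has_sum_intC (I : choiceType) (a : I -> R) (x : I -> R -> R[i])
    (u : R -> R[i]) :
  fsummable a -> (forall i, cmeasurable T (x i)) -> 
  (forall i t, D t -> cmod (x i t) <= a i) -> 
  cintegrable T u -> 
  has_sum (fun i => intC T (fun t => x i t * u t))
          (intC T (fun t => sumC (x ^~ t) * u t)).
Proof.
move=> fa mx xa iu.
pose k t := `|complex.Re (u t)| + `|complex.Im (u t)|.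
have ik : mu.-integrable D (EFin \o k).
  by case: iu => u1 u2; apply: integrable_add; exact: integrable_norm.
have uk t : cmod (u t) <= k t by exact: cmod_le.
have [M hM] := fa.2.
have ms : cmeasurable T (fun t => sumC (x ^~ t)).
  exact: (cmeasurable_sumC fa).
have is_ : cintegrable T (fun t => sumC (x ^~ t) * u t).
  apply: (cintegrable_mul (M := M)) => // t Dt; apply: (cmod_sumC fa.1 hM) => i; exact: xa.
have ix i : cintegrable T (fun t => x i t * u t).
  by apply: (cintegrable_mul (M := a i)) => // t; exact: xa.
move=> e e0.
pose K := \int[mu]_(t in D) k t.
have K0 : 0 <= K by apply: Rintegral_ge0 => t _; rewrite addr_ge0.
have e1 : 0 < e / (2 * K + 1) by rewrite divr_gt0 //; lra.
have [J0 hJ0] := has_sum_unif fa e1.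
exists J0 => J J0J.
rewrite -intC_sum // -intCB //; last exact: cintegrable_sum.
have e2 : 2 * \int[mu]_(t in D) (e / (2 * K + 1) * k t) <= e.
  rewrite RintegralZl // -/K mulrCA mulrAC ler_pdivrMr; last by lra.
  by rewrite ler_wpM2l ?(ltW e0) //; lra.
apply: le_trans e2; apply: cmod_intC.
- by apply: cintegrableB => //; exact: cintegrable_sum.
- exact: integrable_scale.
- move=> t Dt; rewrite -mulr_suml -mulrBl cmodM ler_pM ?cmod_ge0 //.
  by apply: (hJ0 (x ^~ t)) => // i; exact: xa.
Qed.

End SeriesIntegral.

(** * Completeness of square integrable functions *)

Section RieszFischer.
Context {R : realType} {d : measure_display} {X : measurableType d}.
Context (mu : {measure set X -> \bar R}) (D : set X).
Context (mD : measurable D) (finD : (mu D < +oo)%E).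

Lemma limn_einf_le (u : nat -> \bar R) (l : \bar R) (N : nat) :
  (forall n, (N <= n)%N -> (u n <= l)%E) -> (limn_einf u <= l)%E.
Proof.
move=> ul; rewrite limn_einf_lim; apply: lime_le; first exact: is_cvg_einfs.
apply: nearW => n; apply: (@le_trans _ _ (u (maxn N n))).
  by apply: ereal_inf_lbound; exists (maxn N n) => //=; rewrite leq_maxr.
by apply: ul; rewrite leq_maxl.
Qed.

(** A rapidly Cauchy sequence has summable increments in [L^1] of a finite
    measure, hence converges almost everywhere. *)
Lemma rapidly_cauchy_cvg_ae (h : nat -> X -> R) :
  (forall n, measurable_fun D (h n)) ->
  (forall k, (\int[mu]_(x in D) ((h k.+1 x - h k x) ^+ 2)%:E <=
              ((((1 + k%:R) ^+ 2)^-1) ^+ 2)%:E)%E) ->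
  {ae mu, forall x, D x -> cvgn (h ^~ x)}.
Proof.
move=> mh hk.
pose w (k : nat) : R := ((1 + k%:R) ^+ 2)^-1.
have w0 k : 0 < w k.
  by rewrite /w invr_gt0 exprn_gt0 // ltr_wpDr.
(* the weights [w k] are summable, and [b <= a + b ^ 2 / a] with [a = w k] bounds
   the integral of an increment by a multiple of [w k] *)
pose dl k x := `|h k.+1 x - h k x|.
have mdl k : measurable_fun D (dl k).
  by apply: measurableT_comp => //; exact: measurable_funB.
have mdlE k : measurable_fun D (fun x => (dl k x)%:E).
  exact/measurable_EFinP.
pose C : R := fine (mu D) + 1.
have muDE : mu D = (fine (mu D))%:E by rewrite fineK // ge0_fin_numE.
have C0 : 0 <= C by rewrite addr_ge0 // fine_ge0.
have idl k : (\int[mu]_(x in D) (dl k x)%:E <= (C * w k)%:E)%E.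
  pose q x := (h k.+1 x - h k x) ^+ 2.
  have mq : measurable_fun D q.
    by apply: measurable_funX; exact: measurable_funB.
  have q0 x : 0 <= q x by exact: sqr_ge0.
  apply: (@le_trans _ _ (\int[mu]_(x in D) ((w k)%:E + (w k)^-1%:E * (q x)%:E))%E).
    apply: ge0_le_integral => //.
    - by move=> x _; rewrite lee_fin normr_ge0.
    - apply: emeasurable_funD; first exact: measurable_cst.
      by apply: measurable_funeM; exact/measurable_EFinP.
    - move=> x _; rewrite -EFinM -EFinD lee_fin /q -(@real_normK _ (_ - _)) ?num_real // -/(dl k x).
      have := w0 k; move: (w k) (dl k x) => a b a0.
      rewrite -(ler_pM2r a0) mulrDl -mulrAC mulVf ?lt0r_neq0 // mul1r.
      have := sqr_ge0 (a - b); have := sqr_ge0 a; have := sqr_ge0 b.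
      by rewrite !expr2; nra.
  rewrite ge0_integralD //; last 3 first.
  - by move=> x _; rewrite lee_fin ltW.
  - by move=> x _; rewrite -EFinM lee_fin mulr_ge0 // invr_ge0 ltW.
  - by apply: measurable_funeM; exact/measurable_EFinP.
  rewrite integral_cst // ge0_integralZl //; last 3 first.
  - exact/measurable_EFinP.
  - by move=> x _; rewrite lee_fin.
  - by rewrite lee_fin invr_ge0 ltW.
  rewrite muDE /C mulrDl mul1r EFinD; apply: leeD.
    by rewrite -EFinM mulrC.
  have := hk k; rewrite -/(w k) => hk'.
  apply: (@le_trans _ _ ((w k)^-1%:E * (w k ^+ 2)%:E)%E).
    by apply: lee_wpmul2l => //; rewrite lee_fin invr_ge0 ltW.
  by rewrite -EFinM lee_fin expr2 mulKf // lt0r_neq0.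
have dl0 k x : (0 <= (dl k x)%:E)%E by rewrite lee_fin normr_ge0.
pose G x := (\sum_(0 <= k <oo) (dl k x)%:E)%E.
have mG : measurable_fun D G.
  exact: ge0_emeasurable_sum.
have iG : (\int[mu]_(x in D) G x <= (C * 2)%:E)%E.
  rewrite integral_nneseries //.
  apply: lime_le.
    by apply: is_cvg_nneseries => n _ _; exact: integral_ge0.
  apply: nearW => n.
  apply: (@le_trans _ _ (\sum_(0 <= k < n) (C * w k)%:E)%E).
    by apply: lee_sum => k _; exact: idl.
  rewrite sumEFin lee_fin -mulr_sumr ler_wpM2l //.
  exact: sum_inv_square_le.
have G0 x : (0 <= G x)%E by apply: nneseries_ge0.
have : mu.-integrable D G.
  apply/integrableP; split => //.
  under eq_integral do rewrite gee0_abs //.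
  exact: le_lt_trans iG (ltry _).
move=> /(integrable_ae mD); apply: filterS => x Gx Dx.
have -> : h ^~ x = (fun n => h 0%N x + series (telescope (h ^~ x)) n).
  by apply/funext => n; rewrite -eq_sum_telescope.
apply: is_cvgD; first exact: is_cvg_cst.
apply: normed_cvg; apply: nondecreasing_is_cvgn.
  by apply: nondecreasing_series => i _ _; exact: normr_ge0.
exists (fine (G x)) => _ [n _ <-].
rewrite -lee_fin fineK; last exact: Gx.
rewrite /series /= -sumEFin.
by apply: nneseries_lim_ge => k _ _; exact: dl0.
Qed.

(** The limit of a rapidly Cauchy subsequence exists almost everywhere; Fatou's
    lemma bounds its distance to the terms of the whole sequence. *)
Theorem L2_complete (f : nat -> X -> R) :
  (forall n, measurable_fun D (f n)) ->
  (forall e : R, 0 < e -> exists N, forall m n, (N <= m)%N -> (N <= n)%N ->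
     (\int[mu]_(x in D) ((f m x - f n x) ^+ 2)%:E <= e%:E)%E) ->
  exists2 g : X -> R, measurable_fun D g &
    forall e : R, 0 < e -> exists N, forall n, (N <= n)%N ->
     (\int[mu]_(x in D) ((f n x - g x) ^+ 2)%:E <= e%:E)%E.
Proof.
move=> mf cf.
pose w (k : nat) : R := ((1 + k%:R) ^+ 2)^-1.
have w0 k : 0 < w k.
  by rewrite /w invr_gt0 exprn_gt0 // ltr_wpDr.
have /choice[N hN] : forall k, exists N, forall m n, (N <= m)%N -> (N <= n)%N ->
     (\int[mu]_(x in D) ((f m x - f n x) ^+ 2)%:E <= (w k ^+ 2)%:E)%E.
  by move=> k; apply: cf; rewrite exprn_gt0.
pose p k := (\max_(i < k.+1) maxn i (N i))%N.
have ph k i : (i <= k)%N -> (N i <= p k)%N.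
  move=> ik; apply: leq_trans (leq_maxr i _) _.
  exact: (@leq_bigmax _ (fun i : 'I_k.+1 => maxn i (N i)) (Ordinal (ik : (i < k.+1)%N))).
have pk k : (k <= p k)%N.
  apply: leq_trans (leq_maxl k (N k)) _.
  exact: (@leq_bigmax _ (fun i : 'I_k.+1 => maxn i (N i)) ord_max).
pose h k := f (p k).
have mh k : measurable_fun D (h k) by exact: mf.
have hk k : (\int[mu]_(x in D) ((h k.+1 x - h k x) ^+ 2)%:E <= (w k ^+ 2)%:E)%E.
  by apply: hN; apply: ph.
have [A [mA A0 hA]] := rapidly_cauchy_cvg_ae mh hk.
(* set to 0 on the null set [A] where convergence may fail *)
pose h' k := h k \_ (~` A).
have h'A k x : ~ A x -> h' k x = h k x.
  by move=> xA; rewrite /h' patchE ifT // inE.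
have mh' k : measurable_fun D (h' k).
  apply/measurable_restrict => //; first exact: measurableC.
  apply: measurable_funS (mh k) => //; exact: subIsetl.
have ch' x : D x -> cvgn (h' ^~ x).
  move=> Dx; have [xA|xA] := pselect (A x).
    have -> : h' ^~ x = cst 0.
      by apply/funext => k; rewrite /h' patchE ifF //; apply/negbTE/negP; rewrite inE.
    exact: is_cvg_cst.
  have -> : h' ^~ x = h ^~ x by apply/funext => k; exact: h'A.
  by apply: contrapT => nc; apply: xA; apply: hA => /= /(_ Dx).
pose g x := limn (h' ^~ x).
have mg : measurable_fun D g.
  by apply: (measurable_fun_cvg mh') => x Dx; exact: ch'.
exists g => // e e0.
have [M hM] := cf e e0; exists M => n Mn.
pose F k x := ((h' k x - f n x) ^+ 2)%:E.
have mF k : measurable_fun D (F k).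
  apply/measurable_EFinP; apply: measurable_funX; exact: measurable_funB.
have F0 k x : D x -> (0 <= F k x)%E by rewrite lee_fin sqr_ge0.
have := fatou mu mD mF F0.
have -> : (\int[mu]_(x in D) limn_einf (F ^~ x) =
  \int[mu]_(x in D) ((f n x - g x) ^+ 2)%:E)%E.
  apply: eq_integral => x; rewrite inE => Dx.
  have /cvg_limn_einf_sup[-> _] // : F ^~ x @ \oo --> ((f n x - g x) ^+ 2)%:E.
  apply: cvg_EFin; first exact: nearW.
  have -> : (f n x - g x) ^+ 2 = (g x - f n x) ^+ 2 by rewrite -sqrrN opprB.
  rewrite /F /=.
  have c : h' ^~ x @ \oo --> g x by exact: ch'.
  have c2 : (fun k => h' k x - f n x) @ \oo --> g x - f n x.
    by apply: cvgB => //; exact: cvg_cst.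
  have c3 : (fun k => (h' k x - f n x) * (h' k x - f n x)) @ \oo -->
      (g x - f n x) * (g x - f n x) by exact: cvgM.
  rewrite expr2.
  have -> : fine \o (fun k => ((h' k x - f n x) ^+ 2)%:E) =
      (fun k => (h' k x - f n x) * (h' k x - f n x)).
    by apply/funext => k; rewrite /= expr2.
  exact: c3.
move=> /le_trans; apply.
apply: (@limn_einf_le _ _ M) => k Mk.
have -> : (\int[mu]_(x in D) F k x = \int[mu]_(x in D) ((h k x - f n x) ^+ 2)%:E)%E.
  apply: ge0_ae_eq_integral => //.
  - apply/measurable_EFinP; apply: measurable_funX; exact: measurable_funB.
  - exact: F0.
  - by move=> x _; rewrite lee_fin sqr_ge0.
  - exists A; split => // x /= /not_implyP[Dx neq].
    by apply: contrapT => xA; apply: neq; rewrite /F h'A.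
by apply: hM => //; exact: leq_trans Mk (pk k).
Qed.

End RieszFischer.

(** * The Hilbert space of complex controls *)

Section ComplexL2.
Context {R : realType} (T : R) (T_gt0 : 0 < T).
Implicit Types (u v : R -> R[i]).

Local Notation mu := (@lebesgue_measure R).
Local Notation D := (itv0 T).

Definition dotL2 u v : R[i] := intC T (fun t => u t * (v t)^*).

Lemma sqnorm_ge0 (z : R[i]) : 0 <= sqnorm z.
Proof. by rewrite -cmod_sqr sqr_ge0. Qed.

Lemma measurable_sqnorm u : cmeasurable T u ->
  measurable_fun D (fun t => sqnorm (u t)).
Proof. by move=> [u1 u2]; apply: measurable_funD; exact: measurable_funX. Qed.

Lemma L2CP u : L2C T u <->
  cmeasurable T u /\ mu.-integrable D (EFin \o (fun t => sqnorm (u t))).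
Proof.
split=> [[u1 u2 u3]|[mu_ iu]].
  have mu_ : cmeasurable T u by split.
  split => //; apply/integrableP; split.
    by apply/measurable_EFinP; exact: measurable_sqnorm.
  under eq_integral do rewrite gee0_abs ?lee_fin ?sqnorm_ge0 //.
  exact: u3.
case: (mu_) => u1 u2; split => //.
move/integrableP : iu => [_]; under eq_integral do rewrite gee0_abs ?lee_fin ?sqnorm_ge0 //.
exact.
Qed.

Lemma L2C_measurable u : L2C T u -> cmeasurable T u.
Proof. by move=> /L2CP[]. Qed.

Lemma L2C_dom u (h : R -> R) : cmeasurable T u ->
  mu.-integrable D (EFin \o h) -> (forall t, D t -> sqnorm (u t) <= h t) ->
  L2C T u.
Proof.
move=> mu_ ih uh; apply/L2CP; split => //.
apply: (le_integrable _ _ _ ih) => //.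
  by apply/measurable_EFinP; exact: measurable_sqnorm.
move=> t /uh ut; rewrite /= lee_fin ger0_norm ?sqnorm_ge0 //.
exact: le_trans (ler_norm _).
Qed.

Lemma L2C_bounded u (M : R) : cmeasurable T u ->
  (forall t, D t -> cmod (u t) <= M) -> L2C T u.
Proof.
move=> mu_ uM; apply: (@L2C_dom _ (fun=> M ^+ 2)) => //.
  exact: integrable_cst.
move=> t /uM ut; rewrite -cmod_sqr lerXn2r ?nnegrE ?cmod_ge0 //.
exact: le_trans (cmod_ge0 _) ut.
Qed.

Lemma L2C_lin (a : R[i]) u v : L2C T u -> L2C T v -> L2C T (a *: u + v).
Proof.
move=> /L2CP[mu_ iu] /L2CP[mv iv].
apply: (@L2C_dom _ (fun t => 2 * sqnorm a * sqnorm (u t) + 2 * sqnorm (v t))).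
- by apply: (@cmeasurableD _ _ (fun t => a * u t) v) => //; exact: cmeasurableZ.
- by apply: integrable_add; exact: integrable_scale.
- move=> t _; rewrite -[(_ + _) t]/(a * u t + v t) -mulrA -!cmod_sqr.
  have h := cmodD (a * u t) (v t); rewrite -exprMn -cmodM.
  have := cmod_ge0 (a * u t + v t); have := cmod_ge0 (v t).
  have := cmod_ge0 (a * u t); move: h.
  move: (cmod (_ + _)) (cmod (a * _)) (cmod (v t)) => x y z h y0 z0 x0.
  have : x ^+ 2 <= (y + z) ^+ 2 by rewrite lerXn2r ?nnegrE // addr_ge0.
  have := sqr_ge0 (y - z); rewrite sqrrB sqrrD; lra.
Qed.

Lemma L2C_mul_integrable u v : L2C T u -> L2C T v ->
  cintegrable T (fun t => u t * (v t)^*).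
Proof.
move=> /L2CP[mu_ iu] /L2CP[mv iv].
apply: (@cintegrable_dom _ _ _ (fun t => sqnorm (u t) + sqnorm (v t))).
- by apply: cmeasurableM => //; exact: cmeasurable_conj.
- exact: integrable_add.
- move=> t _; rewrite cmodM cmod_conj -!cmod_sqr.
  have := cmod_ge0 (u t); have := cmod_ge0 (v t).
  move: (cmod (u t)) (cmod (v t)) => x y x0 y0.
  have := sqr_ge0 (x - y); rewrite sqrrB; nra.
Qed.

Lemma L2C_integrable u : L2C T u -> cintegrable T u.
Proof.
move=> /L2CP[mu_ iu].
apply: (@cintegrable_dom _ _ _ (fun t => 1 + sqnorm (u t))) => //.
  by apply: integrable_add => //; exact: integrable_cst.
move=> t _; rewrite -cmod_sqr; have := sqr_ge0 (cmod (u t) - 1).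
by rewrite sqrrB; have := cmod_ge0 (u t); lra.
Qed.

Lemma dotL2_self u : complex.Re (dotL2 u u) = \int[mu]_(t in D) sqnorm (u t).
Proof.
rewrite /dotL2 /intC !ReImE; apply: eq_Rintegral => t _.
by rewrite /sqnorm !ReImE; ring.
Qed.

Lemma dotnorm_L2norm u : dotnorm dotL2 u = L2norm T u.
Proof. by rewrite /dotnorm dotL2_self. Qed.

Lemma integral_sqnorm u : L2C T u ->
  (\int[mu]_(t in D) (sqnorm (u t))%:E)%E = (dotnorm dotL2 u ^+ 2)%:E.
Proof.
move=> /L2CP[mu_ iu].
rewrite /dotnorm dotL2_self sqr_sqrtr; last first.
  by apply: Rintegral_ge0 => t _; exact: sqnorm_ge0.
by rewrite fineK //; exact: integrable_fin_num.
Qed.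

Lemma L2C_parts u (a b : R) : cmeasurable T u ->
  (\int[mu]_(t in D) (complex.Re (u t) ^+ 2)%:E <= a%:E)%E ->
  (\int[mu]_(t in D) (complex.Im (u t) ^+ 2)%:E <= b%:E)%E ->
  L2C T u /\ dotnorm dotL2 u ^+ 2 <= a + b.
Proof.
move=> [u1 u2] ua ub.
have le_ab : (\int[mu]_(t in D) (sqnorm (u t))%:E <= (a + b)%:E)%E.
  under eq_integral do rewrite EFinD.
  rewrite ge0_integralD //.
  - by rewrite EFinD; exact: leeD.
  - by move=> t _; rewrite lee_fin sqr_ge0.
  - by apply/measurable_EFinP; exact: measurable_funX.
  - by move=> t _; rewrite lee_fin sqr_ge0.
  - by apply/measurable_EFinP; exact: measurable_funX.
have L : L2C T u by split => //; exact: le_lt_trans le_ab (ltry _).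
by split => //; rewrite -lee_fin -integral_sqnorm.
Qed.

Lemma L2C_complete (u_ : nat -> R -> R[i]) : (forall n, L2C T (u_ n)) ->
  (forall e : R, 0 < e -> exists N : nat, forall m n : nat,
     (N <= m)%N -> (N <= n)%N -> dotnorm dotL2 (u_ m - u_ n) < e) ->
  exists2 u, L2C T u & forall e : R, 0 < e -> exists N : nat, forall n : nat,
     (N <= n)%N -> dotnorm dotL2 (u_ n - u) < e.
Proof.
move=> Lu cu.
have LB u v : L2C T u -> L2C T v -> L2C T (u - v).
  by move=> Lu' Lv; have := L2C_lin (-1) Lv Lu'; rewrite scaleN1r addrC.
have finD : (mu D < +oo)%E.
  by have := lebesgue_itv0 T_gt0 => /(congr1 (fun x => (x < +oo)%E)) /= ->; rewrite ltry.
have part (p : R[i] -> R) :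
    (forall z w, p (z - w) = p z - p w) -> (forall z, p z ^+ 2 <= sqnorm z) ->
    (forall u, cmeasurable T u -> measurable_fun D (fun t => p (u t))) ->
    exists2 g : R -> R, measurable_fun D g &
    forall e : R, 0 < e -> exists N, forall n, (N <= n)%N ->
     (\int[mu]_(x in D) ((p (u_ n x) - g x) ^+ 2)%:E <= e%:E)%E.
  move=> pB ple mp.
  apply: (L2_complete (measurable_itv0 T) finD (f := fun n t => p (u_ n t))).
    by move=> n; apply: mp; exact: L2C_measurable.
  move=> e e0; have [|N hN] := cu (Num.sqrt e); first by rewrite sqrtr_gt0.
  exists N => m n Nm Nn.
  have LBmn := LB _ _ (Lu m) (Lu n).
  apply: (@le_trans _ _ (\int[mu]_(t in D) (sqnorm ((u_ m - u_ n) t))%:E)%E).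
    apply: ge0_le_integral => //.
    - by move=> t _; rewrite lee_fin sqr_ge0.
    - apply/measurable_EFinP; apply: measurable_funX; apply: measurable_funB.
        by apply: mp; exact: L2C_measurable.
      by apply: mp; exact: L2C_measurable.
    - apply/measurable_EFinP; apply: measurable_sqnorm; exact: L2C_measurable.
    - by move=> t _; rewrite lee_fin -pB; exact: ple.
  rewrite integral_sqnorm // lee_fin -(sqr_sqrtr (ltW e0)).
  by rewrite lerXn2r ?nnegrE ?dotnorm_ge0 ?sqrtr_ge0 // ltW // hN.
have [g1 mg1 hg1] : exists2 g : R -> R, measurable_fun D g &
    forall e : R, 0 < e -> exists N, forall n, (N <= n)%N ->
     (\int[mu]_(x in D) ((complex.Re (u_ n x) - g x) ^+ 2)%:E <= e%:E)%E.
  apply: part => [z w|z|u []//]; first by rewrite ReD ReN.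
  by rewrite /sqnorm lerDl sqr_ge0.
have [g2 mg2 hg2] : exists2 g : R -> R, measurable_fun D g &
    forall e : R, 0 < e -> exists N, forall n, (N <= n)%N ->
     (\int[mu]_(x in D) ((complex.Im (u_ n x) - g x) ^+ 2)%:E <= e%:E)%E.
  apply: part => [z w|z|u []//]; first by rewrite ImD ImN.
  by rewrite /sqnorm lerDr sqr_ge0.
pose g t := g1 t +i* g2 t.
have key (e : R) : 0 < e -> exists N : nat, forall n, (N <= n)%N ->
    L2C T (u_ n - g) /\ dotnorm dotL2 (u_ n - g) ^+ 2 <= e + e.
  move=> e0; have [N1 h1] := hg1 e e0; have [N2 h2] := hg2 e e0.
  exists (maxn N1 N2) => n; rewrite geq_max => /andP[Nn1 Nn2].
  have [m1 m2] := L2C_measurable (Lu n).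
  apply: L2C_parts.
  - split.
      apply: (eq_measurable_fun (fun t => complex.Re (u_ n t) - g1 t)) => [t _|].
        by rewrite -[(_ - _) t]/(u_ n t - g t) ReD ReN.
      exact: measurable_funB.
    apply: (eq_measurable_fun (fun t => complex.Im (u_ n t) - g2 t)) => [t _|].
      by rewrite -[(_ - _) t]/(u_ n t - g t) ImD ImN.
    exact: measurable_funB.
  - apply: le_trans (h1 n Nn1); rewrite le_eqVlt; apply/orP; left; apply/eqP.
    by apply: eq_integral => t _; rewrite -[(_ - _) t]/(u_ n t - g t) ReD ReN.
  - apply: le_trans (h2 n Nn2); rewrite le_eqVlt; apply/orP; left; apply/eqP.
    by apply: eq_integral => t _; rewrite -[(_ - _) t]/(u_ n t - g t) ImD ImN.
exists g.
  have [N hN] := key 1 ltr01; have [Lg _] := hN N (leqnn N).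
  have -> : g = u_ N - (u_ N - g) by rewrite opprB addrC subrK.
  exact: LB.
move=> e e0.
have [|N hN] := key (e ^+ 2 / 4); first by rewrite divr_gt0 ?exprn_gt0.
exists N => n /hN[_ h].
rewrite -(@ltr_pXn2r _ 2) ?nnegrE ?(ltW e0) ?dotnorm_ge0 //.
have := exprn_gt0 2 e0; lra.
Qed.

(** Functions that agree almost everywhere are kept apart, so the inner
    product is only semi-definite. *)
Theorem L2C_semi_hilbert : semi_hilbert (L2C T) dotL2.
Proof.
have L0 : L2C T 0.
  apply: (@L2C_bounded _ 0); first exact: (cmeasurable_cst T 0).
  by move=> t _; rewrite [cmod _]cmod0.
split => //.
- exact: L2C_lin.
- move=> a u v w Lu Lv Lw; rewrite /dotL2 -intC_lin //; try exact: L2C_mul_integrable.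
  by apply: eq_intC => t _; rewrite -[(_ + _) t]/(a * u t + v t); ring.
- move=> u v Lu Lv; rewrite /dotL2.
  have [i1 i2] := L2C_mul_integrable Lu Lv.
  apply: complexP; rewrite /intC !ReImE.
    by apply: eq_Rintegral => t _; rewrite !ReImE; ring.
  rewrite -mulN1r -RintegralZl //; apply: eq_Rintegral => t _.
  by rewrite !ReImE; ring.
- move=> u Lu; rewrite lecE; apply/andP; split.
    rewrite /dotL2 /intC !ReImE; apply/eqP.
    rewrite -[RHS](_ : \int[mu]_(t in D) 0 = 0); last by rewrite Rintegral_cst // mul0r.
    by apply: eq_Rintegral => t _; rewrite !ReImE; ring.
  by rewrite dotL2_self; apply: Rintegral_ge0 => t _; exact: sqnorm_ge0.
- exact: L2C_complete.
Qed.

End ComplexL2.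

(** * Estimates of the heat kernel in a sector *)

Section HeatKernelBounds.
Context {R : realType}.
Implicit Types (z w h q : R[i]) (t b c : R) (n : int).

(** [dxK z t] is [- z * kap t * gauss z t]: the positive factor carries the
    singularity at [t = 0], the exponential one its cancellation. *)
Definition kap t : R := (4 * Num.sqrt pi * t `^ (3 / 2))^-1.

Definition gauss z t : R[i] := expC (- (z ^+ 2 * ((4 * t)^-1)%:C)).

Lemma realC_inv t : (t%:C)^-1 = (t^-1)%:C :> R[i].
Proof. by rewrite fmorphV. Qed.

Lemma dxKE z t : dxK z t = - (z * (kap t)%:C * gauss z t).
Proof. by rewrite /dxK !realC_inv mulNr. Qed.

Lemma cmod_gauss z t :
  cmod (gauss z t) = expR (- (complex.Re (z ^+ 2) / (4 * t))).
Proof. by rewrite cmod_expC !ReImE mulr0 subr0. Qed.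

Lemma sqrt_pi_ge1 : 1 <= Num.sqrt pi :> R.
Proof. by rewrite -[1]sqrtr1 ler_wsqrtr // (le_trans _ (pi_ge2 R)) // ler1n. Qed.

Lemma kap_gt0 t : 0 < t -> 0 < kap t.
Proof.
move=> t0; rewrite /kap invr_gt0 mulr_gt0 ?powR_gt0 //.
by have := sqrt_pi_ge1; lra.
Qed.

Lemma cmod_dxK z t : 0 < t ->
  cmod (dxK z t) = cmod z * kap t * expR (- (complex.Re (z ^+ 2) / (4 * t))).
Proof.
move=> t0; rewrite dxKE cmodN (cmodM (z * _) (gauss z t)) cmod_gauss (cmodM z).
by rewrite cmod_real gtr0_norm ?kap_gt0.
Qed.

Lemma powR32 t : 0 < t -> t `^ (3 / 2) = t * Num.sqrt t.
Proof.
move=> t0; have -> : 3 / 2 = 1 + 2^-1 :> R by field.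
rewrite powRD ?powRr1 ?(ltW t0) ?powR12_sqrt ?(ltW t0) //.
by apply/implyP => _; exact: lt0r_neq0.
Qed.

Lemma kap_sqr t : 0 < t -> kap t ^+ 2 = (16 * pi * t ^+ 3)^-1.
Proof.
move=> t0; rewrite /kap exprVn; congr (_^-1).
rewrite powR32 // !exprMn !sqr_sqrtr ?(ltW t0) ?pi_ge0 //.
by ring.
Qed.

Lemma kap_le T t : 0 < t -> t <= T -> kap t <= (1 + T) * (t ^+ 2)^-1.
Proof.
move=> t0 tT; rewrite /kap powR32 //.
have p1 := sqrt_pi_ge1.
have s0 : 0 < Num.sqrt t by rewrite sqrtr_gt0.
have st : Num.sqrt t ^+ 2 = t by rewrite sqr_sqrtr // ltW.
have s1 : Num.sqrt t <= 1 + T.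
  by have := sqr_ge0 (Num.sqrt t - 1); rewrite sqrrB st; lra.
move: (Num.sqrt t) s0 st s1 => s s0 st s1.
rewrite ler_pdivlMr ?exprn_gt0 //.
apply: le_trans s1.
rewrite mulrC ler_pdivrMr; last by rewrite !mulr_gt0 // ?exprn_gt0 //; lra.
rewrite -st.
have h : 0 < s ^+ 4 by rewrite exprn_gt0.
have -> : (s ^+ 2) ^+ 2 = s ^+ 4 by ring.
have -> : s * (4 * Num.sqrt pi * (s ^+ 2 * s)) = s ^+ 4 * (4 * Num.sqrt pi) by ring.
by rewrite ler_peMr ?(ltW h) //; lra.
Qed.

Lemma exp_decay m b t : 0 < b -> 0 < t ->
  expR (- (b / t)) <= (m.+1)`!%:R * t ^+ m.+1 / b ^+ m.+1.
Proof.
move=> b0 t0.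
have x0 : 0 < b / t by rewrite divr_gt0.
have := expR_ge1Dxn m (ltW x0).
have f0 : (0 : R) < (m.+1)`!%:R by rewrite ltr0n fact_gt0.
set f : R := _%:R in f0 *; move=> h.
have y0 : 0 < (b / t) ^+ m.+1 / f by rewrite divr_gt0 ?exprn_gt0.
have {}h : (b / t) ^+ m.+1 / f <= expR (b / t) by lra.
rewrite expRN; apply: (@le_trans _ _ ((b / t) ^+ m.+1 / f)^-1).
  by rewrite lef_pV2 ?posrE ?expR_gt0.
rewrite expr_div_n le_eqVlt; apply/orP; left; apply/eqP.
have := exprn_gt0 m.+1 b0; have := exprn_gt0 m.+1 t0.
move: (b ^+ m.+1) (t ^+ m.+1) => B A A0 B0.
by field; rewrite !lt0r_neq0.
Qed.

(** The exponential beats every power of [t] at 0; all the bounds uniform in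
    [t] below come from here. *)
Lemma exp_decay_le m b t : 0 < b -> 0 < t ->
  (t ^+ m.+1)^-1 * expR (- (b / t)) <= (m.+1)`!%:R / b ^+ m.+1.
Proof.
move=> b0 t0; have t1 := exprn_gt0 m.+1 t0.
rewrite mulrC ler_pdivrMr // mulrAC; exact: exp_decay.
Qed.

Lemma Re_sqr z : complex.Re (z ^+ 2) = complex.Re z ^+ 2 - complex.Im z ^+ 2.
Proof. by case: z => x y; rewrite expr2 /=; ring. Qed.

Lemma bracket_ge1 n : 1 <= bracket n :> R.
Proof. by rewrite lerDl ler0z. Qed.

(** On [Q] the imaginary part is smaller than the distance from the real part
    to the integers: this is where the shape of the domain matters. *)
Lemma Qsq_translates q : Qsq q -> exists2 c, 0 < c <= 1 &
  forall n, c * bracket n ^+ 2 <= complex.Re ((q + n%:~R) ^+ 2) /\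
            cmod (q + n%:~R) <= 2 * bracket n.
Proof.
case: q => x y [/= h1 h2].
have [r [r0 r1 r2]] : exists r, [/\ 0 < r, r + `|y| <= x & r + `|y| <= 1 - x].
  case: (leP x (1 - x)) => h.
    by exists (x - `|y|); split; lra.
  by exists (1 - x - `|y|); split; lra.
have y0 := normr_ge0 y.
exists (r ^+ 3 / 8); first by apply/andP; split; [rewrite divr_gt0 ?exprn_gt0|nra].
move=> n; have N1 := bracket_ge1 n.
rewrite Re_sqr !ReImE addr0 -(@real_normK _ y) ?num_real //.
pose X := `|x + n%:~R|; rewrite -(@real_normK _ (x + _)) ?num_real // -/X.
have hX : [/\ r + `|y| <= X, r / 2 * bracket n <= X & X <= bracket n].
  rewrite /X /bracket; case: (lerP 0 n) => n0.
    rewrite (ger0_norm n0) (@ger0_norm _ (x + _)); last by rewrite addr_ge0 ?ler0z //; lra.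
    have : 0 <= n%:~R :> R by rewrite ler0z.
    by move: (n%:~R : R) => a a0; split; nra.
  rewrite (ltr0_norm n0) rmorphN /=.
  have : n%:~R <= -1 :> R by rewrite -(rmorphN1 intr) ler_int; lia.
  by move: (n%:~R : R) => a a0; rewrite (@ltr0_norm _ (x + _)); [split; nra|lra].
case: hX => hX1 hX2 hX3.
split; last first.
  rewrite (le_trans (cmod_le _)) // !ReImE addr0 -/X.
  by rewrite mulr_natl mulr2n lerD //; lra.
move: X (bracket n) (`|y|) hX1 hX2 hX3 N1 y0 r1 r2 => X N Y hX1 hX2 hX3 N1 Y0 r1 r2.
have X0 : 0 < X by lra.
have hr : r / 2 * X <= X - Y.
  have [X1|X1] := leP 1 X; nra.
have : r / 2 * X ^+ 2 <= X ^+ 2 - Y ^+ 2.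
  have : r / 2 * X * X <= (X - Y) * (X + Y) by apply: ler_pM; nra.
  by rewrite expr2; nra.
apply: le_trans.
have -> : r ^+ 3 / 8 * N ^+ 2 = r / 2 * (r / 2 * N) ^+ 2 by field.
rewrite ler_wpM2l //; first lra.
by rewrite lerXn2r ?nnegrE //; nra.
Qed.

Context (T : R).

Lemma dxK_bound c : 0 < c <= 1 -> 0 <= T -> exists2 C, 0 <= C &
  forall N z t, 0 < t <= T -> 1 <= N ->
  c * N ^+ 2 <= complex.Re (z ^+ 2) -> cmod z <= 2 * N ->
  cmod (dxK z t) <= C * (N ^+ 2)^-1.
Proof.
move=> /andP[c0 c1] TT.
exists (64 * ((1 + T) * c ^- 2)).
  by apply: mulr_ge0 => //; apply: mulr_ge0; rewrite ?invr_ge0 ?exprn_ge0 ?(ltW c0) //; lra.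
move=> N z t /andP[t0 tT] N1 h1 h2.
rewrite cmod_dxK //.
have := cmod_ge0 z.
move: (cmod _) (complex.Re _) h1 h2 => p a h1 h2 p0.
have T0 : 0 <= 1 + T by lra.
have N0 : 0 < N by lra.
have b0 : 0 < c * N ^+ 2 / 4 by rewrite divr_gt0 ?mulr_gt0 ?exprn_gt0.
have := exp_decay_le 1 b0 t0.
have e1 : expR (- (a / (4 * t))) <= expR (- (c * N ^+ 2 / 4 / t)).
  rewrite ler_expR lerN2 -mulrA -invfM ler_wpM2r //.
  by rewrite invr_ge0 mulr_ge0 // ltW.
move=> e2.
apply: (@le_trans _ _ (2 * N * ((1 + T) * (t ^+ 2)^-1) * expR (- (c * N ^+ 2 / 4 / t)))).
  apply: ler_pM => //; rewrite ?expR_ge0 //.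
    by apply: mulr_ge0 => //; exact: ltW (kap_gt0 t0).
  by apply: ler_pM => //; [exact: ltW (kap_gt0 t0)|exact: kap_le].
move: (expR (- (c * N ^+ 2 / 4 / t))) e2 {e1} => E e2.
rewrite -!mulrA.
apply: (@le_trans _ _ (2 * (N * ((1 + T) * (2 / (c * N ^+ 2 / 4) ^+ 2))))).
  by rewrite !ler_wpM2l // ltW.
have -> : 2 * (N * ((1 + T) * (2 / (c * N ^+ 2 / 4) ^+ 2))) =
   64 * ((1 + T) * (c ^- 2 * (N ^+ 3)^-1)).
  by field; rewrite !lt0r_neq0.
apply: ler_wpM2l => //; apply: ler_wpM2l => //.
apply: ler_wpM2l; first by rewrite invr_ge0 exprn_ge0 // ltW.
rewrite lef_pV2 ?posrE ?exprn_gt0 //.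
by rewrite (exprS _ 2) ler_peMl // exprn_ge0 // ltW.
Qed.

(** The complex derivative of [dxK] in the space variable. *)
Definition dxxK z t : R[i] :=
  - ((1 - z ^+ 2 * ((2 * t)^-1)%:C) * (kap t)%:C * gauss z t).

Lemma dxK_taylor_identity z h t : 0 < t ->
  let k := - ((2 * z * h + h ^+ 2) * ((4 * t)^-1)%:C) in
  dxK (z + h) t - dxK z t - h * dxxK z t =
  - ((kap t)%:C * gauss z t *
     ((z + h) * (expC k - 1 - k) -
      (3 * z * h ^+ 2 + h ^+ 3) * ((4 * t)^-1)%:C)).
Proof.
move=> t0 k; rewrite !dxKE.
have -> : gauss (z + h) t = gauss z t * expC k.
  by rewrite /gauss -expCD; congr expC; rewrite /k; ring.
have e : ((2 * t)^-1)%:C = 2 * ((4 * t)^-1)%:C :> R[i].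
  rewrite -(rmorph_nat (real_complex R)) -rmorphM; congr (_%:C).
  by field; exact: lt0r_neq0.
move: (expC k) => E; rewrite /dxxK e /k; ring.
Qed.

(** The Gaussian decay absorbs the exponential growth of the remainder of
    [expC] as soon as the step is small with respect to the sector constant
    [c]; the bound is uniform in [t]. *)
Lemma dxK_taylor c : 0 < c <= 1 -> 0 <= T -> exists2 C, 0 <= C &
  forall N z h t, 0 < t <= T -> 1 <= N ->
  c * N ^+ 2 <= complex.Re (z ^+ 2) -> cmod z <= 2 * N -> cmod h <= c / 20 ->
  cmod (dxK (z + h) t - dxK z t - h * dxxK z t) <=
  C * (cmod h ^+ 2 * (N ^+ 2)^-1).
Proof.
move=> /andP[c0 c1] T0.
have [Q Q0 hQ] : exists2 Q, 0 <= Q & forall t, 0 < t <= T ->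
    375 * (4 * t)^-1 ^+ 2 + 7 * (4 * t)^-1 <= Q * (t ^+ 2)^-1.
  exists ((375 + 28 * T) / 16); first lra.
  move=> t /andP[t0 tT].
  have -> : 375 * (4 * t)^-1 ^+ 2 + 7 * (4 * t)^-1 = (375 + 28 * t) / 16 * (t ^+ 2)^-1.
    by field; exact: lt0r_neq0.
  have : 0 < (t ^+ 2)^-1 by rewrite invr_gt0 exprn_gt0.
  move: (t ^+ 2)^-1 => x x0; nra.
have [D D0 hD] : exists2 D, 0 <= D & forall N, 0 < N ->
    N ^+ 3 * (24 / (c * N ^+ 2 / 8) ^+ 4) = D * (N ^+ 5)^-1.
  exists (24 * (8 / c) ^+ 4).
    by apply: mulr_ge0; rewrite ?exprn_ge0 ?divr_ge0 // ltW.
  by move=> N N0; field; rewrite !lt0r_neq0.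
exists ((1 + T) * Q * D); first by rewrite !mulr_ge0 //; lra.
move=> N z h t /andP[t0 tT] N1 h1 h2 h3.
have {hQ} hQ := hQ t (introT andP (conj t0 tT)).
have {hD} hD := hD N (lt_le_trans ltr01 N1).
pose s := (4 * t)^-1; pose k : R[i] := - ((2 * z * h + h ^+ 2) * s%:C).
rewrite (dxK_taylor_identity z h t0) /= -/s -/k.
rewrite -/s in hQ.
have s0 : 0 < s by rewrite invr_gt0 mulr_gt0.
have N0 : 0 < N by lra.
have p0 := cmod_ge0 z; have r0 := cmod_ge0 h.
have kb : cmod k <= 5 * N * cmod h * s.
  rewrite cmodN cmodM cmod_real (gtr0_norm s0) ler_wpM2r ?(ltW s0) //.
  apply: (le_trans (cmodD _ _)); rewrite cmodX !cmodM cmod_nat.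
  have : cmod z * cmod h <= 2 * N * cmod h by rewrite ler_wpM2r.
  have : cmod h ^+ 2 <= N * cmod h by rewrite expr2 ler_wpM2r //; lra.
  lra.
rewrite cmodN (cmodM (_ * gauss _ _)) (cmodM _ (gauss _ _)) cmod_real.
rewrite (gtr0_norm (kap_gt0 t0)) cmod_gauss.
have eb : cmod ((z + h) * (expC k - 1 - k) - (3 * z * h ^+ 2 + h ^+ 3) * s%:C) <=
    cmod h ^+ 2 * N ^+ 3 * (375 * s ^+ 2 + 7 * s) * expR (2 * cmod k).
  apply: (le_trans (cmodB _ _)).
  have ek1 : 1 <= expR (2 * cmod k) by rewrite -expR0 ler_expR mulr_ge0 ?cmod_ge0.
  have b1 : cmod ((z + h) * (expC k - 1 - k)) <=
      3 * N * (5 * (5 * N * cmod h * s) ^+ 2 * expR (2 * cmod k)).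
    rewrite cmodM; apply: ler_pM; rewrite ?cmod_ge0 //.
      by apply: (le_trans (cmodD _ _)); lra.
    apply: (le_trans (expC_taylor k)); rewrite ler_wpM2r ?expR_ge0 //.
    by rewrite ler_wpM2l // lerXn2r ?nnegrE ?cmod_ge0 // (le_trans (cmod_ge0 k)).
  have b2 : cmod ((3 * z * h ^+ 2 + h ^+ 3) * s%:C) <= cmod h ^+ 2 * (7 * N) * s.
    rewrite cmodM cmod_real (gtr0_norm s0) ler_wpM2r ?(ltW s0) //.
    apply: (le_trans (cmodD _ _)); rewrite (cmodX h 3) (cmodM _ (h ^+ 2)) (cmodX h 2) (cmodM 3) cmod_nat.
    have -> : 3 * cmod z * cmod h ^+ 2 + cmod h ^+ 3 =
      cmod h ^+ 2 * (3 * cmod z + cmod h) by ring.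
    rewrite ler_wpM2l ?sqr_ge0 //; lra.
  apply: (le_trans (lerD b1 b2)).
  move: (expR _) ek1 => E E1.
  move: (cmod h) r0 => r r0.
  have q0 : 0 <= r ^+ 2 * N * s by rewrite mulr_ge0 ?(ltW s0) // mulr_ge0 ?sqr_ge0 ?(ltW N0).
  have N2 : 1 <= N ^+ 2 by rewrite exprn_ege1.
  have : r ^+ 2 * N * s * 7 <= r ^+ 2 * N * s * (7 * (N ^+ 2 * E)).
    by rewrite ler_wpM2l // ler_peMr // mulr_ege1.
  lra.
pose E := expR (- (c * N ^+ 2 / 8 / t)).
have gE : expR (- (complex.Re (z ^+ 2) / (4 * t))) * expR (2 * cmod k) <= E.
  rewrite -expRD ler_expR.
  have -> : c * N ^+ 2 / 8 / t = c * N ^+ 2 * s / 2.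
    by rewrite /s; field; exact: lt0r_neq0.
  rewrite -/s.
  have : c * N ^+ 2 * s <= complex.Re (z ^+ 2) * s by rewrite ler_wpM2r ?(ltW s0).
  have : cmod k <= c * N ^+ 2 * s / 4.
    apply: (le_trans kb).
    have -> : c * N ^+ 2 * s / 4 = c / 4 * (N ^+ 2) * s by ring.
    rewrite ler_wpM2r ?(ltW s0) //.
    apply: (@le_trans _ _ (c / 4 * N)); first nra.
    rewrite ler_wpM2l //; first by rewrite divr_ge0 // ltW.
    by rewrite expr2 ler_peMr // ltW.
  lra.
have W0 : 0 <= 375 * s ^+ 2 + 7 * s by have := sqr_ge0 s; lra.
move: (375 * s ^+ 2 + 7 * s) W0 hQ eb => W W0 hQ eb.
have kp0 := kap_gt0 t0.
have kb2 : kap t * W <= (1 + T) * Q * (t ^+ 4)^-1.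
  have -> : (1 + T) * Q * (t ^+ 4)^-1 = (1 + T) * (t ^+ 2)^-1 * (Q * (t ^+ 2)^-1).
    by field; exact: lt0r_neq0.
  by apply: ler_pM; [exact: ltW|exact: W0|exact: kap_le|exact: hQ].
have b0 : 0 < c * N ^+ 2 / 8 by rewrite divr_gt0 ?mulr_gt0 ?exprn_gt0.
have := exp_decay_le 3 b0 t0; rewrite -/E => tE.
have E0 : 0 < E by exact: expR_gt0.
have g0 := expR_gt0 (- (complex.Re (z ^+ 2) / (4 * t))).
have hN0 : 0 <= cmod h ^+ 2 * N ^+ 3.
  by apply: mulr_ge0; [exact: sqr_ge0|exact/exprn_ge0/ltW].
have TQ0 : 0 <= (1 + T) * Q by apply: mulr_ge0 => //; lra.
apply: (@le_trans _ _ (cmod h ^+ 2 * N ^+ 3 * (kap t * W) * E)).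
  apply: (@le_trans _ _ (kap t * expR (- (complex.Re (z ^+ 2) / (4 * t))) *
     (cmod h ^+ 2 * N ^+ 3 * W * expR (2 * cmod k)))).
    by apply: ler_wpM2l; [apply: mulr_ge0; exact: ltW|exact: eb].
  move: (expR (- (complex.Re _ / _))) (expR (2 * cmod k)) g0 gE => G F g0 gE.
  have -> : kap t * G * (cmod h ^+ 2 * N ^+ 3 * W * F) =
    cmod h ^+ 2 * N ^+ 3 * (kap t * W) * (G * F) by ring.
  apply: ler_wpM2l gE; apply: mulr_ge0 => //.
  by apply: mulr_ge0 => //; exact: ltW.
apply: (@le_trans _ _ (cmod h ^+ 2 * N ^+ 3 * ((1 + T) * Q * (24 / (c * N ^+ 2 / 8) ^+ 4)))).
  rewrite -[leLHS]mulrA; apply: ler_wpM2l => //.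
  apply: (@le_trans _ _ ((1 + T) * Q * (t ^+ 4)^-1 * E)).
    by apply: ler_wpM2r => //; exact: ltW.
  by rewrite -mulrA; apply: ler_wpM2l.
have -> : cmod h ^+ 2 * N ^+ 3 * ((1 + T) * Q * (24 / (c * N ^+ 2 / 8) ^+ 4)) =
  (1 + T) * Q * cmod h ^+ 2 * (N ^+ 3 * (24 / (c * N ^+ 2 / 8) ^+ 4)).
  by move: (24 / _) => y; ring.
rewrite hD.
have -> : (1 + T) * Q * cmod h ^+ 2 * (D * (N ^+ 5)^-1) =
  (1 + T) * Q * D * (cmod h ^+ 2 * (N ^+ 5)^-1) by move: (N ^+ 5)^-1 => y; ring.
apply: ler_wpM2l; first exact: mulr_ge0.
apply: ler_wpM2l; first exact: sqr_ge0.
by rewrite lef_pV2 ?posrE ?exprn_gt0 // ler_weXn2l.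
Qed.

Lemma dxxK_bound c : 0 < c <= 1 -> 0 <= T -> exists2 C, 0 <= C &
  forall N z t, 0 < t <= T -> 1 <= N ->
  c * N ^+ 2 <= complex.Re (z ^+ 2) -> cmod z <= 2 * N ->
  cmod (dxxK z t) <= C * (N ^+ 2)^-1.
Proof.
move=> /andP[c0 c1] T0.
have TT : 0 <= (T + 2) * (1 + T) by apply: mulr_ge0; lra.
have [D D0 hD] : exists2 D, 0 <= D & forall N, 0 < N ->
    N ^+ 2 * (6 / (c * N ^+ 2 / 4) ^+ 3) = D * (N ^+ 4)^-1.
  exists (6 * (4 / c) ^+ 3).
    by apply: mulr_ge0; rewrite ?exprn_ge0 ?divr_ge0 // ltW.
  by move=> N N0; field; rewrite !lt0r_neq0.
exists ((T + 2) * (1 + T) * D); first exact: mulr_ge0.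
move=> N z t /andP[t0 tT] N1 h1 h2.
have {hD} hD := hD N (lt_le_trans ltr01 N1).
have N0 : 0 < N by lra.
have p0 := cmod_ge0 z.
rewrite cmodN (cmodM (_ * _) (gauss _ _)) cmod_gauss (cmodM (1 - _)) cmod_real.
rewrite (gtr0_norm (kap_gt0 t0)).
pose E := expR (- (c * N ^+ 2 / 4 / t)).
have gE : expR (- (complex.Re (z ^+ 2) / (4 * t))) <= E.
  rewrite ler_expR lerN2 -mulrA -invfM ler_wpM2r //.
  by rewrite invr_ge0 mulr_ge0 // ltW.
have zb : cmod (1 - z ^+ 2 * ((2 * t)^-1)%:C) <= N ^+ 2 * ((T + 2) * t^-1).
  apply: (le_trans (cmodB _ _)).
  rewrite -(rmorph1 (real_complex R)) cmod_real normr1 (cmodM (z ^+ 2)) cmodX cmod_real.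
  rewrite gtr0_norm ?invr_gt0 ?mulr_gt0 //.
  have z2 : cmod z ^+ 2 <= 4 * N ^+ 2.
    have -> : 4 * N ^+ 2 = (2 * N) ^+ 2 by ring.
    by rewrite lerXn2r ?nnegrE // mulr_ge0 // ltW.
  have N2 : 1 <= N ^+ 2 by rewrite exprn_ege1.
  have i0 : 0 < t^-1 by rewrite invr_gt0.
  have ti : 1 <= T * t^-1 by rewrite ler_pdivlMr // mul1r.
  have -> : (2 * t)^-1 = t^-1 / 2 by field; exact: lt0r_neq0.
  have : cmod z ^+ 2 * (t^-1 / 2) <= 4 * N ^+ 2 * (t^-1 / 2).
    by rewrite ler_wpM2r // divr_ge0 // ltW.
  have : 1 <= N ^+ 2 * (T * t^-1) by rewrite mulr_ege1.
  lra.
have b0 : 0 < c * N ^+ 2 / 4 by rewrite divr_gt0 ?mulr_gt0 ?exprn_gt0.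
have := exp_decay_le 2 b0 t0; rewrite -/E => tE.
have kp := kap_le t0 tT; have kp0 := kap_gt0 t0.
apply: (@le_trans _ _ (N ^+ 2 * ((T + 2) * t^-1) * ((1 + T) * (t ^+ 2)^-1) * E)).
  apply: ler_pM; rewrite ?expR_ge0 //.
    by rewrite mulr_ge0 ?cmod_ge0 // ltW.
  by apply: ler_pM; rewrite ?cmod_ge0 // ltW.
have -> : N ^+ 2 * ((T + 2) * t^-1) * ((1 + T) * (t ^+ 2)^-1) * E =
  N ^+ 2 * ((T + 2) * (1 + T)) * ((t ^+ 3)^-1 * E).
  by field; exact: lt0r_neq0.
apply: (@le_trans _ _ (N ^+ 2 * ((T + 2) * (1 + T)) * (6 / (c * N ^+ 2 / 4) ^+ 3))).
  by apply: ler_wpM2l => //; apply: mulr_ge0 => //; exact: sqr_ge0.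
have -> : N ^+ 2 * ((T + 2) * (1 + T)) * (6 / (c * N ^+ 2 / 4) ^+ 3) =
  (T + 2) * (1 + T) * (N ^+ 2 * (6 / (c * N ^+ 2 / 4) ^+ 3)).
  by move: (6 / _) => y; ring.
rewrite hD -[leRHS]mulrA; apply: ler_wpM2l => //; apply: ler_wpM2l => //.
by rewrite lef_pV2 ?posrE ?exprn_gt0 // ler_weXn2l.
Qed.

End HeatKernelBounds.

(** * Laplace integrals *)

Section LaplaceIntegral.
Context {R : realType}.

(** Gives the continuity, up to the end point where the heat kernel is
    singular, that the fundamental theorem of calculus asks for. *)
Lemma cvg_at_left_linear (f : R -> R) (a b C : R) : a < b ->
  (forall x, a < x < b -> `|f x| <= C * (b - x)) -> f x @[x --> b^'-] --> 0.
Proof.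
move=> ab fC; apply/cvgrPdist_le => e e0.
have C1 : 0 < `|C| + 1 by rewrite ltr_wpDl.
near=> x; rewrite sub0r normrN.
have xb : x < b by near: x; exact: nbhs_left_lt.
have ax : a < x by near: x; exact: nbhs_left_gt.
apply: (le_trans (fC x _)); first by rewrite ax xb.
have h : b - e / (`|C| + 1) < x.
  by near: x; apply: nbhs_left_gt; rewrite ltrBlDr ltrDl divr_gt0.
have {}h : (b - x) * (`|C| + 1) <= e by rewrite -ler_pdivlMr // lerBlDr -lerBlDl ltW.
have bx : 0 < b - x by lra.
have := ler_norm C; nra.
Unshelve. all: by end_near. Qed.

Context (al be p q p' q' g g' : R).

(* With [s = al + be i], [P = p + p' i], [Q = q + q' i], [c = g + g' i], [H] is
   the real part of [exp (- s v) (P + Q v)] and [f0] that of [v ^ 3 exp (- s v) c];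
   the relations [s P = Q] and [s Q = c] assumed below say that the derivative of
   [H] is [- f0 v / v ^ 2]. *)
Let H v := expR (- (al * v)) *
  (cos (be * v) * (p + q * v) + sin (be * v) * (p' + q' * v)).
Let f0 v := v ^+ 3 * (expR (- (al * v)) * (cos (be * v) * g + sin (be * v) * g')).

Lemma is_derive_H (v : R) : is_derive v 1 H (expR (- (al * v)) *
  (cos (be * v) * (- al * (p + q * v) + be * (p' + q' * v) + q) +
   sin (be * v) * (- al * (p' + q' * v) - be * (p + q * v) + q'))).
Proof.
have dl (c : R) : is_derive v 1 (fun v : R => c * v) c.
  have h : is_derive v 1 (c *: (@id R)) (c *: 1) by apply: is_deriveZ.
  by rewrite /GRing.scale /= mulr1 in h.
have dE : is_derive v 1 (fun v : R => expR (- (al * v))) (expR (- (al * v)) * - al).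
  have := is_derive1_comp (is_derive_expR (- al * v)) (dl (- al)).
  by rewrite /comp mulNr; under eq_fun do rewrite mulNr.
have dC : is_derive v 1 (fun v : R => cos (be * v)) (- sin (be * v) * be).
  exact: is_derive1_comp (is_derive_cos (be * v)) (dl be).
have dS : is_derive v 1 (fun v : R => sin (be * v)) (cos (be * v) * be).
  exact: is_derive1_comp (is_derive_sin (be * v)) (dl be).
apply: is_derive_eq.
rewrite /GRing.scale /=; ring.
Qed.

Context (al0 : 0 < al).
Context (hq : al * p - be * p' = q) (hq' : be * p + al * p' = q').
Context (hg : al * q - be * q' = g) (hg' : be * q + al * q' = g').

(** In the variable [v = 1 / (T - t)] the integrand has the primitive [- H]. *)
Lemma integral_laplace (T : R) : 0 < T ->
  \int[lebesgue_measure]_(t in itv0 T) f0 (T - t)^-1 = H T^-1.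
Proof.
move=> T0.
pose v x : R := (T - x)^-1.
pose f x := f0 (v x).
(* the factor [v x * (T - x)] is 1 for [x < T] and 0 at the end point *)
pose F x := - (H (v x) * (v x * (T - x))).
have Tx x : x < T -> T - x != 0 by move=> xT; rewrite subr_eq0 gt_eqF.
have dv x : x < T -> is_derive x 1 v ((v x) ^+ 2).
  move=> xT.
  have dl : is_derive x 1 (fun x : R => T - x) (- 1).
    have : is_derive x 1 (cst T - @id R) (0 - 1) by apply: is_deriveB.
    by rewrite sub0r.
  have := @is_deriveV R (fun x : R => T - x) x (- 1) 1 (Tx x xT) dl.
  by rewrite /v /GRing.scale /= mulrN1 opprK exprVn.
have dF x : x < T -> is_derive x 1 F (f x).
  move=> xT; have dvx := dv x xT.
  have dH := is_derive1_comp (is_derive_H (v x)) dvx.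
  have dl : is_derive x 1 (fun x : R => T - x) (- 1).
    have : is_derive x 1 (cst T - @id R) (0 - 1) by apply: is_deriveB.
    by rewrite sub0r.
  have dF' : is_derive x 1 (- ((H \o v) * (v * (fun x : R => T - x)))) _ :=
    is_deriveN (is_deriveM dH (is_deriveM dvx dl)).
  apply: (@is_derive_eq _ _ _ _ _ _ _ _ dF').
  have vx : v x * (T - x) = 1 by rewrite mulVf // Tx.
  rewrite /GRing.scale /= /f /f0 /H.
  have -> : (v * (fun x : R => T - x)) x = 1 by exact: vx.
  have -> : v x * - 1 + (T - x) * v x ^+ 2 = v x * (v x * (T - x)) - v x by ring.
  rewrite vx mulr1 subrr mulr0 add0r mul1r.
  have -> : - al * (p + q * v x) + be * (p' + q' * v x) + q = - (g * v x).
    rewrite -hg; transitivity (q - (al * p - be * p') - (al * q - be * q') * v x).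
      by ring.
    by rewrite hq; ring.
  have -> : - al * (p' + q' * v x) - be * (p + q * v x) + q' = - (g' * v x).
    rewrite -hg'; transitivity (q' - (be * p + al * p') - (be * q + al * q') * v x).
      by ring.
    by rewrite hq'; ring.
  by ring.
have sinb y : `|sin y| <= 1 :> R by exact: sin_max.
have cosb y : `|cos y| <= 1 :> R by exact: cos_max.
have trig (y a b : R) : `|cos y * a + sin y * b| <= `|a| + `|b|.
  apply: (le_trans (ler_normD _ _)); rewrite !normrM.
  by rewrite lerD // ler_piMl.
have Ev m x : 0 < x < T -> expR (- (al * v x)) <= (m.+1)`!%:R * (T - x) ^+ m.+1 / al ^+ m.+1.
  by move=> /andP[_ xT]; apply: exp_decay => //; rewrite subr_gt0.
have fT : f x @[x --> T^'-] --> f T.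
  have -> : f T = 0 by rewrite /f /f0 /v subrr invr0 expr0n mul0r.
  apply: (@cvg_at_left_linear _ 0 T (24 * (`|g| + `|g'|) / al ^+ 4)) => // x x0T.
  have e1 := Ev 3 x x0T; have := trig (be * v x) g g'.
  have xT : 0 < T - x by move: x0T => /andP[_]; rewrite subr_gt0.
  rewrite /f /f0 (normrM (v x ^+ 3)) (normrM (expR _)) (ger0_norm (expR_ge0 _)).
  rewrite (@ger0_norm _ (v x ^+ 3)) => [h|]; last by rewrite exprn_ge0 // invr_ge0 ltW.
  apply: (@le_trans _ _ (v x ^+ 3 * (24 * (T - x) ^+ 4 / al ^+ 4 * (`|g| + `|g'|)))).
    by rewrite ler_wpM2l ?exprn_ge0 ?invr_ge0 ?(ltW xT) // ler_pM ?expR_ge0.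
  rewrite /v le_eqVlt; apply/orP; left; apply/eqP.
  by field; rewrite !lt0r_neq0.
have FT : F x @[x --> T^'-] --> F T.
  have -> : F T = 0 by rewrite /F subrr !mulr0 oppr0.
  apply: (@cvg_at_left_linear _ 0 T (2 * ((`|p| + `|p'|) * T + (`|q| + `|q'|)) / al ^+ 2)) => // x x0T.
  have e1 := Ev 1 x x0T; have := trig (be * v x) (p + q * v x) (p' + q' * v x).
  have xT : 0 < T - x by move: x0T => /andP[_]; rewrite subr_gt0.
  have xT' : T - x <= T by move: x0T => /andP[/ltW]; rewrite gerBl.
  have v0 : 0 < v x by rewrite invr_gt0.
  have vx : v x * (T - x) = 1 by rewrite mulVf // lt0r_neq0.
  rewrite /F vx mulr1 normrN /H normrM (ger0_norm (expR_ge0 _)) => h.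
  have h2 : `|p + q * v x| + `|p' + q' * v x| <= (`|p| + `|p'|) + (`|q| + `|q'|) * v x.
    have := ler_normD p (q * v x); have := ler_normD p' (q' * v x).
    rewrite !normrM (gtr0_norm v0); lra.
  apply: (@le_trans _ _ (2 * (T - x) ^+ 2 / al ^+ 2 * ((`|p| + `|p'|) + (`|q| + `|q'|) * v x))).
    by rewrite ler_pM ?expR_ge0 // (le_trans h).
  have -> : 2 * (T - x) ^+ 2 / al ^+ 2 * ((`|p| + `|p'|) + (`|q| + `|q'|) * v x) =
    2 / al ^+ 2 * (T - x) * ((`|p| + `|p'|) * (T - x) + (`|q| + `|q'|) * (v x * (T - x))).
    by field; rewrite lt0r_neq0.
  have -> : 2 * ((`|p| + `|p'|) * T + (`|q| + `|q'|)) / al ^+ 2 * (T - x) =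
    2 / al ^+ 2 * (T - x) * ((`|p| + `|p'|) * T + (`|q| + `|q'|) * 1).
    by field; rewrite lt0r_neq0.
  rewrite vx ler_wpM2l // ?lerD2r ?ler_wpM2l ?addr_ge0 //.
  by rewrite mulr_ge0 ?(ltW xT) // divr_ge0 ?exprn_ge0 ?(ltW al0).
have cf0 : continuous f0.
  have cl (c : R) : continuous (fun y : R => c * y) by exact: mulrl_continuous.
  have cE : continuous (fun y : R => expR (- (al * y))).
    move=> y; under eq_fun do rewrite -mulNr.
    by apply: continuous_comp; [exact: cl|exact: continuous_expR].
  have cC : continuous (fun y : R => cos (be * y)).
    by move=> y; apply: continuous_comp; [exact: cl|exact: continuous_cos].
  have cS : continuous (fun y : R => sin (be * y)).
    by move=> y; apply: continuous_comp; [exact: cl|exact: continuous_sin].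
  move=> y.
  have cg (b : R) : {for y, continuous (fun=> b : R)} by exact: cst_continuous.
  have c1 : (fun y : R => cos (be * y) * g + sin (be * y) * g') x @[x --> y] -->
      cos (be * y) * g + sin (be * y) * g'.
    apply: cvgD; apply: cvgM; [exact: cC|exact: cg|exact: cS|exact: cg].
  have c2 : (fun y : R => expR (- (al * y)) * (cos (be * y) * g + sin (be * y) * g')) x @[x --> y] -->
      expR (- (al * y)) * (cos (be * y) * g + sin (be * y) * g').
    by apply: cvgM => //; exact: cE.
  by apply: cvgM => //; exact: exprn_continuous.
have cf x : x < T -> {for x, continuous f}.
  move=> xT; apply: continuous_comp; last exact: cf0.
  apply: differentiable_continuous; apply/derivable1_diffP.
  by have [] := dv x xT.
have cF x : x < T -> {for x, continuous F}.
  move=> xT; apply: differentiable_continuous; apply/derivable1_diffP.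
  by have [] := dF x xT.
have wf : {within `[0, T], continuous f}.
  apply/continuous_within_itvP => //; split => //.
    by move=> x; rewrite in_itv /= => /andP[_ xT]; exact: cf.
  by apply: cvg_at_right_filter; exact: cf.
have ftc : (\int[lebesgue_measure]_(x in `[0%R, T]) (f x)%:E = (F T)%:E - (F 0)%:E)%E.
  apply: (@continuous_FTC2 _ f F 0 T T0 wf); [split|].
  - by move=> x; rewrite in_itv /= => /andP[_ xT]; have [] := dF x xT.
  - by apply: cvg_at_right_filter; exact: cF.
  - exact: FT.
  - move=> x; rewrite in_itv /= => /andP[_ xT].
    by have dFx := dF x xT; rewrite derive1E derive_val.
have mf : measurable_fun (`[0, T] : set R) f.
  by apply: subspace_continuous_measurable_fun => //; exact: measurable_itv.
have sub (a b : bool) : [set` Interval (BSide a 0) (BSide b T)] `<=` (`[0, T] : set R).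
  by apply: subset_itv; rewrite bnd_simp.
have -> : H T^-1 = fine ((F T)%:E - (F 0)%:E)%E.
  rewrite /= /F subrr !mulr0 oppr0 sub0r opprK /v subr0 addr0 mulVf ?mulr1 //.
  exact: lt0r_neq0.
rewrite -ftc /Rintegral; congr fine.
have mfS (a b : bool) :
    measurable_fun [set` Interval (BSide a 0) (BSide b T)] (EFin \o f).
  apply/measurable_EFinP; apply: measurable_funS mf; first exact: measurable_itv.
  exact: sub.
rewrite /itv0 integral_itv_bndo_bndc; last exact: mfS.
apply: integral_itv_obnd_cbnd; exact: mfS.
Qed.

End LaplaceIntegral.

Section KernelIntegral.
Context {R : realType} (T : R) (T_gt0 : 0 < T).

Lemma intC_laplace (s c : R[i]) : 0 < complex.Re s ->
  intC T (fun t => ((T - t)^-1 ^+ 3)%:C * expC (- (s * ((T - t)^-1)%:C)) * c) =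
  expC (- (s * (T^-1)%:C)) * (c / s ^+ 2 + c / s * (T^-1)%:C).
Proof.
move=> s0.
have sn0 : s != 0 by apply: contraTneq s0 => ->; rewrite ltxx.
pose Q := c / s; pose P := Q / s.
have hQ : s * Q = c by rewrite mulrC divfK.
have hP : s * P = Q by rewrite mulrC divfK.
have -> : c / s ^+ 2 = P by rewrite /P /Q expr2 invfM mulrA.
rewrite -/Q; clearbody P; clearbody Q.
have hPr := congr1 (@complex.Re R) hP; have hPi := congr1 (@complex.Im R) hP.
have hQr := congr1 (@complex.Re R) hQ; have hQi := congr1 (@complex.Im R) hQ.
rewrite !ReImE in hPr hPi hQr hQi.
rewrite addrC in hPi; rewrite addrC in hQi.
(* the imaginary part is the real part after multiplication by [- 'i] *)
have hPr' : complex.Re s * complex.Im P - complex.Im s * - complex.Re P = complex.Im Q.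
  by rewrite -hPi; ring.
have hPi' : complex.Im s * complex.Im P + complex.Re s * - complex.Re P = - complex.Re Q.
  by rewrite -hPr; ring.
have hQr' : complex.Re s * complex.Im Q - complex.Im s * - complex.Re Q = complex.Im c.
  by rewrite -hQi; ring.
have hQi' : complex.Im s * complex.Im Q + complex.Re s * - complex.Re Q = - complex.Re c.
  by rewrite -hQr; ring.
have IR := integral_laplace s0 hPr hPi hQr hQi T_gt0.
have II := integral_laplace s0 hPr' hPi' hQr' hQi' T_gt0.
apply: complexP.
  rewrite /intC Re_pair.
  transitivity (\int[lebesgue_measure]_(t in itv0 T)
    ((T - t)^-1 ^+ 3 * (expR (- (complex.Re s * (T - t)^-1)) *
      (cos (complex.Im s * (T - t)^-1) * complex.Re c +
       sin (complex.Im s * (T - t)^-1) * complex.Im c)))).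
    apply: eq_Rintegral => t _; rewrite /expC !ReImE !mulr0 !subr0 !add0r cosN sinN.
    by ring.
  rewrite IR /expC !ReImE !mulr0 !subr0 !add0r cosN sinN.
  by ring.
rewrite /intC Im_pair.
transitivity (\int[lebesgue_measure]_(t in itv0 T)
    ((T - t)^-1 ^+ 3 * (expR (- (complex.Re s * (T - t)^-1)) *
      (cos (complex.Im s * (T - t)^-1) * complex.Im c +
       sin (complex.Im s * (T - t)^-1) * - complex.Re c)))).
  apply: eq_Rintegral => t _; rewrite /expC !ReImE !mulr0 !subr0 !add0r cosN sinN.
  by ring.
rewrite II /expC !ReImE !mulr0 !subr0 !add0r cosN sinN.
by ring.
Qed.

(** The product of the two kernels is a multiple of
    [r ^ 3 * exp (- s r / 4)] with [r = 1 / (T - t)] and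
    [s = z ^ 2 + (w^* ) ^ 2]. *)
Lemma K0_integral (z w : R[i]) :
  0 < complex.Re (z ^+ 2) -> 0 < complex.Re (w ^+ 2) ->
  K0 T z w = intC T (fun t => dxK z (T - t) * (dxK w (T - t))^*).
Proof.
move=> z0 w0.
pose s := z ^+ 2 + w^* ^+ 2.
have s0 : 0 < complex.Re (s / 4).
  have -> : (4 : R[i])^-1 = (4^-1)%:C by rewrite -realC_inv rmorph_nat.
  rewrite (ReM s) Re_real Im_real mulr0 subr0 mulr_gt0 // (ReD (z ^+ 2)) addr_gt0 //.
  by rewrite conjE -conjX ReJ.
have sn0 : s != 0.
  by apply: contraTneq s0 => ->; rewrite mul0r ltxx.
have pi0 : (pi%:C : R[i]) != 0.
  by rewrite fmorph_eq0 lt0r_neq0 // pi_gt0.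
pose c : R[i] := z * w^* / (16 * pi)%:C.
transitivity (intC T (fun t => ((T - t)^-1 ^+ 3)%:C *
    expC (- (s / 4 * ((T - t)^-1)%:C)) * c)); last first.
  apply: eq_intC => t; rewrite /itv0 /= in_itv /= => /andP[_ tT].
  have Tt : 0 < T - t by lra.
  move: (T - t) Tt => r r0.
  rewrite !dxKE.
  rewrite conjE conjN mulrNN (conjM (w * _)) (conjM w) conjc_real.
  have -> : z * (kap r)%:C * gauss z r * (conjc w * (kap r)%:C * conjc (gauss w r)) =
    (kap r ^+ 2)%:C * (gauss z r * conjc (gauss w r)) * (z * conjc w).
    by rewrite rmorphXn /=; ring.
  have -> : gauss z r * conjc (gauss w r) = expC (- (s / 4 * (r^-1)%:C)).
    rewrite /gauss -expC_conj -expCD conjN conjM conjc_real conjX.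
    congr expC; rewrite /s conjE invfM rmorphM /= -realC_inv rmorph_nat; ring.
  rewrite kap_sqr // /c.
  have -> : (16 * pi * r ^+ 3)^-1 = r^-1 ^+ 3 * (16 * pi)^-1.
    by rewrite exprVn invfM mulrC.
  move: (expC _) => E; rewrite conjE (rmorphM (real_complex R) (r^-1 ^+ 3)) /=.
  by rewrite -(realC_inv (16 * pi)); ring.
rewrite intC_laplace // /K0 -/s.
have -> : s / 4 * (T^-1)%:C = s / (4 * T)%:C.
  by rewrite -realC_inv rmorphM rmorph_nat invfM mulrA.
have T0 : (T%:C : R[i]) != 0 by rewrite fmorph_eq0 lt0r_neq0.
rewrite /c -realC_inv !rmorphM !rmorph_nat /= conjE; move: (expC _) => E.
move: (pi%:C) pi0 (T%:C) T0 => P P0 T' T0.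
by field; rewrite T0 sn0 P0.
Qed.

End KernelIntegral.

(** * Theta series on the union of the squares *)

Section Domain.
Context {R : realType}.
Implicit Types (z w h q : R[i]).

Lemma Qinf_translates z : Qinf z -> exists c m, 0 < c <= 1 /\
  forall n : int, c * bracket (m + n) ^+ 2 <= complex.Re ((z + n%:~R) ^+ 2) /\
                  cmod (z + n%:~R) <= 2 * bracket (m + n).
Proof.
move=> [m _ [q /Qsq_translates[c c01 hc] <-]]; exists c, m; split => // n.
have -> : m%:~R + q + n%:~R = q + (m + n)%:~R by rewrite intrD; ring.
exact: hc.
Qed.

Lemma Qsq_Qinf z : Qsq z -> Qinf z.
Proof. by move=> Qz; exists 0 => //; exists z => //; rewrite add0r. Qed.

Lemma Qinf_addz z (n : int) : Qinf z -> Qinf (z + n%:~R).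
Proof.
move=> [m _ [q Qq <-]]; exists (m + n) => //; exists q => //.
by rewrite intrD; ring.
Qed.

Lemma QinfN z : Qinf z -> Qinf (- z).
Proof.
move=> [m _ [q [/= q1 q2] <-]]; exists (- m - 1) => //; exists (1 - q).
  by rewrite /Qsq /= !ReImE sub0r !normrN; split; lra.
by rewrite !intrD !rmorphN /=; ring.
Qed.

Lemma Qinf_open z : Qinf z ->
  exists2 d : R, 0 < d & forall h, cmod h <= d -> Qinf (z + h).
Proof.
move=> [m _ [q [/= q1 q2] <-]].
have [d [d0 d1 d2]] : exists d, [/\ 0 < d, 2 * d < complex.Re q - `|complex.Im q| &
    2 * d < 1 - complex.Re q - `|complex.Im q|].
  case: (leP (complex.Re q) (1 - complex.Re q)) => hq.
    by exists ((complex.Re q - `|complex.Im q|) / 4); split; lra.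
  by exists ((1 - complex.Re q - `|complex.Im q|) / 4); split; lra.
exists d => // h hd; exists m => //; exists (q + h); last by rewrite addrA.
have := le_trans (cmod_Re h) hd; have := le_trans (cmod_Im h) hd.
have := ler_normD (complex.Im q) (complex.Im h).
have := ler_norm (complex.Re h); have := ler_norm (- complex.Re h).
rewrite normrN /Qsq /= !ReImE => *; split; lra.
Qed.

End Domain.

Section Theta.
Context {R : realType} (T : R) (T_gt0 : 0 < T).
Implicit Types (z w h : R[i]) (t : R).

Local Notation D := (itv0 T).

Lemma itv0_sub t : D t -> 0 < T - t <= T.
Proof. by rewrite /itv0 /= in_itv /= => /andP[t0 tT]; lra. Qed.

Lemma cmeasurable_expC (g : R -> R[i]) : cmeasurable T g ->
  cmeasurable T (fun t => expC (g t)).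
Proof.
move=> [g1 g2].
have me : measurable_fun D (fun t => expR (complex.Re (g t))).
  exact: (measurableT_comp (@measurable_expR R) g1).
have mc : measurable_fun D (fun t => cos (complex.Im (g t))).
  exact: (measurableT_comp (continuous_measurable_fun (@continuous_cos R)) g2).
have ms : measurable_fun D (fun t => sin (complex.Im (g t))).
  exact: (measurableT_comp (continuous_measurable_fun (@continuous_sin R)) g2).
apply: cmeasurableM; first exact: cmeasurable_real.
by split.
Qed.

Lemma measurable_sub : measurable_fun D (fun t => T - t).
Proof. by apply: measurable_funB; [exact: measurable_cst|exact: measurable_id]. Qed.

Lemma measurable_inv_sub c : measurable_fun D (fun t => (c * (T - t))^-1).
Proof.
have h : measurable_fun D (fun t => c^-1 * (T - t) `^ (- 1)).
  apply: measurable_funM; first exact: measurable_cst.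
  exact: (measurableT_comp (measurable_powR (- 1)) measurable_sub).
apply: (eq_measurable_fun (fun t => c^-1 * (T - t) `^ (- 1))) => [t|]; last exact: h.
rewrite inE => /itv0_sub/andP[t0 _].
by rewrite powR_inv1 ?(ltW t0) // invfM.
Qed.

Lemma measurable_kap : measurable_fun D (fun t => kap (T - t)).
Proof.
have h : measurable_fun D (fun t => (4 * Num.sqrt pi)^-1 * (T - t) `^ (- (3 / 2))).
  apply: measurable_funM; first exact: measurable_cst.
  exact: (measurableT_comp (measurable_powR _) measurable_sub).
apply: (eq_measurable_fun (fun t => (4 * Num.sqrt pi)^-1 * (T - t) `^ (- (3 / 2)))) => [t|]; last exact: h.
by move=> _; rewrite powRN /kap [in RHS]invfM.
Qed.

Lemma cmeasurable_gauss z : cmeasurable T (fun t => gauss z (T - t)).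
Proof.
apply: cmeasurable_expC; apply: cmeasurableN; apply: cmeasurableZ.
by apply: cmeasurable_real; exact: measurable_inv_sub.
Qed.

Lemma cmeasurable_dxK z : cmeasurable T (fun t => dxK z (T - t)).
Proof.
under [X in cmeasurable _ X]eq_fun do rewrite dxKE.
apply: cmeasurableN; apply: cmeasurableM; last exact: cmeasurable_gauss.
by apply: cmeasurableZ; apply: cmeasurable_real; exact: measurable_kap.
Qed.

Lemma cmeasurable_dxxK z : cmeasurable T (fun t => dxxK z (T - t)).
Proof.
apply: cmeasurableN; apply: cmeasurableM; last exact: cmeasurable_gauss.
apply: cmeasurableM; last by apply: cmeasurable_real; exact: measurable_kap.
apply: cmeasurableD; first exact: cmeasurable_cst.
apply: cmeasurableN; apply: cmeasurableZ.
by apply: cmeasurable_real; exact: measurable_inv_sub.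
Qed.

Lemma fsummable_bracket (C : R) (m : int) : 0 <= C ->
  fsummable (fun n : int => C * (bracket (m + n) ^+ 2)^-1 : R).
Proof.
move=> C0; apply: fsummableZ => //.
exact: (fsummable_inj (f := fun n => m + n) (@addrI _ m) fsummable_bracket2).
Qed.

(** For [z] in the [m]-th square the majorant is centred at [- m]; it does not
    depend on [t]. *)
Lemma dxK_majorant z : Qinf z -> exists2 a : int -> R, fsummable a &
  forall (n : int) t, D t -> cmod (dxK (z + n%:~R) (T - t)) <= a n.
Proof.
move=> /Qinf_translates[c [m [c01 hc]]].
have [C C0 hC] := dxK_bound c01 (ltW T_gt0).
exists (fun n => C * (bracket (m + n) ^+ 2)^-1); first exact: fsummable_bracket.
move=> n t /itv0_sub ht; have [h1 h2] := hc n.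
by apply: hC => //; exact: bracket_ge1.
Qed.

Lemma double_int_inj : injective (fun n : int => 2 * n : int).
Proof. by move=> m n /=; lia. Qed.

Lemma even_translate (n : int) : 2 * n%:~R = (2 * n : int)%:~R :> R[i].
Proof. by rewrite intrM. Qed.

Lemma theta_majorant z : Qinf z -> exists2 a : int -> R, fsummable a &
  forall (n : int) t, D t -> cmod (dxK (z + 2 * n%:~R) (T - t)) <= a n.
Proof.
move=> /dxK_majorant[a fa ha].
exists (a \o (fun n : int => 2 * n : int)); first exact: fsummable_inj double_int_inj fa.
by move=> n t Dt; rewrite even_translate; exact: ha.
Qed.

Lemma has_sum_dxtheta z t : Qinf z -> D t ->
  has_sum (fun n : int => dxK (z + 2 * n%:~R) (T - t)) (dxtheta z (T - t)).
Proof.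
move=> /theta_majorant[a fa ha] Dt.
by apply: (has_sum_ex fa) => n; exact: ha.
Qed.

Lemma dxtheta_bound z : Qinf z ->
  exists M, forall t, D t -> cmod (dxtheta z (T - t)) <= M.
Proof.
move=> /theta_majorant[a fa ha]; have [M hM] := fa.2.
by exists M => t Dt; apply: (cmod_sumC fa.1 hM) => n; exact: ha.
Qed.

Lemma cmeasurable_dxtheta z : Qinf z ->
  cmeasurable T (fun t => dxtheta z (T - t)).
Proof.
move=> /theta_majorant[a fa ha].
apply: (cmeasurable_sumC fa) => //= n; exact: cmeasurable_dxK.
Qed.

Lemma dxthetaD2 z t : Qinf z -> D t ->
  dxtheta (z + 2) (T - t) = dxtheta z (T - t).
Proof.
move=> Qz Dt; apply: has_sum_sumC.
have := has_sum_bij (@addrK _ 1) (@subrK _ 1) (has_sum_dxtheta Qz Dt).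
congr has_sum; apply/funext => n /=; congr dxK.
by rewrite intrD; ring.
Qed.

Lemma dxthetaB1 z t : Qinf z -> D t ->
  dxtheta (z - 1) (T - t) = dxtheta (z + 1) (T - t).
Proof.
move=> Qz Dt; rewrite -(@dxthetaD2 (z - 1)) //; last exact: (Qinf_addz (-1)).
by congr dxtheta; ring.
Qed.

Lemma dxKN z t : dxK (- z) t = - dxK z t.
Proof. by rewrite !dxKE /gauss sqrrN mulNr mulNr. Qed.

Lemma dxthetaN z t : Qinf z -> D t ->
  dxtheta (- z) (T - t) = - dxtheta z (T - t).
Proof.
move=> Qz Dt; apply: has_sum_sumC.
have := has_sum_bij (@opprK _) (@opprK _) (has_sumN (has_sum_dxtheta Qz Dt)).
congr has_sum; apply/funext => n /=; rewrite -dxKN; congr dxK.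
by rewrite rmorphN /=; ring.
Qed.

(** The odd translates of [z] are the even translates of [z + 1]. *)
Lemma has_sum_dxtheta2 z t : Qinf z -> D t ->
  has_sum (fun n : int => dxK (z + n%:~R) (T - t))
          (dxtheta z (T - t) + dxtheta (z + 1) (T - t)).
Proof.
move=> Qz Dt.
apply: (@has_sum_split _ _ _ _ (fun n : int => (2 %| n)%Z)
  (fun n : int => 2 * n : int) (fun n => (n %/ 2)%Z)
  (fun n : int => 2 * n + 1 : int) (fun n => (n %/ 2)%Z)).
- by move=> n /=; lia.
- by move=> n /=; lia.
- by move=> n /=; lia.
- by move=> n /=; lia.
- by move=> n /=; lia.
- by move=> n /=; lia.
- have := has_sum_dxtheta Qz Dt; congr has_sum; apply/funext => n /=.
  by rewrite even_translate.
- have := has_sum_dxtheta (Qinf_addz 1 Qz) Dt; congr has_sum; apply/funext => n /=.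
  by rewrite intrD even_translate; congr dxK; ring.
Qed.

(** The family [f] of translations is made of all integers for [Kplus] and of
    the even ones for [Kl]. *)
Lemma has_sum_K0 (f : int -> R[i]) (z w : R[i]) (a b : int -> R)
    (F G : R -> R[i]) :
  fsummable a -> fsummable b ->
  (forall n, 0 < complex.Re ((z + f n) ^+ 2)) ->
  (forall n, 0 < complex.Re ((w + f n) ^+ 2)) ->
  (forall n t, D t -> cmod (dxK (z + f n) (T - t)) <= a n) ->
  (forall n t, D t -> cmod (dxK (w + f n) (T - t)) <= b n) ->
  (forall t, D t -> has_sum (fun n => dxK (z + f n) (T - t)) (F t)) ->
  (forall t, D t -> has_sum (fun n => dxK (w + f n) (T - t)) (G t)) ->
  has_sum (fun p : int * int => K0 T (z + f p.2) (w + f p.1))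
          (intC T (fun t => F t * (G t)^*)).
Proof.
move=> fa fb z0 w0 za wb hF hG.
pose x (p : int * int) t := dxK (z + f p.2) (T - t) * (dxK (w + f p.1) (T - t))^*.
have mx p : cmeasurable T (x p).
  by apply: cmeasurableM; [|apply: cmeasurable_conj]; exact: cmeasurable_dxK.
have xab p t : D t -> cmod (x p t) <= a p.2 * b p.1.
  by move=> Dt; rewrite cmodM cmod_conj ler_pM ?cmod_ge0 ?za ?wb.
have i1 : cintegrable T (fun=> 1).
  by apply: (@cintegrable_bounded _ _ T_gt0 (cmod 1)) => //; exact: cmeasurable_cst.
have := has_sum_intC (fsummableM fa fb) mx xab i1.
have -> : (fun p => intC T (fun t => x p t * 1)) =
    (fun p : int * int => K0 T (z + f p.2) (w + f p.1)).
  apply/funext => p; rewrite K0_integral //.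
  by apply: eq_intC => t _; rewrite mulr1.
congr has_sum; apply: eq_intC => t Dt; rewrite mulr1.
rewrite -(has_sum_sumC (hF t Dt)) -(has_sum_sumC (has_sum_conj (hG t Dt))).
apply: has_sum_sumC; apply: (has_sumM fa fb) => n; first exact: za.
by rewrite cmod_conj wb.
Qed.

Lemma Qinf_Re_sqr z (n : int) : Qinf z -> 0 < complex.Re ((z + n%:~R) ^+ 2).
Proof.
move=> /Qinf_translates[c [m [/andP[c0 _] hc]]]; have [h _] := hc n.
apply: lt_le_trans h; rewrite mulr_gt0 // exprn_gt0 //.
exact: lt_le_trans (bracket_ge1 _).
Qed.

Lemma Kl_integral z w : Qinf z -> Qinf w ->
  Kl T z w = intC T (fun t => dxtheta z (T - t) * (dxtheta w (T - t))^*).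
Proof.
move=> Qz Qw; have [a fa ha] := theta_majorant Qz; have [b fb hb] := theta_majorant Qw.
apply: has_sum_sumC.
apply: (@has_sum_K0 (fun n => 2 * n%:~R) z w a b) => // [n|n|t|t].
- by rewrite even_translate Qinf_Re_sqr.
- by rewrite even_translate Qinf_Re_sqr.
- exact: has_sum_dxtheta.
- exact: has_sum_dxtheta.
Qed.

Lemma Kplus_integral z w : Qinf z -> Qinf w ->
  Kplus T z w = intC T (fun t =>
    (dxtheta z (T - t) + dxtheta (z + 1) (T - t)) *
    (dxtheta w (T - t) + dxtheta (w + 1) (T - t))^*).
Proof.
move=> Qz Qw; have [a fa ha] := dxK_majorant Qz; have [b fb hb] := dxK_majorant Qw.
apply: has_sum_sumC.
apply: (@has_sum_K0 (fun n => n%:~R) z w a b) => // [n|n|t|t].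
- exact: Qinf_Re_sqr.
- exact: Qinf_Re_sqr.
- exact: has_sum_dxtheta2.
- exact: has_sum_dxtheta2.
Qed.

End Theta.

(** * Holomorphy of the controlled states *)

Section Holomorphy.
Context {R : realType}.
Implicit Types (z w h : R[i]).

(** A quadratic remainder is the form in which differentiability survives sums
    and integrals. *)
Lemma derivable_quadratic (f : R[i] -> R[i]) z (l : R[i]) (C d : R) : 0 < d ->
  (forall h, cmod h <= d -> cmod (f (z + h) - f z - h * l) <= C * cmod h ^+ 2) ->
  derivable f z 1.
Proof.
move=> d0 hf; apply/cvg_ex; exists l; apply/cvgrPdist_le.
suff real (e : R) : 0 < e -> \forall h \near 0^',
    `|l - h^-1 *: (f (h *: 1 + z) - f z)| <= e%:C.
  move=> e; rewrite ltcE => /andP[/eqP/= i0 /real].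
  by have -> : (complex.Re e)%:C = e by case: e i0 => a b /= ->.
move=> e0.
have C1 : 0 < `|C| + 1 by rewrite ltr_wpDl.
have r0 : 0 < Num.min d (e / (`|C| + 1)) by rewrite lt_min d0 divr_gt0.
near=> h.
have h0 : h != 0 by near: h; exact: nbhs_dnbhs_neq.
have hr : cmod h <= Num.min d (e / (`|C| + 1)).
  rewrite -lecR -cmodE; near: h; apply: dnbhs0_le.
  by rewrite ltcR.
move: hr; rewrite le_min => /andP[hd he].
have ch0 : 0 < cmod h by rewrite cmod_gt0.
rewrite cmodE lecR -/(cmod _) /=.
have -> : l - h^-1 *: (f (h *: 1 + z) - f z) =
   - (h^-1 * (f (z + h) - f z - h * l)).
  rewrite -[h *: 1]/(h * 1) mulr1 (addrC h) -[_ *: _]/(_ * _).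
  by field.
rewrite cmodN cmodM cmodV mulrC ler_pdivrMr //.
apply: (le_trans (hf h hd)).
rewrite expr2 mulrA ler_wpM2r ?(ltW ch0) //.
move: he; rewrite ler_pdivlMr // => he.
apply: (@le_trans _ _ (cmod h * `|C|)); last by lra.
by rewrite mulrC ler_wpM2l ?(ltW ch0) // ler_norm.
Unshelve. all: by end_near. Qed.

End Holomorphy.

Section ControlOperators.
Context {R : realType} (T : R) (T_gt0 : 0 < T).
Implicit Types (z w h : R[i]) (t : R) (u v : R -> R[i]).

Local Notation D := (itv0 T).

(** Sums [dxK_taylor] over the translates; [E] is the derivative. *)
Lemma theta_taylor z : Qinf z -> exists (E : R -> R[i]) (M C d : R),
  [/\ cmeasurable T E, (forall t, D t -> cmod (E t) <= M), 0 < d &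
  forall h, cmod h <= d -> forall t, D t ->
  cmod (dxtheta (z + h) (T - t) - dxtheta z (T - t) - h * E t) <=
  C * cmod h ^+ 2].
Proof.
move=> Qz; have [c [m [c01 hc]]] := Qinf_translates Qz.
have [C1 C10 hC1] := dxK_taylor c01 (ltW T_gt0).
have [C2 C20 hC2] := dxxK_bound c01 (ltW T_gt0).
pose a (n : int) : R := (bracket (m + 2 * n) ^+ 2)^-1.
have fa : fsummable a.
  apply: (fsummable_inj (f := fun n => m + 2 * n) _ fsummable_bracket2).
  by move=> n p /=; lia.
have [M hM] := fa.2.
have hE t : D t -> forall n : int, cmod (dxxK (z + 2 * n%:~R) (T - t)) <= C2 * a n.
  move=> /itv0_sub ht n; rewrite even_translate; have [h1 h2] := hc (2 * n).
  by apply: hC2 => //; exact: bracket_ge1.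
exists (fun t => sumC (fun n : int => dxxK (z + 2 * n%:~R) (T - t))), (C2 * M), (C1 * M), (c / 20).
have c0 : 0 < c by case/andP: c01.
split; last 1 first.
- move=> h hd t Dt.
  pose rem (n : int) := dxK (z + 2 * n%:~R + h) (T - t) - dxK (z + 2 * n%:~R) (T - t)
    - h * dxxK (z + 2 * n%:~R) (T - t).
  have hrem n : cmod (rem n) <= C1 * cmod h ^+ 2 * a n.
    rewrite -mulrA /rem even_translate; have [h1 h2] := hc (2 * n).
    by apply: hC1 => //; [exact: itv0_sub|exact: bracket_ge1].
  have r0 : 0 <= C1 * cmod h ^+ 2 by rewrite mulr_ge0 // sqr_ge0.
  have srem := has_sum_ex (fsummableZ r0 fa) hrem.
  have sE := has_sum_ex (fsummableZ C20 fa) (hE t Dt).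
  have := has_sumD srem (has_sumD (has_sum_dxtheta T_gt0 Qz Dt) (has_sumZ h sE)).
  set S := sumC rem in srem *; set Et := sumC (fun n : int => dxxK _ _).
  have -> : (fun n : int => rem n + (dxK (z + 2 * n%:~R) (T - t) +
      h * dxxK (z + 2 * n%:~R) (T - t))) = (fun n : int => dxK (z + h + 2 * n%:~R) (T - t)).
    apply/funext => n; have -> : z + h + 2 * n%:~R = z + 2 * n%:~R + h by ring.
    by rewrite /rem; move: (dxK _ _) (dxK _ _) (dxxK _ _) => x y v; ring.
  move=> /has_sum_sumC; rewrite -/(dxtheta (z + h) (T - t)) => ->.
  have -> : S + (dxtheta z (T - t) + h * Et) - dxtheta z (T - t) - h * Et = S.
    by move: (dxtheta _ _) => x; ring.
  rewrite mulrAC.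
  apply: (@cmod_sumC _ _ (fun n => C1 * cmod h ^+ 2 * a n)) => //.
    by move=> n; rewrite mulr_ge0 //; exact: fa.1.
  by move=> J; rewrite -mulr_sumr ler_wpM2l.
- apply: (cmeasurable_sumC (fsummableZ C20 fa)) => [n|n t Dt]; last exact: hE.
  exact: cmeasurable_dxxK.
- move=> t Dt; apply: (@cmod_sumC _ _ (fun n => C2 * a n)) => //.
  + by move=> n; rewrite mulr_ge0 //; exact: fa.1.
  + by move=> J; rewrite -mulr_sumr ler_wpM2l.
  + exact: hE.
- by rewrite divr_gt0.
Qed.

(** Both symmetry classes are treated together: [sg] is [1] or [-1]. *)
Context (sg : R[i]) (sg2 : sg * sg = 1) (sgJ : conjc sg = sg).

Definition thetasg z t : R[i] :=
  dxtheta z (T - t) + sg * dxtheta (z + 1) (T - t).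

Definition control_op u z : R[i] := intC T (fun t => thetasg z t * u t).

Lemma cmeasurable_thetasg z : Qinf z -> cmeasurable T (thetasg z).
Proof.
move=> Qz; apply: cmeasurableD; first exact: cmeasurable_dxtheta.
by apply: cmeasurableZ; apply: cmeasurable_dxtheta => //; exact: (Qinf_addz 1).
Qed.

Lemma thetasg_bound z : Qinf z -> exists M, forall t, D t -> cmod (thetasg z t) <= M.
Proof.
move=> Qz; have [M1 h1] := dxtheta_bound T_gt0 Qz.
have [M2 h2] := dxtheta_bound T_gt0 (Qinf_addz 1 Qz).
exists (M1 + cmod sg * M2) => t Dt; apply: (le_trans (cmodD _ _)).
by rewrite cmodM lerD ?h1 // ler_wpM2l ?cmod_ge0 ?h2.
Qed.

Lemma thetasg_integrable z u : Qinf z -> cintegrable T u ->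
  cintegrable T (fun t => thetasg z t * u t).
Proof.
move=> Qz iu; have [M hM] := thetasg_bound Qz.
by apply: cintegrable_mul hM iu; exact: cmeasurable_thetasg.
Qed.

Lemma thetasgD1 z t : Qinf z -> D t -> thetasg (z + 1) t = sg * thetasg z t.
Proof.
move=> Qz Dt; rewrite /thetasg.
have -> : z + 1 + 1 = z + 2 by ring.
by rewrite dxthetaD2 // mulrDr mulrA sg2 mul1r addrC.
Qed.

Lemma thetasgN z t : Qinf z -> D t -> thetasg (- z) t = - thetasg z t.
Proof.
move=> Qz Dt; rewrite /thetasg dxthetaN //.
have -> : - z + 1 = - (z - 1) by ring.
rewrite dxthetaN ?dxthetaB1 //; last exact: (Qinf_addz (-1)).
by rewrite mulrN opprD.
Qed.

Lemma control_opD1 u z : Qinf z -> cintegrable T u -> control_op u (z + 1) = sg * control_op u z.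
Proof.
move=> Qz iu; rewrite /control_op -intCZ; last exact: thetasg_integrable.
by apply: eq_intC => t Dt; rewrite thetasgD1 // mulrA.
Qed.

Lemma control_opN u z : Qinf z -> cintegrable T u -> control_op u (- z) = - control_op u z.
Proof.
move=> Qz iu; rewrite -[RHS]mulN1r /control_op -intCZ; last exact: thetasg_integrable.
by apply: eq_intC => t Dt; rewrite thetasgN // mulN1r mulNr.
Qed.

Lemma control_opZ a u z : Qinf z -> cintegrable T u ->
  control_op (a *: u) z = a * control_op u z.
Proof.
move=> Qz iu; rewrite /control_op -intCZ; last exact: thetasg_integrable.
by apply: eq_intC => t Dt; rewrite -[(a *: u) t]/(a * u t) mulrCA.
Qed.

Lemma control_op_taylor u z : Qinf z -> cintegrable T u -> exists (l : R[i]) (C d : R),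
  0 < d /\ forall h, cmod h <= d ->
  cmod (control_op u (z + h) - control_op u z - h * l) <= C * cmod h ^+ 2.
Proof.
move=> Qz iu.
have [E1 [M1 [C1 [d1 [mE1 hE1 d10 h1]]]]] := theta_taylor Qz.
have [E2 [M2 [C2 [d2 [mE2 hE2 d20 h2]]]]] := theta_taylor (Qinf_addz 1 Qz).
have [d3 d30 h3] := Qinf_open Qz.
pose E t := E1 t + sg * E2 t.
have mE : cmeasurable T E by apply: cmeasurableD => //; exact: cmeasurableZ.
have iE : cintegrable T (fun t => E t * u t).
  apply: (cintegrable_mul (M := M1 + cmod sg * M2)) => // t Dt.
  apply: (le_trans (cmodD _ _)).
  by rewrite cmodM lerD ?hE1 // ler_wpM2l ?cmod_ge0 ?hE2.
pose k t := `|complex.Re (u t)| + `|complex.Im (u t)|.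
have ik : lebesgue_measure.-integrable D (EFin \o k).
  by case: iu => u1 u2; apply: integrable_add; exact: integrable_norm.
pose K := \int[lebesgue_measure]_(t in D) k t.
exists (intC T (fun t => E t * u t)), (2 * ((C1 + cmod sg * C2) * K)).
exists (Num.min d1 (Num.min d2 d3)); split; first by rewrite !lt_min d10 d20.
move=> h; rewrite !le_min => /and3P[hd1 hd2 hd3].
have Qzh := h3 h hd3.
have i1 := thetasg_integrable Qzh iu; have i0 := thetasg_integrable Qz iu.
have -> : control_op u (z + h) - control_op u z - h * intC T (fun t => E t * u t) =
    intC T (fun t => (thetasg (z + h) t - thetasg z t - h * E t) * u t).
  rewrite -intCZ // /control_op -intCB // -intCB //; last 2 first.
  - exact: cintegrableB.
  - exact: cintegrableZ.
  by apply: eq_intC => t _; ring.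
have -> : 2 * ((C1 + cmod sg * C2) * K) * cmod h ^+ 2 =
    2 * \int[lebesgue_measure]_(t in D) ((C1 + cmod sg * C2) * cmod h ^+ 2 * k t).
  by rewrite RintegralZl // -/K; ring.
apply: cmod_intC.
- have := cintegrableB (cintegrableB i1 i0) (cintegrableZ h iE).
  congr cintegrable; apply/funext => t; ring.
- exact: integrable_scale.
- move=> t Dt; rewrite cmodM; apply: ler_pM; rewrite ?cmod_ge0 ?cmod_le //.
  have -> : thetasg (z + h) t - thetasg z t - h * E t =
    (dxtheta (z + h) (T - t) - dxtheta z (T - t) - h * E1 t) +
    sg * (dxtheta (z + 1 + h) (T - t) - dxtheta (z + 1) (T - t) - h * E2 t).
    rewrite /thetasg /E; have -> : z + h + 1 = z + 1 + h by ring.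
    by move: (dxtheta _ _) (dxtheta _ _) (dxtheta _ _) (dxtheta _ _) => x1 x2 x3 x4; ring.
  apply: (le_trans (cmodD _ _)); rewrite cmodM mulrDl -mulrA.
  by rewrite lerD ?h1 // ler_wpM2l ?cmod_ge0 ?h2.
Qed.

End ControlOperators.

(** * The reachable space *)

Section ReachableSpace.
Context {R : realType} (T : R) (T_gt0 : 0 < T).
Context (sg : R[i]) (sg2 : sg * sg = 1) (sgJ : conjc sg = sg).
Implicit Types (z w h : R[i]) (t : R) (u v : R -> R[i]).

Local Notation D := (itv0 T).
Local Notation Phi := (thetasg T sg).
Local Notation Lsg := (control_op T sg).

(** The Riesz representer of evaluation at [w] after the control operator. *)
Definition representer (w : Qsq (R := R)) : R -> R[i] :=
  fun t => conjc (Phi (val w) t).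

Lemma Qsq_val (w : Qsq (R := R)) : Qinf (val w).
Proof. by apply: Qsq_Qinf; apply/set_mem; exact: valP. Qed.

Lemma L2C_representer (w : Qsq (R := R)) : L2C T (representer w).
Proof.
have [M hM] := thetasg_bound T_gt0 sg (Qsq_val w).
apply: (L2C_bounded (M := M) T_gt0) => [|t Dt].
  by apply: cmeasurable_conj; apply: cmeasurable_thetasg => //; exact: Qsq_val.
by rewrite cmod_conj hM.
Qed.

Lemma coef_representer u : coef (dotL2 T) representer u = onQ (Lsg u).
Proof.
apply/funext => x; apply: eq_intC => t _.
by rewrite /representer conjE conjcK mulrC.
Qed.

Lemma gram_representer (z w : Qsq (R := R)) :
  dotL2 T (representer w) (representer z) =
  intC T (fun t => Phi (val z) t * (Phi (val w) t)^*).
Proof.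
by apply: eq_intC => t _; rewrite /representer conjE conjcK mulrC.
Qed.

Lemma dxtheta_mul_integrable z w : Qinf z -> Qinf w ->
  cintegrable T (fun t => dxtheta z (T - t) * (dxtheta w (T - t))^*).
Proof.
move=> Qz Qw; have [M hM] := dxtheta_bound T_gt0 Qz.
have [N hN] := dxtheta_bound T_gt0 Qw.
apply: (cintegrable_mul (M := M)) => //; first exact: cmeasurable_dxtheta.
apply: (cintegrable_bounded (M := N) T_gt0) => [|t Dt].
  by apply: cmeasurable_conj; exact: cmeasurable_dxtheta.
by rewrite cmod_conj hN.
Qed.

Lemma intC_lin4 (f0 f1 f2 f3 : R -> R[i]) : cintegrable T f0 ->
  cintegrable T f1 -> cintegrable T f2 -> cintegrable T f3 ->
  intC T f0 + intC T f1 + sg * intC T f2 + sg * intC T f3 =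
  intC T (fun t => f0 t + f1 t + sg * f2 t + sg * f3 t).
Proof.
move=> i0 i1 i2 i3; rewrite -(intCZ sg i2) -(intCZ sg i3) -(intCD i0 i1).
have i01 := cintegrableD i0 i1; have j2 := cintegrableZ sg i2.
by rewrite -(intCD i01 j2) -(intCD (cintegrableD i01 j2) (cintegrableZ sg i3)).
Qed.

Lemma thetasg_gram z w : Qinf z -> Qinf w ->
  intC T (fun t => Phi z t * (Phi w t)^*) =
  Kl T z w + Kl T (z + 1) (w + 1) + sg * Kl T (z + 1) w + sg * Kl T z (w + 1).
Proof.
move=> Qz Qw.
have Qz1 : Qinf (z + 1) by exact: (Qinf_addz 1).
have Qw1 : Qinf (w + 1) by exact: (Qinf_addz 1).
have i0 := dxtheta_mul_integrable Qz Qw.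
have i1 := dxtheta_mul_integrable Qz1 Qw1.
have i2 := dxtheta_mul_integrable Qz1 Qw.
have i3 := dxtheta_mul_integrable Qz Qw1.
rewrite (Kl_integral T_gt0 Qz Qw) (Kl_integral T_gt0 Qz1 Qw1).
rewrite (Kl_integral T_gt0 Qz1 Qw) (Kl_integral T_gt0 Qz Qw1).
rewrite (intC_lin4 i0 i1 i2 i3).
apply: eq_intC => t _; rewrite /thetasg !conjE conjD conjM sgJ mulrDl !mulrDr.
rewrite mulrACA sg2 mul1r -!mulrA (mulrCA _ sg).
move: (dxtheta _ _ * _) (dxtheta _ _ * _) => x y; ring.
Qed.

Lemma symmetric_ext (f g : R[i] -> R[i]) :
  (forall z, Qinf z -> sg * f (z + 1) = f z) ->
  (forall z, Qinf z -> sg * g (z + 1) = g z) ->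
  (forall z, Qsq z -> f z = g z) -> forall z, Qinf z -> f z = g z.
Proof.
move=> hf hg fg z [m _ [q Qq <-]].
have Qi := Qsq_Qinf Qq.
have up (k : R[i] -> R[i]) : (forall z, Qinf z -> sg * k (z + 1) = k z) ->
    forall z, Qinf z -> k (z + 1) = sg * k z.
  by move=> hk x Qx; rewrite -(hk x Qx) mulrA sg2 mul1r.
have Qn (n : int) : Qinf (q + n%:~R) by exact: Qinf_addz.
rewrite addrC; case: m => n.
  elim: n => [|n IH]; first by rewrite addr0 fg.
  have -> : q + n.+1%:~R = q + n%:~R + 1 :> R[i].
    by rewrite -addrA -(intrD _ n 1); congr (_ + _%:~R); lia.
  by rewrite (up f hf) ?(up g hg) ?IH.
elim: n => [|n IH].
  rewrite -(hf _ (Qn _)) -(hg _ (Qn _)).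
  have -> : q + (Negz 0)%:~R + 1 = q by rewrite NegzE rmorphN /= subrK.
  by rewrite fg.
rewrite -(hf _ (Qn _)) -(hg _ (Qn _)).
have -> : q + (Negz n.+1)%:~R + 1 = q + (Negz n)%:~R :> R[i].
  by rewrite -addrA -(intrD _ _ 1); congr (_ + _%:~R); lia.
by rewrite IH.
Qed.

Lemma heat_sol_control_op u z : L2C T u -> Qinf z ->
  heat_sol u (fun t => - (sg * u t)) z T = - 2 * Lsg u z.
Proof.
move=> Lu Qz; have iu := L2C_integrable T_gt0 Lu.
have Qz1 : Qinf (z + 1) by exact: (Qinf_addz 1).
have int_theta y : Qinf y -> cintegrable T (fun t => dxtheta y (T - t) * u t).
  move=> Qy; have [M hM] := dxtheta_bound T_gt0 Qy.
  by apply: cintegrable_mul hM iu; exact: cmeasurable_dxtheta.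
rewrite /heat_sol.
have -> : intC T (fun t => dxtheta (z - 1) (T - t) * - (sg * u t)) =
    - sg * intC T (fun t => dxtheta (z + 1) (T - t) * u t).
  rewrite -intCZ; last exact: int_theta.
  by apply: eq_intC => t Dt; rewrite dxthetaB1 //; ring.
have -> : Lsg u z = intC T (fun t => dxtheta z (T - t) * u t) +
    sg * intC T (fun t => dxtheta (z + 1) (T - t) * u t).
  rewrite -intCZ; last exact: int_theta.
  rewrite -intCD; [|exact: int_theta|by apply: cintegrableZ; exact: int_theta].
  by apply: eq_intC => t _; rewrite /thetasg; ring.
by move: (intC _ _) (intC _ _) => A B; ring.
Qed.

(** A function with the symmetries is determined by its restriction to [Q],
    so being reachable is a condition on that restriction only. *)
Lemma reachable_iff (f : R[i] -> R[i]) :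
  (exists2 u, L2C T u & forall z, Qinf z -> f z = - 2 * Lsg u z) <->
  [/\ hol Qinf f,
      (forall z, Qinf z -> sg * f (z + 1) = f z /\ f z = - f (- z)) &
      range_space (L2C T) (dotL2 T) representer (onQ f)].
Proof.
have SH := L2C_semi_hilbert T_gt0.
split=> [[u Lu fu]|[_ fsym [u Lu]]].
  have iu := L2C_integrable T_gt0 Lu; split.
  - move=> z Qz; have [l [C [d [d0 hl]]]] := control_op_taylor T_gt0 sg Qz iu.
    have [d' d'0 hd'] := Qinf_open Qz.
    apply: (@derivable_quadratic _ f z (- 2 * l) (2 * C) (Num.min d d')).
      by rewrite lt_min d0.
    move=> h; rewrite le_min => /andP[hd hhd'].
    rewrite !fu //; last exact: hd'.
    have e (a b : R[i]) : - 2 * a - - 2 * b - h * (- 2 * l) =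
      - (2 * (a - b - h * l)) by ring.
    by rewrite e cmodN cmodM cmod_nat -mulrA ler_wpM2l // hl.
  - move=> z Qz; rewrite !fu //; [|exact: QinfN|exact: (Qinf_addz 1)].
    rewrite control_opD1 // control_opN // mulrN opprK; split => //.
    by rewrite mulrCA (mulrA sg) sg2 mul1r.
  - exists (- 2 *: u); first exact: (shZ SH).
    rewrite coef_representer; apply/funext => x; rewrite /onQ fu; last exact: Qsq_val.
    by rewrite control_opZ //; exact: Qsq_val.
rewrite coef_representer => fu; have iu := L2C_integrable T_gt0 Lu.
exists ((- 2^-1) *: u); first exact: (shZ SH).
have iv := L2C_integrable T_gt0 (shZ SH (- 2^-1) Lu).
apply: symmetric_ext => [z /fsym[]//|z Qz|z Qz].
  by rewrite control_opD1 // mulrCA (mulrA sg) sg2 mul1r.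
have := congr1 (@^~ (exist _ z (mem_set Qz) : Qsq (R := R))) fu.
rewrite /onQ /= => ->; rewrite control_opZ //; last exact: Qsq_Qinf.
rewrite mulrA mulrNN mulfV ?mul1r //.

Qed.

(** [v |-> - 2 v] exchanges the controls that steer to the state with the
    representatives of the coefficient function. *)
Lemma control_norm_range (L : (R -> R[i]) -> R[i] -> R[i]) u :
  (forall v z, L2C T v -> Qsq z -> L v z = Lsg v z) -> L2C T u ->
  ipnorm (range_dot (L2C T) (dotL2 T) representer) (coef (dotL2 T) representer u) =
  2 * control_norm L T (coef (dotL2 T) representer u).
Proof.
move=> hL Lu; have SH := L2C_semi_hilbert T_gt0.
rewrite (range_space_norm SH L2C_representer Lu) /control_norm.
set B := [set r | exists v, _]; set A := [set r | exists v, _].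
have LB v : L2C T v -> onQ (fun z => - 2 * L v z) = coef (dotL2 T) representer (- 2 *: v).
  move=> Lv; have iv := L2C_integrable T_gt0 Lv.
  rewrite coef_representer; apply/funext => x; rewrite /onQ control_opZ //; last exact: Qsq_val.
  by rewrite hL //; apply/set_mem; exact: valP.
have c2 : cmod (- 2 : R[i]) = 2 by rewrite cmodN cmod_nat.
have AB r : A r -> B (r / 2).
  move=> [v [Lv cv ->]]; have Lw := shZ SH (- 2^-1) Lv.
  exists (- 2^-1 *: v); split => //.
    rewrite (LB _ Lw).
    by rewrite scalerA mulrNN mulfV ?scale1r ?cv // (pnatr_eq0 _ 2).
  rewrite -dotnorm_L2norm (dotnormZ SH) // cmodN cmodV cmod_nat mulrC.
  by rewrite dotnorm_L2norm.
have BA r : B r -> A (2 * r).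
  move=> [v [Lv cv ->]]; exists (- 2 *: v); split.
  - exact: (shZ SH).
  - by rewrite -(LB _ Lv).
  - by rewrite (dotnormZ SH) // c2 dotnorm_L2norm.
have A0 : A !=set0 by exists (dotnorm (dotL2 T) u), u.
have lbA : has_lbound A by exists 0 => _ [v [_ _ ->]]; exact: dotnorm_ge0.
have lbB : has_lbound B by exists 0 => _ [v [_ _ ->]]; exact: sqrtr_ge0.
apply/eqP; rewrite eq_le; apply/andP; split; last first.
  apply: lb_le_inf => // r /AB /(inf_lbound lbB); lra.
suff : inf A / 2 <= inf B by lra.
apply: lb_le_inf; first by case: A0 => r /AB h; exists (r / 2).
by move=> r /BA /(inf_lbound lbA); lra.
Qed.

(** The kernel [K] and the operator [L] are abstract because they are written
    differently for the two signs. *)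
Lemma reachable_space_rkhs (K : R[i] -> R[i] -> R[i])
    (L : (R -> R[i]) -> R[i] -> R[i]) :
  (forall z w, Qsq z -> Qsq w ->
     K z w = intC T (fun t => Phi z t * (Phi w t)^*)) ->
  (forall v z, L2C T v -> Qsq z -> L v z = Lsg v z) ->
  exists (H : set (Qsq (R := R) -> R[i]))
         (ip : (Qsq (R := R) -> R[i]) -> (Qsq (R := R) -> R[i]) -> R[i]),
     [/\ is_rkhs H ip (kernel_onQ K),
         (forall f, H f -> ipnorm ip f = 2 * control_norm L T f) &
         [set f | exists2 u, L2C T u &
            forall z, Qinf z -> f z = heat_sol u (fun t => - (sg * u t)) z T] =
         [set f | [/\ hol Qinf f,
                      (forall z : R[i], Qinf z ->
                         sg * f (z + 1) = f z /\ f z = - f (- z)) &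
                      H (onQ f)]]].
Proof.
move=> hK hL; have SH := L2C_semi_hilbert T_gt0.
exists (range_space (L2C T) (dotL2 T) representer).
exists (range_dot (L2C T) (dotL2 T) representer); split.
- have -> : kernel_onQ K = fun x y => dotL2 T (representer y) (representer x).
    apply/funext => x; apply/funext => y; rewrite gram_representer.
    by apply: hK; apply/set_mem; exact: valP.
  exact: (range_space_rkhs SH L2C_representer).
- by move=> f [u Lu ->]; exact: control_norm_range.
- apply/seteqP; split => f /=.
    move=> [u Lu fu]; apply/reachable_iff; exists u => // z Qz.
    by rewrite fu // heat_sol_control_op.
  move=> /reachable_iff[u Lu fu]; exists u => // z Qz.
  by rewrite fu // heat_sol_control_op.
Qed.

End ReachableSpace.

Theorem theorem3 (R : realType) (T : R) (T_gt0 : 0 < T) :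
  ((forall z w : R[i], Qsq z -> Qsq w ->
      Kplus T z w = Kl T z w + Kl T (z + 1) (w + 1)
                    + Kl T (z + 1) w + Kl T z (w + 1)) /\
   exists (H : set (Qsq (R := R) -> R[i]))
          (ip : (Qsq (R := R) -> R[i]) -> (Qsq (R := R) -> R[i]) -> R[i]),
     [/\ is_rkhs H ip (kernel_onQ (Kplus T)),
         (forall f, H f -> ipnorm ip f = 2 * control_norm (Lplus T) T f) &
         reach_plus T =
           [set f | [/\ hol Qinf f,
                        (forall z : R[i], Qinf z ->
                           f (z + 1) = f z /\ f z = - f (- z)) &
                        H (onQ f)]]]) /\
  (exists (H : set (Qsq (R := R) -> R[i]))
          (ip : (Qsq (R := R) -> R[i]) -> (Qsq (R := R) -> R[i]) -> R[i]),
     [/\ is_rkhs H ip (kernel_onQ (Kminus T)),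
         (forall f, H f -> ipnorm ip f = 2 * control_norm (Lminus T) T f) &
         reach_minus T =
           [set f | [/\ hol Qinf f,
                        (forall z : R[i], Qinf z ->
                           - f (z + 1) = f z /\ f z = - f (- z)) &
                        H (onQ f)]]]).
Proof.
have s1 : (1 : R[i]) * 1 = 1 by rewrite mulr1.
have J1 : conjc (1 : R[i]) = 1 by exact: conjc1.
have s2 : (- 1 : R[i]) * - 1 = 1 by rewrite mulrNN mulr1.
have J2 : conjc (- 1 : R[i]) = - 1 by rewrite conjN conjc1.
have Kp (z w : R[i]) : Qsq z -> Qsq w ->
    Kplus T z w = intC T (fun t => thetasg T 1 z t * (thetasg T 1 w t)^*).
  move=> /Qsq_Qinf Qz /Qsq_Qinf Qw; rewrite Kplus_integral //.
  by apply: eq_intC => t _; rewrite /thetasg !mul1r.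
have Km (z w : R[i]) : Qsq z -> Qsq w ->
    Kminus T z w = intC T (fun t => thetasg T (- 1) z t * (thetasg T (- 1) w t)^*).
  move=> /Qsq_Qinf Qz /Qsq_Qinf Qw; rewrite (thetasg_gram T_gt0 s2 J2) //.
  by rewrite /Kminus !mulN1r.
have Lp v (z : R[i]) : L2C T v -> Qsq z -> Lplus T v z = control_op T 1 v z.
  by move=> _ _; apply: eq_intC => t _; rewrite /thetasg mul1r.
have Lm v (z : R[i]) : L2C T v -> Qsq z -> Lminus T v z = control_op T (- 1) v z.
  by move=> _ _; apply: eq_intC => t _; rewrite /thetasg mulN1r.
split; first split.
- move=> z w Qz Qw; rewrite Kp // (thetasg_gram T_gt0 s1 J1) ?mul1r //; exact: Qsq_Qinf.
- have [H [ip [h1 h2 h3]]] := reachable_space_rkhs T_gt0 s1 Kp Lp.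
  exists H, ip; split => //; rewrite /reach_plus.
  apply/seteqP; split => f /=.
    move=> [u Lu fu]; have : [set f | exists2 u, L2C T u &
        forall z, Qinf z -> f z = heat_sol u (fun t => - (1 * u t)) z T] f.
      by exists u => // z Qz; rewrite fu //; congr heat_sol; apply/funext => t; rewrite mul1r.
    rewrite h3 => -[hf fsym Hf]; split => // z Qz.
    by have [] := fsym z Qz; rewrite mul1r.
  move=> [hf fsym Hf].
  have : [set f | [/\ hol Qinf f, (forall z : R[i], Qinf z ->
      1 * f (z + 1) = f z /\ f z = - f (- z)) & H (onQ f)]] f.
    by split => // z Qz; rewrite mul1r; exact: fsym.
  rewrite -h3 => -[u Lu fu]; exists u => // z Qz; rewrite fu //.
  by congr heat_sol; apply/funext => t; rewrite mul1r.
- have [H [ip [h1 h2 h3]]] := reachable_space_rkhs T_gt0 s2 Km Lm.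
  exists H, ip; split => //; rewrite /reach_minus.
  apply/seteqP; split => f /=.
    move=> [u Lu fu]; have : [set f | exists2 u, L2C T u &
        forall z, Qinf z -> f z = heat_sol u (fun t => - (- 1 * u t)) z T] f.
      exists u => // z Qz; rewrite fu //; congr heat_sol; apply/funext => t.
      by rewrite mulN1r opprK.
    rewrite h3 => -[hf fsym Hf]; split => // z Qz.
    by have [] := fsym z Qz; rewrite mulN1r.
  move=> [hf fsym Hf].
  have : [set f | [/\ hol Qinf f, (forall z : R[i], Qinf z ->
      - 1 * f (z + 1) = f z /\ f z = - f (- z)) & H (onQ f)]] f.
    by split => // z Qz; rewrite mulN1r; exact: fsym.
  rewrite -h3 => -[u Lu fu]; exists u => // z Qz; rewrite fu //.
  by congr heat_sol; apply/funext => t; rewrite mulN1r opprK.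
Qed.
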